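(* Let $\alpha\in\mathbb{C}\setminus\mathbb{Z}$ with $\mathrm{Re}(\alpha)<0$, and let $z\in\mathbb{C}$ with $\mathrm{Re}(z)<0$ and $|z|<2\pi$. Then $$\mathrm{Li}_\alpha(e^z)=C_\alpha z^{\alpha-1}+\sum_{n=0}^\infty\frac{\zeta(\alpha-n)}{n!}z^n .$$
   Context: $\mathrm{Li}_\alpha(w)=\sum_{n=1}^\infty w^n/n^\alpha$ for $|w|<1$ (here $|e^z|<1$). $C_\alpha=e^{\pi i(-\alpha-1)}\Gamma(1-\alpha)$. The power is $z^{\alpha-1}=e^{(\alpha-1)(\ln|z|+i\arg z)}$ with $\arg z\in(0,2\pi)$, so that $\arg z\in(\pi/2,3\pi/2)$ for $\mathrm{Re}(z)<0$. $\zeta$ is the (analytically continued) Riemann zeta function. *)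

(* Defs.v *)
From Stdlib Require Import Reals Lra ZArith ClassicalEpsilon.
From Coquelicot Require Import Coquelicot.
Open Scope R_scope.

Definition Cexp (z : C) : C :=
  (exp (Re z) * cos (Im z), exp (Re z) * sin (Im z)).

(* The sum of a convergent complex series, taken componentwise since [Series]
   is real-valued. Like [Series], it is only meaningful when the series
   converges. *)
Definition CSeries (a : nat -> C) : C :=
  (Series (fun n => Re (a n)), Series (fun n => Im (a n))).

(* t^s for a real base t > 0. *)
Definition Rcpow (t : R) (s : C) : C := Cexp (s * ln t)%C.

(* The argument in (0, 2 PI), for z off the half-line [0, +oo).
   On that half-line the value is not meaningful. *)
Definition arg (z : C) : R :=
  if Rlt_dec 0 (Im z) then acos (Re z / Cmod z)
  else 2 * PI - acos (Re z / Cmod z).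

(* z^s for z off the half-line [0, +oo), with arg z in (0, 2 PI). *)
Definition Cpower (z s : C) : C :=
  Cexp (s * (ln (Cmod z) + Ci * arg z))%C.

(* Euler's integral, which is the Gamma function for Re s > 0 only. *)
Definition Gamma (s : C) : C :=
  let f t := (Rcpow t (s - 1) * exp (- t))%C in
  (RInt_gen (fun t => Re (f t)) (at_right 0) (Rbar_locally p_infty),
   RInt_gen (fun t => Im (f t)) (at_right 0) (Rbar_locally p_infty)).

(* The term of index n carries the exponent n + 1 since the sum starts at 1.
   Meaningful for |w| < 1. *)
Definition polylog (alpha w : C) : C :=
  CSeries (fun n => w ^ (S n) / Rcpow (INR (S n)) alpha)%C.

Definition analytic_at (f : C -> C) (s : C) : Prop :=
  exists (r : R) (a : nat -> C), 0 < r /\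
    forall h : C, Cmod h < r -> is_pseries a h (f (s + h)%C).

(* f is the analytic continuation to C \ {1} of sum_(n >= 1) 1 / n^s.
   By the identity theorem this determines f off 1. *)
Definition is_zeta (f : C -> C) : Prop :=
  (forall s : C, 1 < Re s ->
     is_series (fun n => / Rcpow (INR (S n)) s)%C (f s)) /\
  (forall s : C, s <> RtoC 1 -> analytic_at f s).

(* The value at 1 is arbitrary. *)
Definition riemann_zeta : C -> C :=
  epsilon (inhabits (fun _ : C => RtoC 0)) is_zeta.

Definition C_alpha (alpha : C) : C :=
  (Cexp (PI * Ci * (- alpha - 1)) * Gamma (1 - alpha))%C.

Lemma arg_spec (z : C) : ~ (Im z = 0 /\ 0 <= Re z) ->
  0 < arg z < 2 * PI /\ z = (RtoC (Cmod z) * Cexp (Ci * arg z))%C.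
Proof.
destruct z as [x y]; unfold arg; simpl; intros H.
set (m := Cmod (x, y)).
assert (m2 : m * m = x * x + y * y).
{ unfold m, Cmod; simpl. rewrite sqrt_sqrt; nra. }
assert (m0 : 0 < m).
{ apply Cmod_gt_0; intros E; injection E as -> ->; apply H; simpl; lra. }
set (q := x / m).
assert (xq : x = q * m) by (unfold q; field; lra).
assert (q2 : q * q <= 1).
{ apply Rmult_le_reg_r with (m * m); nra. }
assert (q1 : -1 <= q <= 1) by nra.
assert (q1' : q < 1).
{ destruct (Rlt_dec q 1) as [|n]; [easy|]. exfalso; apply H.
  assert (q = 1) by lra. split; nra. }
pose proof (acos_bound q) as [a0 a1].
pose proof (cos_acos q q1) as ca.
assert (a0' : 0 < acos q).
{ destruct a0 as [|a0]; [easy|]. rewrite <- a0, cos_0 in ca; lra. }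
pose proof (sin2_cos2 (acos q)) as sc; unfold Rsqr in sc; rewrite ca in sc.
pose proof (sin_ge_0 _ (Rlt_le _ _ a0') a1) as s0.
assert (ys : y * y = (m * sin (acos q)) * (m * sin (acos q))) by nra.
pose proof PI_RGT_0.
assert (E : forall t : R, (RtoC m * Cexp (Ci * t))%C = (m * cos t, m * sin t)).
{ intros t; unfold Cexp, Cmult, Ci, RtoC, Re, Im; simpl.
  replace (0 * t - 1 * 0) with 0 by ring.
  replace (0 * 0 + 1 * t) with t by ring.
  rewrite exp_0; f_equal; ring. }
rewrite E; clear E.
destruct (Rlt_dec 0 y) as [y0|y0].
- split; [lra|].
  rewrite ca. apply injective_projections; simpl; [lra|].
  assert (0 <= m * sin (acos q)) by nra. nra.
- split; [lra|].
  rewrite cos_minus, sin_minus, cos_2PI, sin_2PI, ca.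
  apply injective_projections; simpl; [lra|].
  assert (0 <= m * sin (acos q)) by nra. nra.
Qed.

(* Main.v *)
Require Import Defs.
From Stdlib Require Import Reals ZArith.
From Coquelicot Require Import Coquelicot.
From Stdlib Require Import Lra Lia ClassicalEpsilon FunctionalExtensionality.
Open Scope R_scope.

(** Put [b = 1 - alpha] and [w = - z], so that [Re b > 1] and [Re w > 0]. The left-hand
    side is the sum over [n >= 1] of [n ^ (b - 1) * exp (- n w)], called [psum b w]. The
    proof rests on the Lipschitz formula ([lipschitz_formula])

      [psum b w = Gamma b * sum over all integers k of (w + 2 PI i k) ^ (- b)].

    Its term [k = 0] is the singular term [C_alpha * z ^ (alpha - 1)]. Every other term is
    analytic for [|w| < 2 PI] and is expanded by the binomial series; exchanging the two
    summations ([psum_expansion]) gives a power series in [z] whose coefficient of index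
    [n] is [Gamma (b + n) / n!] times the sum [zsum (b + n)] of [(2 PI i k) ^ (- b - n)]
    over [k <> 0]. It remains to recognise [Gamma (b + n) * zsum (b + n)] as
    [zeta (alpha - n)]; this is the functional equation of zeta, [riemann_zeta_left].

    The Lipschitz formula is proved without Fourier analysis. Integration along a rotated
    ray gives [Gamma b * u ^ (- b)] as the Laplace transform of [t ^ (b - 1)] for complex
    [u] ([laplace_Gamma]). Replacing the power by its piecewise linear interpolant at the
    integers turns this transform into [psum b u] times an explicit factor [hatK u] that
    tends to 1 at 0, up to an error that is controlled uniformly in a strip
    ([laplace_psum_error]). On the other hand, averaging over the roots of unity of order
    [M = 2 N + 1] gives the exact identity ([psum_average])

      [M ^ b * psum b w = sum over |j| <= N of psum b ((w + 2 PI i j) / M)].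

    Inserting the approximation on the right, the main terms tend to the terms of the
    Lipschitz formula by dominated convergence, and the errors tend to 0.

    For zeta, one needs the existence of the continuation, its uniqueness, and its values
    for [Re s < 0]. On [Re s > 0] the function [(s - 1) zeta s] is the sum of a series
    that compares [n ^ (- s)] with its integral. On [Re s < 1], zeta is the quotient of
    the alternating series by [1 - 2 ^ (1 - s)], which has no zero there; the alternating
    series is summed by repeated summation by parts, which makes it converge absolutely
    for every [s] and equal to its Abel sum ([eta_Abel]). Analyticity follows from a
    theorem of Weierstrass ([AN_series]), itself a consequence of Cauchy's estimates
    ([cauchy_estimate]); agreement of the two expressions and uniqueness follow from the
    identity theorem along a segment ([identity_segment]). For [Re s < 0] the value
    [(1 - 2 ^ (1 - s)) * zeta s] is thus the limit, as [x] tends to 0, of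
    [psum b x - 2 ^ b * psum b (2 x)] with [b = 1 - s]; in this combination the singular
    terms of [psum_expansion] cancel, and its constant terms give the functional
    equation. *)

(** * Complex numbers, the exponential and powers of positive reals *)

Lemma C_eq (a b : C) : Re a = Re b -> Im a = Im b -> a = b.
Proof. destruct a, b; simpl; intros; f_equal; easy. Qed.

Lemma Re_minus (a b : C) : Re (a - b) = Re a - Re b.
Proof. unfold Cminus; rewrite re_plus, re_opp; ring. Qed.

Lemma Im_minus (a b : C) : Im (a - b) = Im a - Im b.
Proof. unfold Cminus; rewrite im_plus, im_opp; ring. Qed.

Lemma im_le_Cmod (c : C) : Rabs (Im c) <= Cmod c.
Proof. eapply Rle_trans; [apply Rmax_r|apply (Rmax_Cmod c)]. Qed.

Lemma Cmod_le_Re_Im (c : C) : Cmod c <= Rabs (Re c) + Rabs (Im c).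
Proof.
replace c with (RtoC (Re c) + Ci * RtoC (Im c))%C at 1.
2: { apply C_eq; simpl; ring. }
eapply Rle_trans; [apply Cmod_triangle|].
rewrite Cmod_mult, Cmod_Ci, !Cmod_R; lra.
Qed.

Lemma Cmod_minus_sym (a b : C) : Cmod (a - b) = Cmod (b - a).
Proof. rewrite <- Cmod_opp; f_equal; ring. Qed.

Lemma Cmod_triangle_minus (a b : C) : Cmod (a - b) <= Cmod a + Cmod b.
Proof. unfold Cminus; rewrite <- (Cmod_opp b); apply Cmod_triangle. Qed.

Lemma Cmod_triangle_rev (a b : C) : Cmod a - Cmod b <= Cmod (a + b).
Proof.
replace a with ((a + b) - b)%C at 1 by ring.
pose proof (Cmod_triangle_minus (a + b) b); lra.
Qed.

Lemma Cmod_pos_R (x : R) : 0 <= x -> Cmod (RtoC x) = x.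
Proof. intros; rewrite Cmod_R; now apply Rabs_pos_eq. Qed.

Lemma RtoC_neq_0 (x : R) : x <> 0 -> RtoC x <> RtoC 0.
Proof. intros H E; apply H; now apply RtoC_inj. Qed.

Lemma Re_pos_neq_0 (z : C) : 0 < Re z -> z <> RtoC 0.
Proof. intros H E; rewrite E in H; simpl in H; lra. Qed.

Lemma Cexp_plus (a b : C) : Cexp (a + b) = (Cexp a * Cexp b)%C.
Proof.
unfold Cexp; rewrite re_plus, im_plus, exp_plus, cos_plus, sin_plus.
apply C_eq; simpl; ring.
Qed.

Lemma Cexp_RtoC (x : R) : Cexp x = RtoC (exp x).
Proof. unfold Cexp; simpl; rewrite cos_0, sin_0; apply C_eq; simpl; ring. Qed.

Lemma Cexp_0 : Cexp 0 = RtoC 1.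
Proof. rewrite Cexp_RtoC, exp_0; easy. Qed.

Lemma Cmod_Cexp (z : C) : Cmod (Cexp z) = exp (Re z).
Proof.
unfold Cmod, Cexp; simpl.
replace (_ + _) with (exp (Re z) * exp (Re z)).
- apply sqrt_square; left; apply exp_pos.
- pose proof (sin2_cos2 (Im z)) as H; unfold Rsqr in H.
  transitivity (exp (Re z) * exp (Re z) *
    (sin (Im z) * sin (Im z) + cos (Im z) * cos (Im z))); [rewrite H|]; ring.
Qed.

Lemma Cexp_neq_0 (z : C) : Cexp z <> RtoC 0.
Proof. apply Cmod_gt_0; rewrite Cmod_Cexp; apply exp_pos. Qed.

Lemma Cexp_opp (z : C) : Cexp (- z) = (/ Cexp z)%C.
Proof.
assert (H : (Cexp (- z) * Cexp z)%C = RtoC 1).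
{ rewrite <- Cexp_plus, <- Cexp_0; f_equal; ring. }
rewrite <- (Cmult_1_l (/ Cexp z)), <- H; field; apply Cexp_neq_0.
Qed.

Lemma Cexp_minus (a b : C) : Cexp (a - b) = (Cexp a / Cexp b)%C.
Proof. unfold Cminus, Cdiv; now rewrite Cexp_plus, Cexp_opp. Qed.

Lemma Cexp_nat (n : nat) (z : C) : Cexp (INR n * z) = (Cexp z ^ n)%C.
Proof.
induction n as [|n IH].
- simpl; rewrite Cmult_0_l; apply Cexp_0.
- rewrite S_INR, RtoC_plus, Cpow_S, <- IH, <- Cexp_plus; f_equal; ring.
Qed.

Lemma Cexp_Ci (t : R) : Cexp (Ci * t) = (cos t, sin t).
Proof.
unfold Cexp; replace (Re (Ci * t)) with 0 by (simpl; ring).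
replace (Im (Ci * t)) with t by (simpl; ring).
rewrite exp_0; f_equal; ring.
Qed.

(** The periods of the exponential are the multiples of [2 PI i]. *)
Lemma Cexp_inj (a b : C) :
  Cexp a = Cexp b -> Rabs (Im a - Im b) < 2 * PI -> a = b.
Proof.
intros E H.
assert (E1 : Cexp (a - b) = RtoC 1).
{ rewrite Cexp_minus, E; field; apply Cexp_neq_0. }
assert (Hr : Re (a - b) = 0).
{ apply exp_inv; rewrite <- Cmod_Cexp, E1, exp_0; apply Cmod_1. }
assert (E2 : cos (Im (a - b)) = 1).
{ apply (f_equal Re) in E1; unfold Cexp in E1; rewrite Hr, exp_0 in E1.
  simpl in E1; simpl; lra. }
rewrite Re_minus in Hr; rewrite Im_minus in E2.
set (d := Im a - Im b) in *.
assert (Hd : sin (d / 2) = 0).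
{ pose proof (cos_2a_sin (d / 2)) as Hc.
  replace (2 * (d / 2)) with d in Hc by field. nra. }
assert (d = 0).
{ apply Rabs_def2 in H.
  destruct (Rtotal_order d 0) as [L|[L|L]]; [|easy|].
  - assert (0 < sin (- (d / 2))) by (apply sin_gt_0; lra).
    rewrite sin_neg in *; lra.
  - assert (0 < sin (d / 2)) by (apply sin_gt_0; lra); lra. }
apply C_eq; unfold d in *; lra.
Qed.

Lemma Rcpow_plus (t : R) (a b : C) : Rcpow t (a + b) = (Rcpow t a * Rcpow t b)%C.
Proof. unfold Rcpow; rewrite <- Cexp_plus; f_equal; ring. Qed.

Lemma Rcpow_opp (t : R) (a : C) : Rcpow t (- a) = (/ Rcpow t a)%C.
Proof. unfold Rcpow; rewrite <- Cexp_opp; f_equal; ring. Qed.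

Lemma Rcpow_minus (t : R) (a b : C) : Rcpow t (a - b) = (Rcpow t a / Rcpow t b)%C.
Proof. unfold Cminus, Cdiv; now rewrite Rcpow_plus, Rcpow_opp. Qed.

Lemma Rcpow_1 (t : R) : 0 < t -> Rcpow t 1 = RtoC t.
Proof.
intros; unfold Rcpow; rewrite Cmult_1_l, Cexp_RtoC, exp_ln; easy.
Qed.

Lemma Rcpow_base_1 (s : C) : Rcpow 1 s = RtoC 1.
Proof. unfold Rcpow; rewrite ln_1, Cmult_0_r; apply Cexp_0. Qed.

Lemma Rcpow_mult (t u : R) (s : C) : 0 < t -> 0 < u ->
  Rcpow (t * u) s = (Rcpow t s * Rcpow u s)%C.
Proof.
intros; unfold Rcpow; rewrite ln_mult, RtoC_plus, <- Cexp_plus by easy.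
f_equal; ring.
Qed.

Lemma Rcpow_neq_0 (t : R) (s : C) : Rcpow t s <> RtoC 0.
Proof. apply Cexp_neq_0. Qed.

Lemma Cmod_Rcpow (t : R) (s : C) : Cmod (Rcpow t s) = Rpower t (Re s).
Proof.
unfold Rcpow, Rpower; rewrite Cmod_Cexp, re_scal_r; easy.
Qed.

(** * Limits and series of complex numbers *)

Lemma is_lim_seq_scal_0 (c : R) (u : nat -> R) :
  is_lim_seq u 0 -> is_lim_seq (fun n => c * u n) 0.
Proof.
intros H; replace (Finite 0) with (Rbar_mult c 0) by (simpl; f_equal; ring).
now apply is_lim_seq_scal_l.
Qed.

Lemma is_lim_seq_plus_0 (u v : nat -> R) :
  is_lim_seq u 0 -> is_lim_seq v 0 -> is_lim_seq (fun n => u n + v n) 0.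
Proof.
intros Hu Hv; replace (Finite 0) with (Finite (0 + 0)) by (f_equal; ring).
now apply is_lim_seq_plus'.
Qed.

(** Convergence of a complex sequence, phrased through a real limit so that
    real comparison arguments apply. *)
Definition Clim (u : nat -> C) (l : C) : Prop :=
  is_lim_seq (fun n => Cmod (u n - l)) 0.

Lemma Clim_le (u : nat -> C) (l : C) (e : nat -> R) :
  (forall n, Cmod (u n - l) <= e n) -> is_lim_seq e 0 -> Clim u l.
Proof.
intros H He; apply (is_lim_seq_le_le (fun _ => 0) _ e).
- intros n; split; [apply Cmod_ge_0|apply H].
- apply is_lim_seq_const.
- easy.
Qed.

Lemma Clim_ext (u v : nat -> C) (l : C) :
  (forall n, u n = v n) -> Clim u l -> Clim v l.
Proof.
intros H; apply is_lim_seq_ext; intros n; now rewrite H.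
Qed.

Lemma Clim_const (a : C) : Clim (fun _ => a) a.
Proof.
apply (is_lim_seq_ext (fun _ => 0)); [|apply is_lim_seq_const].
intros _; replace (a - a)%C with (RtoC 0) by ring; now rewrite Cmod_0.
Qed.

Lemma Clim_plus (u v : nat -> C) (a b : C) :
  Clim u a -> Clim v b -> Clim (fun n => u n + v n)%C (a + b)%C.
Proof.
intros Hu Hv; apply (Clim_le _ _ (fun n => Cmod (u n - a) + Cmod (v n - b))).
- intros n; replace (u n + v n - (a + b))%C with ((u n - a) + (v n - b))%C by ring.
  apply Cmod_triangle.
- now apply is_lim_seq_plus_0.
Qed.

Lemma Clim_scal (c : C) (u : nat -> C) (a : C) :
  Clim u a -> Clim (fun n => c * u n)%C (c * a)%C.
Proof.
intros Hu; apply (Clim_le _ _ (fun n => Cmod c * Cmod (u n - a))).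
- intros n; replace (c * u n - c * a)%C with (c * (u n - a))%C by ring.
  rewrite Cmod_mult; lra.
- now apply is_lim_seq_scal_0.
Qed.

Lemma Clim_minus (u v : nat -> C) (a b : C) :
  Clim u a -> Clim v b -> Clim (fun n => u n - v n)%C (a - b)%C.
Proof.
intros Hu Hv.
apply (Clim_ext (fun n => u n + (-1) * v n)%C); [intros; ring|].
replace (a - b)%C with (a + (-1) * b)%C by ring.
apply Clim_plus; [easy|now apply Clim_scal].
Qed.

Lemma Clim_mult (u v : nat -> C) (a b : C) :
  Clim u a -> Clim v b -> Clim (fun n => u n * v n)%C (a * b)%C.
Proof.
intros Hu Hv.
apply (Clim_le _ _ (fun n => Cmod (u n - a) * Cmod (v n - b) +
  (Cmod a * Cmod (v n - b) + Cmod b * Cmod (u n - a)))).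
- intros n.
  replace (u n * v n - a * b)%C with
    ((u n - a) * (v n - b) + (a * (v n - b) + b * (u n - a)))%C by ring.
  eapply Rle_trans; [apply Cmod_triangle|].
  rewrite Cmod_mult; apply Rplus_le_compat_l.
  eapply Rle_trans; [apply Cmod_triangle|].
  rewrite !Cmod_mult; lra.
- apply is_lim_seq_plus_0; [|now apply is_lim_seq_plus_0; apply is_lim_seq_scal_0].
  rewrite <- (Rmult_0_l 0); now apply is_lim_seq_mult'.
Qed.

Lemma Clim_unique (u : nat -> C) (a b : C) : Clim u a -> Clim u b -> a = b.
Proof.
intros Ha Hb.
assert (H : is_lim_seq (fun _ : nat => Cmod (a - b)) 0).
{ apply (is_lim_seq_le_le (fun _ => 0) _
    (fun n => Cmod (u n - a) + Cmod (u n - b))).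
  - intros n; split; [apply Cmod_ge_0|].
    replace (a - b)%C with ((u n - b) - (u n - a))%C by ring.
    rewrite Rplus_comm; apply Cmod_triangle_minus.
  - apply is_lim_seq_const.
  - now apply is_lim_seq_plus_0. }
pose proof (is_lim_seq_unique _ _ H) as H1; rewrite Lim_seq_const in H1.
injection H1 as H1; apply Cmod_eq_0 in H1.
replace a with (a - b + b)%C by ring; rewrite H1; ring.
Qed.

Lemma Clim_norm_le (u : nat -> C) (l : C) (B : R) :
  Clim u l -> (forall n, Cmod (u n) <= B) -> Cmod l <= B.
Proof.
intros Hu HB.
assert (H1 : is_lim_seq (fun N => Cmod (u N - l) + B) (0 + B)).
{ apply is_lim_seq_plus'; [apply Hu|apply is_lim_seq_const]. }
rewrite Rplus_0_l in H1.
apply (is_lim_seq_le (fun _ => Cmod l) _ (Cmod l) B) in H1;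
  [easy| |apply is_lim_seq_const].
intros N; pose proof (Cmod_triangle_minus (u N) (u N - l)).
replace (u N - (u N - l))%C with l in * by ring.
pose proof (HB N); lra.
Qed.

Lemma Clim_incr (u : nat -> C) (a : C) : Clim u a <-> Clim (fun n => u (S n)) a.
Proof.
unfold Clim; split; intros H.
- now apply (is_lim_seq_incr_1 (fun n => Cmod (u n - a))).
- now apply (is_lim_seq_incr_1 (fun n => Cmod (u n - a))) in H.
Qed.

Lemma ex_series_R_le (a b : nat -> R) :
  (forall n, 0 <= a n <= b n) -> ex_series b -> ex_series a.
Proof.
intros H; apply (@ex_series_le _ R_CompleteNormedModule); intros n.
unfold norm; simpl; unfold abs; simpl; rewrite Rabs_pos_eq; apply H.
Qed.

Lemma ex_series_geom_dominated (c : nat -> R) (M p q : R) : (forall n, 0 <= c n) ->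
  0 <= q < p -> (forall n, c n * p ^ n <= M) -> ex_series (fun n => c n * q ^ n).
Proof.
intros Hc Hq HM; set (r := q / p).
assert (Hr : 0 <= r < 1).
{ unfold r; split.
  - apply Rmult_le_pos; [lra|left; apply Rinv_0_lt_compat; lra].
  - apply Rmult_lt_reg_r with p; [lra|].
    replace (q / p * p) with q by (field; lra); lra. }
apply (ex_series_R_le _ (fun n => M * r ^ n)).
- intros n; split; [apply Rmult_le_pos; [easy|apply pow_le; lra]|].
  replace q with (p * r) by (unfold r; field; lra).
  rewrite Rpow_mult_distr, <- Rmult_assoc.
  apply Rmult_le_compat_r; [apply pow_le; lra|easy].
- apply (ex_series_scal_l M (fun n => r ^ n)), ex_series_geom; rewrite Rabs_pos_eq; lra.
Qed.

(** The operations of the canonical structures on [C] have types that [ring] does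
    not recognise as [C]. *)
Ltac Cring := match goal with |- @eq _ ?x ?y => change (@eq C x y); ring end.

Lemma sum_n_C_S (a : nat -> C) (n : nat) : sum_n a (S n) = (sum_n a n + a (S n))%C.
Proof. exact (sum_Sn a n). Qed.

Lemma is_series_Clim (a : nat -> C) (l : C) : is_series a l <-> Clim (sum_n a) l.
Proof.
unfold is_series, Clim; split; intros H.
- apply is_lim_seq_spec; intros eps.
  pose proof (proj1 (filterlim_locally_ball_norm _ _) H eps) as [N HN].
  exists N; intros n Hn; rewrite Rminus_0_r, Rabs_pos_eq by apply Cmod_ge_0.
  exact (HN n Hn).
- apply filterlim_locally_ball_norm; intros eps.
  apply is_lim_seq_spec in H; destruct (H eps) as [N HN].
  exists N; intros n Hn; specialize (HN n Hn).
  rewrite Rminus_0_r, Rabs_pos_eq in HN by apply Cmod_ge_0; exact HN.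
Qed.

Lemma Clim_Re_Im (u : nat -> C) (l : C) :
  Clim u l <->
  is_lim_seq (fun n => Re (u n)) (Re l) /\ is_lim_seq (fun n => Im (u n)) (Im l).
Proof.
assert (aux : forall (v : nat -> R) m,
  is_lim_seq (fun n => Rabs (v n - m)) 0 <-> is_lim_seq v m).
{ intros v m; rewrite <- is_lim_seq_abs_0; split; intros H.
  - apply (is_lim_seq_ext (fun n => (v n - m) + m)); [intros; ring|].
    replace (Finite m) with (Finite (0 + m)) by (f_equal; ring).
    apply is_lim_seq_plus'; [easy|apply is_lim_seq_const].
  - replace (Finite 0) with (Finite (m - m)) by (f_equal; ring).
    apply is_lim_seq_minus'; [easy|apply is_lim_seq_const]. }
split.
- intros H; split; apply aux;
    apply (is_lim_seq_le_le (fun _ => 0) _ (fun n => Cmod (u n - l)));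
    try exact H; try apply is_lim_seq_const; intros n; split; try apply Rabs_pos.
  + rewrite <- Re_minus; apply re_le_Cmod.
  + rewrite <- Im_minus; apply im_le_Cmod.
- intros [H1 H2]; apply aux in H1, H2.
  apply (Clim_le _ _ (fun n => Rabs (Re (u n) - Re l) + Rabs (Im (u n) - Im l))).
  2: { now apply is_lim_seq_plus_0. }
  intros n; rewrite <- Re_minus, <- Im_minus; apply Cmod_le_Re_Im.
Qed.

Lemma Re_sum_n (a : nat -> C) (n : nat) :
  Re (sum_n a n) = sum_n (fun k => Re (a k)) n.
Proof.
induction n as [|n IH]; [now rewrite !sum_O|].
rewrite !sum_Sn, <- IH; reflexivity.
Qed.

Lemma Im_sum_n (a : nat -> C) (n : nat) :
  Im (sum_n a n) = sum_n (fun k => Im (a k)) n.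
Proof.
induction n as [|n IH]; [now rewrite !sum_O|].
rewrite !sum_Sn, <- IH; reflexivity.
Qed.

Lemma is_series_Re_Im (a : nat -> C) (l : C) :
  is_series a l <->
  is_series (fun n => Re (a n)) (Re l) /\ is_series (fun n => Im (a n)) (Im l).
Proof.
rewrite is_series_Clim, Clim_Re_Im.
assert (E : forall (u v : nat -> R) (x : R), (forall n, u n = v n) ->
  (is_lim_seq u x <-> is_lim_seq v x)).
{ intros u v x H; split; apply is_lim_seq_ext; intros; now rewrite H. }
rewrite (E _ _ _ (Re_sum_n a)), (E _ _ _ (Im_sum_n a)); reflexivity.
Qed.

Lemma is_series_CSeries (a : nat -> C) (l : C) : is_series a l -> CSeries a = l.
Proof.
rewrite is_series_Re_Im; intros [H1 H2].
apply C_eq; simpl; now apply is_series_unique.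
Qed.

Lemma CSeries_correct (a : nat -> C) : ex_series a -> is_series a (CSeries a).
Proof. intros [l H]; now rewrite (is_series_CSeries a l H). Qed.

Lemma is_series_C_unique (a : nat -> C) (l m : C) :
  is_series a l -> is_series a m -> l = m.
Proof.
intros H1 H2; rewrite <- (is_series_CSeries _ _ H1); now apply is_series_CSeries.
Qed.

Lemma ex_series_Cmod (a : nat -> C) (b : nat -> R) :
  (forall n, Cmod (a n) <= b n) -> ex_series b -> ex_series a.
Proof. exact (@ex_series_le _ C_CompleteNormedModule a b). Qed.

Lemma Cmod_sum_n (a : nat -> C) (b : nat -> R) (n : nat) :
  (forall k, (k <= n)%nat -> Cmod (a k) <= b k) -> Cmod (sum_n a n) <= sum_n b n.
Proof.
induction n as [|n IH]; intros H; [rewrite !sum_O; now apply H|].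
rewrite !sum_Sn; eapply Rle_trans; [apply Cmod_triangle|].
apply Rplus_le_compat; [apply IH; intros; apply H; lia|apply H; lia].
Qed.

Lemma is_lim_seq_series (b : nat -> R) (B : R) :
  is_series b B -> is_lim_seq (sum_n b) B.
Proof. intros H; exact H. Qed.

Lemma sum_n_le_series (b : nat -> R) (B : R) (n : nat) :
  (forall k, 0 <= b k) -> is_series b B -> sum_n b n <= B.
Proof.
intros Hb HB.
apply (is_lim_seq_incr_compare (sum_n b) B (is_lim_seq_series _ _ HB)).
intros k; rewrite sum_Sn; specialize (Hb (S k)); unfold plus; simpl; lra.
Qed.

Lemma Cmod_series_le (a : nat -> C) (b : nat -> R) (l : C) (B : R) :
  is_series a l -> is_series b B -> (forall n, Cmod (a n) <= b n) -> Cmod l <= B.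
Proof.
intros Ha Hb H.
apply is_series_Clim in Ha.
assert (Hb0 : forall k, 0 <= b k) by (intros k; eapply Rle_trans; [apply Cmod_ge_0|apply H]).
apply (Clim_norm_le _ _ _ Ha); intros n.
eapply Rle_trans; [now apply (Cmod_sum_n a b)|now apply sum_n_le_series].
Qed.

Lemma is_series_C_scal (c : C) (a : nat -> C) (l : C) :
  is_series a l -> is_series (fun n => c * a n)%C (c * l)%C.
Proof. exact (is_series_scal c a l). Qed.

Lemma is_series_C_plus (a b : nat -> C) (l m : C) :
  is_series a l -> is_series b m -> is_series (fun n => a n + b n)%C (l + m)%C.
Proof. exact (is_series_plus a b l m). Qed.

Lemma is_series_C_minus (a b : nat -> C) (l m : C) :
  is_series a l -> is_series b m -> is_series (fun n => a n - b n)%C (l - m)%C.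
Proof. exact (is_series_minus a b l m). Qed.

Lemma is_series_C_ext (a b : nat -> C) (l m : C) :
  (forall n, a n = b n) -> l = m -> is_series a l -> is_series b m.
Proof. intros H ->; now apply is_series_ext. Qed.

Lemma is_series_C_shift (a : nat -> C) (l : C) :
  is_series a l <-> is_series (fun n => a (S n)) (l - a 0%nat)%C.
Proof.
split; intros H.
- apply is_series_incr_1.
  change (is_series a (l - a 0%nat + a 0%nat)%C).
  now replace (l - a 0%nat + a 0%nat)%C with l by ring.
- now apply is_series_decr_1.
Qed.

Lemma is_series_C_sum_n (f : nat -> nat -> C) (l : nat -> C) (n : nat) :
  (forall j, is_series (fun i => f i j) (l j)) ->
  is_series (fun i => sum_n (f i) n) (sum_n l n).
Proof.
intros H; induction n as [|n IH].
- rewrite sum_O; eapply is_series_ext; [|apply H].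
  intros i; now rewrite sum_O.
- rewrite sum_Sn; eapply is_series_ext; [|apply (is_series_plus _ _ _ _ IH (H (S n)))].
  intros i; now rewrite sum_Sn.
Qed.

Lemma series_remainder_bound (a : nat -> C) (b : nat -> R) (l : C) (B : R) (n : nat) :
  is_series a l -> is_series b B -> (forall k, Cmod (a k) <= b k) ->
  Cmod (l - sum_n a n) <= B - sum_n b n.
Proof.
intros Ha Hb H.
apply (Cmod_series_le (fun k => a (S n + k)%nat) (fun k => b (S n + k)%nat)).
- apply (is_series_incr_n a (S n)); [lia|]; simpl.
  change (is_series a (l - sum_n a n + sum_n a n)%C).
  now replace (l - sum_n a n + sum_n a n)%C with l by ring.
- apply (is_series_incr_n b (S n)); [lia|]; simpl.
  change (is_series b (B - sum_n b n + sum_n b n)).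
  now replace (B - sum_n b n + sum_n b n) with B by ring.
- intros; apply H.
Qed.

(** Interchange of the two summations of a double series. A majorant in product
    form is all that is needed below, and it makes every remainder explicit. *)
Lemma series_swap (a : nat -> nat -> C) (r : nat -> C) (u v : nat -> R) :
  (forall i j, Cmod (a i j) <= u i * v j) -> ex_series u -> ex_series v ->
  (forall i, 0 <= u i) -> (forall j, 0 <= v j) ->
  (forall i, is_series (a i) (r i)) ->
  exists (c : nat -> C) (S : C),
    (forall j, is_series (fun i => a i j) (c j)) /\ is_series r S /\ is_series c S.
Proof.
intros H [U HU] [V HV] Hu Hv Hr.
set (c := fun j => CSeries (fun i => a i j)).
assert (Hc : forall j, is_series (fun i => a i j) (c j)).
{ intros j; apply CSeries_correct, (ex_series_Cmod _ (fun i => v j * u i)).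
  - intros i; rewrite Rmult_comm; apply H.
  - exists (v j * U); now apply (is_series_scal (v j) u). }
assert (HuV : forall i, is_series (fun j => u i * v j) (u i * V)).
{ intros i; now apply (is_series_scal (u i) v). }
assert (Hrb : forall i, Cmod (r i) <= u i * V).
{ intros i; apply (Cmod_series_le (a i) (fun j => u i * v j)); auto. }
assert (HrS : ex_series r).
{ apply (ex_series_Cmod _ (fun i => u i * V)); [easy|].
  exists (U * V); now apply is_series_scal_r. }
destruct HrS as [S HS].
exists c, S; repeat split; [easy|easy|].
apply is_series_Clim, (Clim_le _ _ (fun n => U * (V - sum_n v n))).
- intros n; rewrite Cmod_minus_sym.
  apply (Cmod_series_le (fun i => r i - sum_n (a i) n)%C
    (fun i => u i * (V - sum_n v n))).
  + apply is_series_C_minus; [easy|now apply is_series_C_sum_n].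
  + now apply is_series_scal_r.
  + intros i.
    eapply Rle_trans; [apply (series_remainder_bound (a i) (fun j => u i * v j));
      auto; apply HuV|].
    right; transitivity (u i * V - u i * sum_n v n); [f_equal|ring].
    exact (sum_n_mult_l (u i) v n).
- replace (Finite 0) with (Finite (U * (V - V))) by (f_equal; ring).
  apply (is_lim_seq_scal_l _ U (V - V)), is_lim_seq_minus'; [apply is_lim_seq_const|easy].
Qed.

(** Dominated convergence for series, along a sequence of parameters. *)
Lemma tannery (F : nat -> nat -> C) (f S : nat -> C) (b : nat -> R) :
  (forall N i, Cmod (F N i) <= b i) -> ex_series b ->
  (forall i, Clim (fun N => F N i) (f i)) -> (forall N, is_series (F N) (S N)) ->
  exists l, is_series f l /\ Clim S l.
Proof.
intros Hb [B HB] Hf HS.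
assert (Hfb : forall i, Cmod (f i) <= b i).
{ intros i; apply (Clim_norm_le _ _ _ (Hf i)); intros N; apply Hb. }
assert (Hl : ex_series f) by (apply (ex_series_Cmod _ b); [easy|now exists B]).
destruct Hl as [l Hl]; exists l; split; [easy|].
assert (Hsum : forall n, Clim (fun N => sum_n (F N) n) (sum_n f n)).
{ induction n as [|n IH].
  - rewrite sum_O; eapply Clim_ext; [|apply Hf]; intros; now rewrite sum_O.
  - rewrite sum_Sn; eapply Clim_ext; [|apply (Clim_plus _ _ _ _ IH (Hf (Datatypes.S n)))].
    intros; now rewrite sum_Sn. }
unfold Clim; apply is_lim_seq_spec; intros eps.
apply is_lim_seq_series, is_lim_seq_spec in HB as HB1.
assert (He : 0 < eps / 4) by (pose proof (cond_pos eps); lra).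
destruct (HB1 (mkposreal _ He)) as [n Hn]; specialize (Hn n (le_n n)); simpl in Hn.
specialize (Hsum n); apply is_lim_seq_spec in Hsum.
destruct (Hsum (mkposreal _ He)) as [N0 HN0]; exists N0; intros N HN.
specialize (HN0 N HN); simpl in HN0.
rewrite Rminus_0_r, Rabs_pos_eq in HN0 |- * by apply Cmod_ge_0.
apply Rabs_def2 in Hn.
pose proof (series_remainder_bound _ _ _ _ n (HS N) HB (Hb N)).
pose proof (series_remainder_bound _ _ _ _ n Hl HB Hfb).
replace (S N - l)%C with ((S N - sum_n (F N) n) - (l - sum_n f n)
  + (sum_n (F N) n - sum_n f n))%C by ring.
pose proof (Cmod_triangle ((S N - sum_n (F N) n) - (l - sum_n f n))%C
  (sum_n (F N) n - sum_n f n)%C).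
pose proof (Cmod_triangle_minus (S N - sum_n (F N) n) (l - sum_n f n)).
lra.
Qed.

Lemma sum_n_C_const (c : C) (n : nat) : sum_n (fun _ => c) n = (INR (S n) * c)%C.
Proof.
induction n as [|n IH]; [rewrite sum_O; simpl; Cring|].
rewrite sum_Sn, IH, (S_INR (S n)), RtoC_plus; change (plus ?x ?y) with (x + y)%C; Cring.
Qed.

Lemma sum_n_C_single (c : C) (m n : nat) : (m <= n)%nat ->
  sum_n (fun l => if Nat.eq_dec l m then c else RtoC 0) n = c.
Proof.
assert (H0 : forall k, (k < m)%nat ->
  sum_n (fun l => if Nat.eq_dec l m then c else RtoC 0) k = RtoC 0).
{ induction k as [|k IH]; intros Hk.
  - rewrite sum_O; destruct (Nat.eq_dec 0 m); [lia|easy].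
  - rewrite sum_Sn, IH by lia; destruct (Nat.eq_dec (S k) m); [lia|].
    change (plus ?x ?y) with (x + y)%C; Cring. }
induction n as [|n IH]; intros Hn.
- rewrite sum_O; destruct (Nat.eq_dec 0 m); [easy|lia].
- rewrite sum_Sn; destruct (Nat.eq_dec (S n) m) as [E|E].
  + rewrite H0 by lia; change (plus ?x ?y) with (x + y)%C; Cring.
  + rewrite IH by lia; change (plus ?x ?y) with (x + y)%C; Cring.
Qed.

Lemma sum_n_C_mult_l (c : C) (u : nat -> C) (n : nat) :
  sum_n (fun k => c * u k)%C n = (c * sum_n u n)%C.
Proof. exact (sum_n_mult_l (K := C_Ring) c u n). Qed.

Lemma sum_n_C_mult_r (c : C) (u : nat -> C) (n : nat) :
  sum_n (fun k => u k * c)%C n = (sum_n u n * c)%C.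
Proof. exact (sum_n_mult_r (K := C_Ring) c u n). Qed.

Lemma sum_n_C_plus (u v : nat -> C) (n : nat) :
  sum_n (fun k => u k + v k)%C n = (sum_n u n + sum_n v n)%C.
Proof. exact (sum_n_plus u v n). Qed.

Lemma series_decimate (a : nat -> C) (m : nat) (s : C) :
  (forall n, (S n mod S m <> 0)%nat -> a n = RtoC 0) -> is_series a s ->
  is_series (fun k => a (S m * k + m)%nat) s.
Proof.
intros H0 Ha; apply is_series_Clim; apply is_series_Clim in Ha.
assert (Hgap : forall k j, (j <= m)%nat ->
  sum_n a (S m * k + m + j) = sum_n a (S m * k + m)).
{ intros k; induction j as [|j IH]; intros Hj; [f_equal; lia|].
  replace (S m * k + m + S j)%nat with (S (S m * k + m + j)) by lia.
  rewrite sum_n_C_S, IH by lia; rewrite H0; [Cring|].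
  replace (S (S (S m * k + m + j))) with (S j + (S k) * S m)%nat by lia.
  rewrite Nat.Div0.mod_add, Nat.mod_small; lia. }
assert (Hfirst : forall j, (j < m)%nat -> sum_n a j = RtoC 0).
{ induction j as [|j IH]; intros Hj.
  - rewrite sum_O; apply H0; rewrite Nat.mod_small; lia.
  - rewrite sum_n_C_S, IH by lia; rewrite H0; [Cring|].
    rewrite Nat.mod_small; lia. }
assert (E : forall k, sum_n (fun k => a (S m * k + m)%nat) k = sum_n a (S m * k + m)).
{ induction k as [|k IH].
  - rewrite sum_O; replace (S m * 0 + m)%nat with m by lia.
    destruct m as [|m]; [now rewrite sum_O|].
    rewrite sum_n_C_S, Hfirst by lia; Cring.
  - rewrite sum_n_C_S, IH, <- (Hgap k m) by lia.
    replace (S m * S k + m)%nat with (S (S m * k + m + m)) by lia.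
    now rewrite sum_n_C_S. }
apply (Clim_ext (fun k => sum_n a (S m * k + m))); [intros; now rewrite E|].
apply (is_lim_seq_subseq (fun n => Cmod (sum_n a n - s)) 0 (fun k => (S m * k + m)%nat));
  [apply eventually_subseq; intros; lia|exact Ha].
Qed.

(** The terms of odd index are counted twice in [A - T], the others cancel. *)
Lemma alternating_split (a : nat -> C) (A E T : C) : is_series a A ->
  is_series (fun n => (-1) ^ n * a n)%C T -> is_series (fun k => a (2 * k + 1)%nat) E ->
  T = (A - 2 * E)%C.
Proof.
intros HA HT HE.
assert (Hsq : ((-1) * (-1))%C = RtoC 1) by (apply C_eq; simpl; ring).
assert (Hev : forall k, ((-1) ^ (2 * k))%C = RtoC 1).
{ intros k; rewrite Cpow_mult_r; replace ((-1) ^ 2)%C with (RtoC 1) by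
    (rewrite <- Hsq; simpl; ring).
  apply Cpow_1_l. }
pose proof (series_decimate (fun n => a n - (-1) ^ n * a n)%C 1 (A - T)%C) as H.
assert (H1 : (A - T)%C = (2 * E)%C).
{ refine (is_series_C_unique _ _ _ (H _ _) _).
  - intros n Hn; pose proof (Nat.div_mod_eq n 2) as Hd.
    assert (Hm : (n mod 2 = 0)%nat).
    { pose proof (Nat.mod_upper_bound n 2 ltac:(lia)).
      destruct (Nat.eq_dec (n mod 2) 1) as [E1|E1]; [|lia].
      exfalso; apply Hn; replace (S n) with (0 + S (n / 2) * 2)%nat by lia.
      now rewrite Nat.Div0.mod_add. }
    replace n with (2 * (n / 2))%nat by lia; rewrite Hev; ring.
  - now apply is_series_C_minus.
  - eapply is_series_C_ext; [|reflexivity|apply (is_series_C_scal 2 _ _ HE)].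
    intros k; cbv beta; rewrite Cpow_add_r, Hev, Cpow_1_r; ring. }
replace T with (A - (A - T))%C by ring; rewrite H1; ring.
Qed.

(** * Complex-valued functions of a real variable *)

(** Derivative of a curve in the plane, taken componentwise so that the real
    mean value theorem and the real integral apply directly. *)
Definition CD (f : R -> C) (x : R) (d : C) : Prop :=
  is_derive (fun t => Re (f t)) x (Re d) /\ is_derive (fun t => Im (f t)) x (Im d).

Lemma is_derive_eq (f : R -> R) (x d e : R) : is_derive f x d -> d = e -> is_derive f x e.
Proof. now intros H <-. Qed.

Lemma CD_eq (f : R -> C) (x : R) (d e : C) : CD f x d -> d = e -> CD f x e.
Proof. now intros H <-. Qed.

Lemma CD_ext (f g : R -> C) (x : R) (d : C) : (forall t, f t = g t) -> CD f x d -> CD g x d.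
Proof.
intros H [H1 H2]; split.
- apply (is_derive_ext (fun t => Re (f t))); [intros; now rewrite H|easy].
- apply (is_derive_ext (fun t => Im (f t))); [intros; now rewrite H|easy].
Qed.

Lemma CD_const (c : C) (x : R) : CD (fun _ => c) x 0.
Proof. split; exact (is_derive_const _ x). Qed.

Lemma CD_RtoC (f : R -> R) (x d : R) : is_derive f x d -> CD (fun t => RtoC (f t)) x d.
Proof. split; [easy|exact (is_derive_const 0 x)]. Qed.

Lemma CD_id (x : R) : CD (fun t => RtoC t) x 1.
Proof. apply (CD_RtoC (fun t => t) x 1); exact (is_derive_id (K := R_AbsRing) x). Qed.

Lemma CD_plus (f g : R -> C) (x : R) (d e : C) :
  CD f x d -> CD g x e -> CD (fun t => f t + g t)%C x (d + e)%C.
Proof.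
intros [H1 H2] [H3 H4]; split.
- exact (is_derive_plus _ _ x _ _ H1 H3).
- exact (is_derive_plus _ _ x _ _ H2 H4).
Qed.

Lemma CD_mult (f g : R -> C) (x : R) (d e : C) :
  CD f x d -> CD g x e -> CD (fun t => f t * g t)%C x (d * g x + f x * e)%C.
Proof.
intros [H1 H2] [H3 H4]; split.
- apply (is_derive_ext (fun t => Re (f t) * Re (g t) - Im (f t) * Im (g t))).
  { intros t; now rewrite re_mult. }
  eapply is_derive_eq.
  + exact (is_derive_minus _ _ x _ _ (is_derive_mult _ _ x _ _ H1 H3 Rmult_comm)
      (is_derive_mult _ _ x _ _ H2 H4 Rmult_comm)).
  + rewrite re_plus, !re_mult; unfold minus, plus, opp, mult; simpl; ring.
- apply (is_derive_ext (fun t => Re (f t) * Im (g t) + Im (f t) * Re (g t))).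
  { intros t; now rewrite im_mult. }
  eapply is_derive_eq.
  + exact (is_derive_plus _ _ x _ _ (is_derive_mult _ _ x _ _ H1 H4 Rmult_comm)
      (is_derive_mult _ _ x _ _ H2 H3 Rmult_comm)).
  + rewrite im_plus, !im_mult; unfold minus, plus, opp, mult; simpl; ring.
Qed.

Lemma CD_scal (c : C) (f : R -> C) (x : R) (d : C) :
  CD f x d -> CD (fun t => c * f t)%C x (c * d)%C.
Proof.
intros H; eapply CD_eq; [apply (CD_mult (fun _ => c) f); [apply CD_const|exact H]|].
ring.
Qed.

Lemma CD_exp (f : R -> C) (x : R) (d : C) :
  CD f x d -> CD (fun t => Cexp (f t)) x (d * Cexp (f x))%C.
Proof.
intros [H1 H2].
assert (He : is_derive (fun t => exp (Re (f t))) x (Re d * exp (Re (f x)))).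
{ exact (is_derive_comp exp _ x _ _ (is_derive_exp _) H1). }
assert (Hc : is_derive (fun t => cos (Im (f t))) x (Im d * - sin (Im (f x)))).
{ exact (is_derive_comp cos _ x _ _ (is_derive_cos _) H2). }
assert (Hs : is_derive (fun t => sin (Im (f t))) x (Im d * cos (Im (f x)))).
{ exact (is_derive_comp sin _ x _ _ (is_derive_sin _) H2). }
split; unfold Cexp; simpl; eapply is_derive_eq.
- exact (is_derive_mult _ _ x _ _ He Hc Rmult_comm).
- unfold plus, mult, Re, Im; simpl; ring.
- exact (is_derive_mult _ _ x _ _ He Hs Rmult_comm).
- unfold plus, mult, Re, Im; simpl; ring.
Qed.

Lemma CD_line (a b : C) (x : R) : CD (fun t => a + t * b)%C x b.
Proof.
eapply CD_eq; [apply CD_plus; [apply CD_const|apply CD_mult;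
  [apply CD_id|apply CD_const]]|].
change ((0 + (1 * b + x * 0))%C = b); ring.
Qed.

Lemma CD_Rcpow (s : C) (x : R) : 0 < x ->
  CD (fun t => Rcpow t s) x (s * Rcpow x (s - 1))%C.
Proof.
intros Hx; unfold Rcpow at 1.
eapply CD_eq; [apply CD_exp, (CD_scal s), CD_RtoC, is_derive_ln, Hx|].
rewrite Rcpow_minus, Rcpow_1, RtoC_inv by lra; unfold Rcpow.
field; apply RtoC_neq_0; lra.
Qed.

Lemma Rmvt_le (f : R -> R) (df : R -> R) (a b M : R) : a <= b ->
  (forall t, a <= t <= b -> is_derive f t (df t)) ->
  (forall t, a <= t <= b -> Rabs (df t) <= M) -> Rabs (f b - f a) <= M * (b - a).
Proof.
intros Hab Hd HM.
destruct (MVT_gen f a b df) as [c [Hc Ec]];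
  rewrite ?Rmin_left, ?Rmax_right in * by easy.
- intros; apply Hd; lra.
- intros x Hx; apply continuity_pt_filterlim, (ex_derive_continuous f).
  exists (df x); now apply Hd.
- rewrite Ec, Rabs_mult, (Rabs_pos_eq (b - a)) by lra.
  apply Rmult_le_compat_r; [lra|now apply HM].
Qed.

(** The factor 2 is the price of arguing on the two components separately; no
    sharp constant is needed anywhere. *)
Lemma Cmvt_le (f d : R -> C) (a b M : R) : a <= b ->
  (forall t, a <= t <= b -> CD f t (d t)) ->
  (forall t, a <= t <= b -> Cmod (d t) <= M) -> Cmod (f b - f a) <= 2 * M * (b - a).
Proof.
intros Hab Hd HM.
eapply Rle_trans; [apply Cmod_le_Re_Im|].
rewrite Re_minus, Im_minus.
assert (H1 : Rabs (Re (f b) - Re (f a)) <= M * (b - a)).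
{ apply (Rmvt_le (fun t => Re (f t)) (fun t => Re (d t))); [easy| |].
  - intros t Ht; apply (Hd t Ht).
  - intros t Ht; eapply Rle_trans; [apply re_le_Cmod|now apply HM]. }
assert (H2 : Rabs (Im (f b) - Im (f a)) <= M * (b - a)).
{ apply (Rmvt_le (fun t => Im (f t)) (fun t => Im (d t))); [easy| |].
  - intros t Ht; apply (Hd t Ht).
  - intros t Ht; eapply Rle_trans; [apply im_le_Cmod|now apply HM]. }
lra.
Qed.

Lemma CD_zero_const (f : R -> C) (a b : R) : a <= b ->
  (forall t, a <= t <= b -> CD f t 0) -> f b = f a.
Proof.
intros Hab Hd.
assert (H : Cmod (f b - f a) <= 2 * 0 * (b - a)).
{ apply (Cmvt_le f (fun _ => RtoC 0)); [easy|easy|].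
  intros; rewrite Cmod_0; lra. }
assert (E : (f b - f a)%C = RtoC 0).
{ apply Cmod_eq_0; pose proof (Cmod_ge_0 (f b - f a)); lra. }
replace (f b) with (f b - f a + f a)%C by ring; rewrite E; ring.
Qed.

(** * The principal logarithm on the right half-plane *)

Definition Clog (w : C) : C := (ln (Cmod w), atan (Im w / Re w)).

Definition Cpw (w s : C) : C := Cexp (s * Clog w).

Lemma Cmod_sqr (w : C) : Cmod w * Cmod w = Re w * Re w + Im w * Im w.
Proof. pose proof (Cmod2_alt w); simpl in *; lra. Qed.

Lemma cos_sin_atan (x y r : R) : 0 < x -> 0 < r -> r * r = x * x + y * y ->
  r * cos (atan (y / x)) = x /\ r * sin (atan (y / x)) = y.
Proof.
intros Hx Hr E.
pose proof (atan_bound (y / x)) as Hb.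
set (t := atan (y / x)) in *.
assert (Hc : 0 < cos t) by (apply cos_gt_0; lra).
assert (Ht : sin t * x = y * cos t).
{ pose proof (tan_atan (y / x)) as H; fold t in H; unfold tan in H.
  apply (f_equal (fun q => q * (cos t * x))) in H.
  replace (sin t / cos t * (cos t * x)) with (sin t * x) in H by (field; lra).
  rewrite H; field; lra. }
pose proof (sin2_cos2 t) as H1; unfold Rsqr in H1.
assert (E2 : (r * cos t) * (r * cos t) = x * x).
{ assert (x * x = (x * x + y * y) * (cos t * cos t)).
  { transitivity (x * x * (sin t * sin t + cos t * cos t)); [rewrite H1; ring|].
    transitivity ((sin t * x) * (sin t * x) + x * x * (cos t * cos t)); [ring|].
    rewrite Ht; ring. }
  rewrite <- E in H; nra. }
assert (E3 : r * cos t = x) by (apply Rsqr_inj; [nra|lra|exact E2]).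
split; [easy|].
apply (Rmult_eq_reg_r (cos t)); [|lra].
transitivity (sin t * x); [rewrite <- E3; ring|lra].
Qed.

Lemma Cexp_Clog (w : C) : 0 < Re w -> Cexp (Clog w) = w.
Proof.
intros H; pose proof (proj1 (Cmod_gt_0 w) (Re_pos_neq_0 w H)) as Hm.
unfold Cexp, Clog; simpl; rewrite exp_ln by easy.
destruct (cos_sin_atan (Re w) (Im w) (Cmod w)) as [E1 E2]; try easy.
{ apply Cmod_sqr. }
rewrite E1, E2; now destruct w.
Qed.

Lemma Im_Clog_bound (w : C) : - PI / 2 < Im (Clog w) < PI / 2.
Proof. pose proof (atan_bound (Im w / Re w)); simpl; lra. Qed.

Lemma Clog_1 : Clog 1 = RtoC 0.
Proof.
apply C_eq; simpl; [rewrite Cmod_1; apply ln_1|].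
replace (0 / 1) with 0 by field; apply atan_0.
Qed.

Lemma Clog_RtoC (x : R) : 0 < x -> Clog x = RtoC (ln x).
Proof.
intros Hx; apply C_eq; simpl; [rewrite Cmod_pos_R; lra|].
replace (0 / x) with 0 by (field; lra); apply atan_0.
Qed.

Lemma CD_Clog (w : R -> C) (t : R) (d : C) :
  CD w t d -> 0 < Re (w t) -> CD (fun u => Clog (w u)) t (d / w t)%C.
Proof.
intros [H1 H2] Hw.
set (x := fun u => Re (w u)) in *; set (y := fun u => Im (w u)) in *.
assert (Hx : 0 < x t) by exact Hw.
assert (H : 0 < x t * (x t * 1) + y t * (y t * 1)) by nra.
replace (Re (w t)) with (x t) in Hw by easy.
assert (E : (d / w t)%C = ((Re d * x t + Im d * y t) / (x t * x t + y t * y t),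
  (Im d * x t - Re d * y t) / (x t * x t + y t * y t))).
{ apply C_eq; simpl; unfold x, y, Re, Im in *; simpl; field; nra. }
assert (Dx : Derive (fun u => x u) t = Re d) by exact (is_derive_unique _ _ _ H1).
assert (Dy : Derive (fun u => y u) t = Im d) by exact (is_derive_unique _ _ _ H2).
rewrite E; split; simpl.
- apply (is_derive_ext (fun u => ln (sqrt (x u * (x u * 1) + y u * (y u * 1))))).
  { intros u; reflexivity. }
  auto_derive.
  + repeat split; first [exact (ex_intro _ _ H1)|exact (ex_intro _ _ H2)|exact H|
      now apply sqrt_lt_R0].
  + rewrite Dx, Dy.
    pose proof (sqrt_lt_R0 _ H); pose proof (sqrt_sqrt _ (Rlt_le _ _ H)) as Es.
    set (q := sqrt _) in *.
    transitivity ((Re d * x t + Im d * y t) / (q * q)); [field; lra|].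
    rewrite Es; f_equal; f_equal; ring.
- apply (is_derive_ext (fun u => atan (y u / x u))); [reflexivity|].
  auto_derive.
  + repeat split; first [exact (ex_intro _ _ H1)|exact (ex_intro _ _ H2)|lra].
  + rewrite Dx, Dy; field; nra.
Qed.

Lemma Cmod_Cpw (w s : C) :
  Cmod (Cpw w s) = exp (Re s * ln (Cmod w) - Im s * Im (Clog w)).
Proof.
unfold Cpw; rewrite Cmod_Cexp, re_mult; reflexivity.
Qed.

(** * Power series along a ray, the exponential and binomial series *)

(** Taken componentwise, so that the theory of real power series yields its
    derivative. *)
Definition Cps (c : nat -> C) (t : R) : C :=
  (PSeries (fun n => Re (c n)) t, PSeries (fun n => Im (c n)) t).

Lemma CV_radius_ge (a : nat -> R) (r M : R) :
  (forall n, Rabs (a n * r ^ n) <= M) -> Rbar_le r (CV_radius a).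
Proof.
intros H; apply (CV_radius_bounded a); now exists M.
Qed.

Lemma Cps_derive (c : nat -> C) (r M t : R) : 0 <= r ->
  (forall n, Cmod (c n) * r ^ n <= M) -> Rabs t < r ->
  is_series (fun n => c n * t ^ n)%C (Cps c t) /\
  is_series (fun n => INR (S n) * c (S n) * t ^ n)%C
    (Cps (fun n => INR (S n) * c (S n))%C t) /\
  CD (Cps c) t (Cps (fun n => INR (S n) * c (S n))%C t).
Proof.
intros Hr0 HM Ht.
assert (Hre : Rbar_lt (Rabs t) (CV_radius (fun n => Re (c n)))).
{ eapply Rbar_lt_le_trans; [|apply (CV_radius_ge _ r M)]; [exact Ht|].
  intros n; rewrite Rabs_mult, (Rabs_pos_eq (r ^ n)) by now apply pow_le.
  eapply Rle_trans; [apply Rmult_le_compat_r; [now apply pow_le|apply re_le_Cmod]|].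
  apply HM. }
assert (Him : Rbar_lt (Rabs t) (CV_radius (fun n => Im (c n)))).
{ eapply Rbar_lt_le_trans; [|apply (CV_radius_ge _ r M)]; [exact Ht|].
  intros n; rewrite Rabs_mult, (Rabs_pos_eq (r ^ n)) by now apply pow_le.
  eapply Rle_trans; [apply Rmult_le_compat_r; [now apply pow_le|apply im_le_Cmod]|].
  apply HM. }
assert (Er : Re (Cps (fun n => INR (S n) * c (S n))%C t) =
  PSeries (PS_derive (fun n => Re (c n))) t).
{ apply PSeries_ext; intros n; unfold PS_derive; apply re_scal_l. }
assert (Ei : Im (Cps (fun n => INR (S n) * c (S n))%C t) =
  PSeries (PS_derive (fun n => Im (c n))) t).
{ apply PSeries_ext; intros n; unfold PS_derive; apply im_scal_l. }
assert (Hsum : forall (a : nat -> R), Rbar_lt (Rabs t) (CV_radius a) ->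
  is_series (fun n => a n * t ^ n) (PSeries a t)).
{ intros a Ha; apply is_pseries_R, PSeries_correct, CV_radius_inside, Ha. }
split; [|split].
- apply is_series_Re_Im; split.
  + eapply is_series_ext; [|apply (Hsum _ Hre)].
    intros n; rewrite <- RtoC_pow, re_scal_r; easy.
  + eapply is_series_ext; [|apply (Hsum _ Him)].
    intros n; rewrite <- RtoC_pow, im_scal_r; easy.
- apply is_series_Re_Im; split.
  + rewrite Er.
    eapply is_series_ext; [|apply (Hsum (PS_derive (fun n => Re (c n))))].
    * intros n; rewrite <- RtoC_pow, re_scal_r, re_scal_l; easy.
    * now rewrite CV_radius_derive.
  + rewrite Ei.
    eapply is_series_ext; [|apply (Hsum (PS_derive (fun n => Im (c n))))].
    * intros n; rewrite <- RtoC_pow, im_scal_r, im_scal_l; easy.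
    * now rewrite CV_radius_derive.
- split.
  + rewrite Er; now apply is_derive_PSeries.
  + rewrite Ei; now apply is_derive_PSeries.
Qed.

Lemma Cps_0 (c : nat -> C) : Cps c 0 = c 0%nat.
Proof. unfold Cps; rewrite !PSeries_0; now destruct (c 0%nat). Qed.

(** Both sides solve [b' = z b], [b 0 = 1] along the segment from 0 to [z]. *)
Lemma is_series_Cexp (z : C) : is_series (fun n => z ^ n / INR (fact n))%C (Cexp z).
Proof.
set (c := fun n => (z ^ n / INR (fact n))%C).
assert (Hf : forall n, RtoC (INR (fact n)) <> RtoC 0).
{ intros; apply RtoC_neq_0, INR_fact_neq_0. }
assert (HM : forall n, Cmod (c n) * 2 ^ n <= exp (Cmod z * 2)).
{ intros n; pose proof (is_exp_Reals (Cmod z * 2)) as H; apply is_pseries_R in H.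
  assert (Hp : forall k, 0 <= / INR (fact k) * (Cmod z * 2) ^ k).
  { intros k; apply Rmult_le_pos; [left; apply Rinv_0_lt_compat, INR_fact_lt_0|].
    apply pow_le; pose proof (Cmod_ge_0 z); lra. }
  eapply Rle_trans; [|apply (sum_n_le_series _ _ n Hp H)].
  replace (Cmod (c n) * 2 ^ n) with (/ INR (fact n) * (Cmod z * 2) ^ n).
  - destruct n as [|n]; [rewrite sum_O; lra|].
    rewrite sum_Sn; unfold plus; simpl AbelianMonoid.plus.
    assert (0 <= sum_n (fun k => / INR (fact k) * (Cmod z * 2) ^ k) n).
    { clear -Hp; induction n; [rewrite sum_O; apply Hp|].
      rewrite sum_Sn; apply Rplus_le_le_0_compat; auto. }
    simpl in *; lra.
  - unfold c; rewrite Cmod_div, Cmod_pow, Cmod_pos_R, Rpow_mult_distr by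
      (auto; apply pos_INR).
    field; apply INR_fact_neq_0. }
assert (Hall : forall t, 0 <= t <= 1 ->
  CD (fun t => Cps c t * Cexp (0 + t * - z))%C t 0).
{ intros t Ht.
  destruct (Cps_derive c 2 _ t ltac:(lra) HM) as (_ & _ & H3).
  { rewrite Rabs_pos_eq; lra. }
  eapply CD_eq; [apply CD_mult; [exact H3|apply CD_exp, CD_line]|].
  assert (E : Cps (fun n => INR (S n) * c (S n))%C t = (z * Cps c t)%C).
  { destruct (Cps_derive c 2 _ t ltac:(lra) HM) as (S1 & S2 & _).
    { rewrite Rabs_pos_eq; lra. }
    apply (is_series_C_unique _ _ _ S2).
    eapply is_series_C_ext; [|reflexivity|apply (is_series_C_scal z _ _ S1)].
    intros n; unfold c; cbv beta; rewrite fact_simpl, mult_INR, RtoC_mult, Cpow_S.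
    field; split; [apply Hf|apply RtoC_neq_0, not_0_INR; lia]. }
  rewrite E; ring. }
pose proof (CD_zero_const _ 0 1 ltac:(lra) Hall) as E; cbv beta in E.
rewrite Cps_0 in E; unfold c at 2 in E; simpl in E.
assert (E1 : Cps c 1 = Cexp z).
{ replace (0 + 1 * - z)%C with (- z)%C in E by ring.
  replace (0 + 0 * - z)%C with (RtoC 0) in E by ring.
  rewrite Cexp_0, Cexp_opp in E.
  replace (Cps c 1) with (Cps c 1 * / Cexp z * Cexp z)%C
    by (field; apply Cexp_neq_0).
  rewrite E; field; apply RtoC_neq_0; lra. }
destruct (Cps_derive c 2 _ 1 ltac:(lra) HM) as (S1 & _ & _).
{ rewrite Rabs_pos_eq; lra. }
eapply is_series_C_ext; [|exact E1|exact S1].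
intros n; cbv beta; unfold c; rewrite Cpow_1_l; ring.
Qed.

(** The generalised binomial coefficient [g choose n]. *)
Fixpoint binc (g : C) (n : nat) : C :=
  match n with
  | O => RtoC 1
  | S m => binc g m * (g - INR m) / INR (S m)
  end%C.

Lemma binc_S (g : C) (m : nat) : binc g (S m) = (binc g m * (g - INR m) / INR (S m))%C.
Proof. reflexivity. Qed.

Lemma eventually_decreasing_bounded (u : nat -> R) (m0 : nat) :
  (forall m, (m0 <= m)%nat -> u (S m) <= u m) -> exists M, forall m, u m <= M.
Proof.
induction m0 as [|m0 IH]; intros H.
- exists (u 0%nat); induction m as [|m IHm]; [lra|].
  specialize (H m ltac:(lia)); lra.
- assert (Hfin : forall k, exists M, forall m, (m <= k)%nat -> u m <= M).
  { induction k as [|k [M HM]].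
    - exists (u 0%nat); intros m Hm; replace m with 0%nat by lia; lra.
    - exists (Rmax M (u (S k))); intros m Hm.
      destruct (Nat.eq_dec m (S k)) as [->|Hne]; [apply Rmax_r|].
      eapply Rle_trans; [apply HM; lia|apply Rmax_l]. }
  destruct (Hfin (S m0)) as [M HM]; exists M; intros m.
  destruct (le_lt_dec m (S m0)) as [Hm|Hm]; [now apply HM|].
  apply Rle_trans with (u (S m0)); [|apply HM; lia].
  induction m as [|m IHm]; [lia|].
  destruct (Nat.eq_dec m (S m0)) as [->|Hne]; [apply H; lia|].
  eapply Rle_trans; [apply H; lia|apply IHm; lia].
Qed.

Lemma binc_bound (g : C) (q : R) : 0 <= q < 1 ->
  exists M, forall m, Cmod (binc g m) * q ^ m <= M.
Proof.
intros Hq.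
destruct (INR_archimed (1 - q) (Cmod g) ltac:(lra)) as [m0 Hm0].
apply (eventually_decreasing_bounded _ m0); intros m Hm; rewrite binc_S.
assert (HS : 0 < INR (S m)) by (apply lt_0_INR; lia).
rewrite Cmod_div, Cmod_mult, (Cmod_pos_R (INR (S m))) by
  first [lra|now apply RtoC_neq_0, Rgt_not_eq].
pose proof (Cmod_triangle_minus g (INR m)) as Ht.
rewrite (Cmod_pos_R (INR m)) in Ht by apply pos_INR.
apply le_INR in Hm.
assert (Hk : Cmod (g - INR m) / INR (S m) * q <= 1).
{ apply Rmult_le_reg_r with (INR (S m)); [easy|].
  replace (Cmod (g - INR m) / INR (S m) * q * INR (S m)) with
    (Cmod (g - INR m) * q) by (field; lra).
  rewrite S_INR in *.
  assert (Cmod (g - INR m) * q <= (Cmod g + INR m) * q) by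
    (apply Rmult_le_compat_r; lra).
  pose proof (Cmod_ge_0 g); pose proof (pos_INR m).
  assert (Cmod g <= (1 - q) * INR m) by nra. nra. }
replace (Cmod (binc g m) * Cmod (g - INR m) / INR (S m) * q ^ S m) with
  ((Cmod (binc g m) * q ^ m) * (Cmod (g - INR m) / INR (S m) * q)) by
  (rewrite <- tech_pow_Rmult; field; lra).
rewrite <- (Rmult_1_r (Cmod (binc g m) * q ^ m)) at 2.
apply Rmult_le_compat_l; [|easy].
apply Rmult_le_pos; [apply Cmod_ge_0|apply pow_le; lra].
Qed.

Lemma binc_summable (g : C) (q : R) : 0 <= q < 1 ->
  ex_series (fun m => Cmod (binc g m) * q ^ m).
Proof.
intros Hq; set (p := (1 + q) / 2).
assert (Hp : 0 < p < 1) by (unfold p; lra).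
destruct (binc_bound g p ltac:(lra)) as [M HM].
apply (ex_series_geom_dominated _ M p); [intros; apply Cmod_ge_0|unfold p; lra|easy].
Qed.

(** Along the segment from 1 to [1 + v] the series [b] satisfies
    [(1 + t v) b' = g v b], the equation of [(1 + t v) ^ g]. *)
Lemma is_series_binomial (g v : C) : Cmod v < 1 ->
  is_series (fun m => binc g m * v ^ m)%C (Cpw (1 + v) g).
Proof.
intros Hv; set (c := fun m => (binc g m * v ^ m)%C).
set (r := 2 / (1 + Cmod v)).
pose proof (Cmod_ge_0 v) as Hv0.
assert (Hr : 1 < r).
{ unfold r; apply Rmult_lt_reg_r with (1 + Cmod v); [lra|].
  replace (2 / (1 + Cmod v) * (1 + Cmod v)) with 2 by (field; lra); lra. }
assert (Hvr : 0 <= Cmod v * r < 1).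
{ split; [nra|]; unfold r; apply Rmult_lt_reg_r with (1 + Cmod v); [lra|].
  replace (Cmod v * (2 / (1 + Cmod v)) * (1 + Cmod v)) with (2 * Cmod v)
    by (field; lra); lra. }
destruct (binc_bound g _ Hvr) as [M HM0].
assert (HM : forall m, Cmod (c m) * r ^ m <= M).
{ intros m; unfold c; rewrite Cmod_mult, Cmod_pow, Rmult_assoc, <- Rpow_mult_distr.
  apply HM0. }
assert (Hre : forall t, 0 <= t <= 1 -> 0 < Re (1 + t * v)).
{ intros t Ht; rewrite re_plus, re_scal_l; simpl.
  pose proof (re_le_Cmod v) as H; apply Rabs_le_between in H; nra. }
assert (Hall : forall t, 0 <= t <= 1 ->
  CD (fun t => Cps c t * Cexp (- g * Clog (1 + t * v)))%C t 0).
{ intros t Ht.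
  destruct (Cps_derive c r _ t ltac:(lra) HM) as (S1 & S2 & H3).
  { rewrite Rabs_pos_eq; lra. }
  pose proof (Re_pos_neq_0 _ (Hre t Ht)) as Hnz.
  eapply CD_eq; [apply CD_mult; [exact H3|apply CD_exp, CD_scal, CD_Clog;
    [apply CD_line|now apply Hre]]|].
  set (b' := Cps (fun n => INR (S n) * c (S n))%C t) in *.
  assert (E : ((1 + t * v) * b' = g * v * Cps c t)%C).
  { assert (S3 : is_series (fun n => INR n * c n * t ^ n)%C (t * b')%C).
    { apply is_series_C_shift.
      eapply is_series_C_ext; [| |apply (is_series_C_scal t _ _ S2)].
      - intros n; cbv beta; rewrite Cpow_S; ring.
      - simpl; ring. }
    pose proof (is_series_C_plus _ _ _ _ S2 (is_series_C_scal v _ _ S3)) as S4.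
    replace ((1 + t * v) * b')%C with (b' + v * (t * b'))%C by ring.
    apply (is_series_C_unique _ _ _ S4).
    eapply is_series_C_ext; [|reflexivity|apply (is_series_C_scal (g * v) _ _ S1)].
    intros n; unfold c; cbv beta; rewrite binc_S, Cpow_S.
    field; apply RtoC_neq_0, not_0_INR; lia. }
  replace b' with (g * v * Cps c t / (1 + t * v))%C by (rewrite <- E; field; easy).
  field; easy. }
pose proof (CD_zero_const _ 0 1 ltac:(lra) Hall) as E; cbv beta in E.
rewrite Cps_0 in E; unfold c at 2 in E; simpl binc in E; simpl Cpow in E.
replace (1 + 0 * v)%C with (RtoC 1) in E by ring.
replace (1 + 1 * v)%C with (1 + v)%C in E by ring.
rewrite Clog_1 in E; replace (- g * 0)%C with (RtoC 0) in E by ring.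
rewrite Cexp_0 in E.
assert (E1 : Cps c 1 = Cpw (1 + v) g).
{ unfold Cpw; replace (g * Clog (1 + v))%C with (- (- g * Clog (1 + v)))%C by ring.
  rewrite Cexp_opp.
  replace (Cps c 1) with (Cps c 1 * Cexp (- g * Clog (1 + v))
    * / Cexp (- g * Clog (1 + v)))%C by (field; apply Cexp_neq_0).
  rewrite E; ring. }
destruct (Cps_derive c r _ 1 ltac:(lra) HM) as (S1 & _ & _).
{ rewrite Rabs_pos_eq; lra. }
eapply is_series_C_ext; [|exact E1|exact S1].
intros n; cbv beta; unfold c; rewrite Cpow_1_l; ring.
Qed.

(** * Analytic functions *)

Lemma Cgeom_sum (q : C) (n : nat) :
  ((q - 1) * sum_n (fun j => q ^ j) n)%C = (q ^ S n - 1)%C.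
Proof.
induction n as [|n IH]; [rewrite sum_O; simpl; ring|].
rewrite sum_Sn; change (plus ?x ?y) with (x + y)%C.
rewrite Cmult_plus_distr_l, IH, !Cpow_S; ring.
Qed.

Lemma is_series_Cgeom (q : C) : Cmod q < 1 -> is_series (fun n => q ^ n)%C (/ (1 - q))%C.
Proof.
intros Hq; pose proof (Cmod_ge_0 q) as H0.
assert (Hnz : (1 - q)%C <> RtoC 0).
{ intros E; apply (f_equal Re) in E; rewrite Re_minus in E; simpl in E.
  pose proof (re_le_Cmod q) as H; apply Rabs_le_between in H; lra. }
apply is_series_Clim, (Clim_le _ _ (fun n => Cmod q ^ S n / Cmod (1 - q))).
- intros n.
  replace (sum_n (fun k => q ^ k)%C n) with ((1 - q ^ S n) / (1 - q))%C.
  2: { pose proof (Cgeom_sum q n) as E.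
       replace (1 - q ^ S n)%C with (- (q ^ S n - 1))%C by ring.
       rewrite <- E; field; easy. }
  replace ((1 - q ^ S n) / (1 - q) - / (1 - q))%C with (- (q ^ S n / (1 - q)))%C
    by (field; easy).
  rewrite Cmod_opp, Cmod_div, Cmod_pow by easy; lra.
- replace (Finite 0) with (Finite (0 / Cmod (1 - q))).
  2: { f_equal; field; intros E; now apply Hnz, Cmod_eq_0. }
  apply (is_lim_seq_scal_r _ _ 0).
  apply (is_lim_seq_incr_1 (fun n => Cmod q ^ n)), is_lim_seq_geom.
  rewrite Rabs_pos_eq; easy.
Qed.

Lemma is_series_bounded (a : nat -> C) : ex_series a -> exists B, forall n, Cmod (a n) <= B.
Proof.
intros [l Hl]; apply is_series_Re_Im in Hl; destruct Hl as [H1 H2].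
assert (Hr : is_lim_seq (fun n => Re (a n)) 0) by (apply ex_series_lim_0; eexists; eauto).
assert (Hi : is_lim_seq (fun n => Im (a n)) 0) by (apply ex_series_lim_0; eexists; eauto).
destruct (filterlim_bounded (fun n => Re (a n)) (ex_intro _ 0 Hr)) as [B1 HB1].
destruct (filterlim_bounded (fun n => Im (a n)) (ex_intro _ 0 Hi)) as [B2 HB2].
exists (B1 + B2); intros n; eapply Rle_trans; [apply Cmod_le_Re_Im|].
specialize (HB1 n); specialize (HB2 n); unfold norm in *; simpl in *; unfold abs in *;
  simpl in *; lra.
Qed.

(** Convergence at one point gives absolute convergence closer to 0. *)
Lemma pser_abs (a : nat -> C) (h : C) (rho : R) :
  ex_series (fun n => a n * h ^ n)%C -> 0 <= rho < Cmod h ->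
  ex_series (fun n => Cmod (a n) * rho ^ n).
Proof.
intros H Hrho; set (p := Cmod h) in *.
destruct (is_series_bounded _ H) as [B HB].
apply (ex_series_geom_dominated _ B p); [intros; apply Cmod_ge_0|easy|].
intros n; specialize (HB n); now rewrite Cmod_mult, Cmod_pow in HB.
Qed.

Lemma pser_continuous_0 (a : nat -> C) (rho : R) : 0 < rho ->
  ex_series (fun n => Cmod (a n) * rho ^ n) ->
  exists K, forall h l : C, Cmod h <= rho -> is_series (fun n => a n * h ^ n)%C l ->
    Cmod (l - a 0%nat) <= K * Cmod h.
Proof.
intros Hrho Hs.
apply (ex_series_incr_1 (fun n => Cmod (a n) * rho ^ n)) in Hs.
destruct Hs as [T HT]; exists (T / rho); intros h l Hh Hl.
apply is_series_C_shift in Hl.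
replace (a 0%nat) with (a 0%nat * h ^ 0)%C by (simpl; ring).
apply (Cmod_series_le _ (fun n => Cmod (a (S n)) * rho ^ S n * (Cmod h / rho)) _ _ Hl).
- replace (T / rho * Cmod h) with (T * (Cmod h / rho)) by (field; lra).
  now apply is_series_scal_r.
- intros n; rewrite Cmod_mult, Cmod_pow, <- !tech_pow_Rmult.
  replace (Cmod (a (S n)) * (rho * rho ^ n) * (Cmod h / rho)) with
    (Cmod (a (S n)) * (Cmod h * rho ^ n)) by (field; lra).
  pose proof (Cmod_ge_0 h).
  apply Rmult_le_compat_l; [apply Cmod_ge_0|].
  apply Rmult_le_compat_l; [easy|apply pow_incr; lra].
Qed.

Lemma pser_zero_0 (a : nat -> C) (delta : R) : 0 < delta ->
  (forall t, 0 < t < delta -> is_series (fun n => a n * RtoC t ^ n)%C (RtoC 0)) ->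
  a 0%nat = RtoC 0.
Proof.
intros Hd H.
assert (Hs : ex_series (fun n => Cmod (a n) * (delta / 3) ^ n)).
{ apply (pser_abs a (delta / 2)%R).
  - eexists; apply H; lra.
  - rewrite Cmod_pos_R; lra. }
destruct (pser_continuous_0 a (delta / 3) ltac:(lra) Hs) as [K HK].
apply Cmod_eq_0.
destruct (Rle_lt_dec (Cmod (a 0%nat)) 0) as [Hle|Hgt].
{ pose proof (Cmod_ge_0 (a 0%nat)); lra. }
exfalso.
set (m := Cmod (a 0%nat)) in *; set (K' := Rabs K + 1).
assert (HK' : 0 < K') by (unfold K'; pose proof (Rabs_pos K); lra).
set (t := Rmin (delta / 3) (m / (2 * K'))).
assert (Ht : 0 < t <= delta / 3).
{ split; [|apply Rmin_l]; apply Rmin_glb_lt; [lra|].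
  apply Rdiv_lt_0_compat; lra. }
assert (Ht2 : t * K' <= m / 2).
{ apply Rle_trans with (m / (2 * K') * K'); [|right; field; lra].
  apply Rmult_le_compat_r; [lra|apply Rmin_r]. }
specialize (HK t 0%C ltac:(rewrite Cmod_pos_R; lra) (H t ltac:(lra))).
replace (0 - a 0%nat)%C with (- a 0%nat)%C in HK by ring.
rewrite Cmod_opp, (Cmod_pos_R t) in HK by lra; fold m in HK.
pose proof (Rle_abs K); unfold K' in *; nra.
Qed.

(** A power series that vanishes on one side of 0 along a line has no nonzero
    coefficient: the constant term vanishes by continuity, then divide by [t]. *)
Lemma pser_zero (a : nat -> C) (delta : R) : 0 < delta ->
  (forall t, 0 < t < delta -> is_series (fun n => a n * RtoC t ^ n)%C (RtoC 0)) ->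
  forall n, a n = RtoC 0.
Proof.
intros Hd H n; revert a H; induction n as [|n IH]; intros a H.
- now apply (pser_zero_0 a delta).
- pose proof (pser_zero_0 a delta Hd H) as H0.
  apply (IH (fun k => a (S k))); intros t Ht.
  pose proof (H t Ht) as H1; apply is_series_C_shift in H1.
  assert (Hnz : RtoC t <> RtoC 0) by (apply RtoC_neq_0; lra).
  eapply is_series_C_ext; [| |apply (is_series_C_scal (/ t) _ _ H1)].
  + intros k; cbv beta; rewrite Cpow_S; field; easy.
  + rewrite H0; ring.
Qed.

(** [AN f s r]: on the disc of centre [s] and radius [r], [f] is the sum of a
    power series. Keeping the radius explicit is what allows termwise operations
    on infinitely many functions. *)
Definition AN (f : C -> C) (s : C) (r : R) : Prop :=
  exists a : nat -> C, forall h, Cmod h < r ->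
    is_series (fun n => a n * h ^ n)%C (f (s + h)%C).

Lemma is_pseries_C (a : nat -> C) (h l : C) :
  is_pseries a h l <-> is_series (fun n => a n * h ^ n)%C l.
Proof.
assert (E : forall n, scal (pow_n h n) (a n) = (a n * h ^ n)%C).
{ intros n; rewrite Cmult_comm; change (scal ?x ?y) with (x * y)%C; f_equal. }
unfold is_pseries; split; apply is_series_ext; intros; now rewrite E.
Qed.

Lemma analytic_at_AN (f : C -> C) (s : C) :
  analytic_at f s <-> exists r, 0 < r /\ AN f s r.
Proof.
split.
- intros (r & a & Hr & H); exists r; split; [easy|]; exists a; intros h Hh.
  now apply is_pseries_C, H.
- intros (r & Hr & a & H); exists r, a; split; [easy|]; intros h Hh.
  now apply is_pseries_C, H.
Qed.

Lemma AN_shrink (f : C -> C) (s : C) (r r' : R) : r' <= r -> AN f s r -> AN f s r'.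
Proof. intros H [a Ha]; exists a; intros h Hh; apply Ha; lra. Qed.

Lemma AN_ext (f g : C -> C) (s : C) (r : R) :
  (forall h, Cmod h < r -> f (s + h)%C = g (s + h)%C) -> AN f s r -> AN g s r.
Proof. intros H [a Ha]; exists a; intros h Hh; rewrite <- H by easy; now apply Ha. Qed.

Lemma AN_const (c s : C) (r : R) : AN (fun _ => c) s r.
Proof.
exists (fun n => match n with O => c | _ => RtoC 0 end); intros h _.
apply is_series_C_shift.
apply (is_series_C_ext (fun n : nat => 0 * 0)%C _ 0%C); [intros; ring|simpl; ring|].
apply is_series_C_shift; apply is_series_Clim, (Clim_ext (fun _ => 0 - 0 * 0)%C);
  [|apply Clim_const].
induction n as [|n IH]; [rewrite sum_O; ring|].
rewrite sum_Sn, <- IH; change (plus ?x ?y) with (x + y)%C; ring.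
Qed.

Lemma AN_plus (f g : C -> C) (s : C) (r : R) :
  AN f s r -> AN g s r -> AN (fun z => f z + g z)%C s r.
Proof.
intros [a Ha] [b Hb]; exists (fun n => a n + b n)%C; intros h Hh.
eapply is_series_C_ext; [|reflexivity|apply (is_series_C_plus _ _ _ _ (Ha h Hh) (Hb h Hh))].
intros n; cbv beta; ring.
Qed.

Lemma AN_scal (c : C) (f : C -> C) (s : C) (r : R) : AN f s r -> AN (fun z => c * f z)%C s r.
Proof.
intros [a Ha]; exists (fun n => c * a n)%C; intros h Hh.
eapply is_series_C_ext; [|reflexivity|apply (is_series_C_scal c _ _ (Ha h Hh))].
intros n; cbv beta; ring.
Qed.

Lemma AN_minus (f g : C -> C) (s : C) (r : R) :
  AN f s r -> AN g s r -> AN (fun z => f z - g z)%C s r.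
Proof.
intros Hf Hg; apply (AN_ext (fun z => f z + (-1) * g z)%C); [intros; ring|].
apply AN_plus; [easy|now apply AN_scal].
Qed.

Lemma AN_id (s : C) (r : R) : AN (fun z => z) s r.
Proof.
destruct (AN_const 1 s r) as [a Ha].
exists (fun n => match n with O => s | S m => a m end); intros h Hh.
apply is_series_C_shift.
eapply is_series_C_ext; [| |apply (is_series_C_scal h _ _ (Ha h Hh))].
- intros n; cbv beta; rewrite Cpow_S; ring.
- simpl; ring.
Qed.

Lemma AN_exp (c s : C) (r : R) : AN (fun z => Cexp (c * z)) s r.
Proof.
exists (fun n => Cexp (c * s) * (c ^ n / INR (fact n)))%C; intros h _.
eapply is_series_C_ext; [| |apply (is_series_C_scal (Cexp (c * s)) _ _
  (is_series_Cexp (c * h)))].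
- intros n; cbv beta; rewrite Cpow_mult_l; unfold Cdiv; ring.
- rewrite <- Cexp_plus; f_equal; ring.
Qed.

Lemma AN_inv (p s : C) : s <> p -> AN (fun z => / (z - p))%C s (Cmod (s - p)).
Proof.
intros Hsp; assert (Hnz : (s - p)%C <> RtoC 0) by now apply Cminus_eq_contra.
pose proof (proj1 (Cmod_gt_0 _) Hnz) as Hpos.
exists (fun n => / (s - p) * (- / (s - p)) ^ n)%C; intros h Hh.
assert (Hq : Cmod (- / (s - p) * h) < 1).
{ rewrite Cmod_mult, Cmod_opp, Cmod_inv by easy.
  apply Rmult_lt_reg_l with (Cmod (s - p)); [easy|].
  rewrite <- Rmult_assoc, Rinv_r by lra; lra. }
eapply is_series_C_ext; [| |apply (is_series_C_scal (/ (s - p)) _ _ (is_series_Cgeom _ Hq))].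
- intros n; cbv beta; rewrite Cpow_mult_l; ring.
- assert (s + h - p <> 0)%C.
  { intros E; replace h with (- (s - p))%C in Hh.
    - rewrite Cmod_opp in Hh; lra.
    - replace h with ((s + h - p) - (s - p))%C by ring; rewrite E; ring. }
  field; easy.
Qed.

Lemma sum_n_R_plus (u v : nat -> R) (n : nat) :
  sum_n (fun k => u k + v k) n = sum_n u n + sum_n v n.
Proof. exact (sum_n_plus u v n). Qed.

Lemma sum_n_R_minus (u v : nat -> R) (n : nat) :
  sum_n (fun k => u k - v k) n = sum_n u n - sum_n v n.
Proof.
induction n as [|n IH]; [now rewrite !sum_O|].
rewrite !sum_Sn, IH; unfold plus; simpl; ring.
Qed.

Lemma is_series_Cauchy_prod (a b : nat -> C) (la lb : C) :
  is_series a la -> is_series b lb ->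
  ex_series (fun n => Cmod (a n)) -> ex_series (fun n => Cmod (b n)) ->
  is_series (fun n => sum_n (fun k => a k * b (n - k)%nat)%C n) (la * lb)%C.
Proof.
intros Ha Hb Aa Ab.
apply is_series_Re_Im in Ha, Hb; destruct Ha as [Ha1 Ha2], Hb as [Hb1 Hb2].
assert (Habs : forall (f : C -> R) (c : nat -> C), (forall z, Rabs (f z) <= Cmod z) ->
  ex_series (fun n => Cmod (c n)) -> ex_series (fun n => Rabs (f (c n)))).
{ intros f c Hf Hc; apply (ex_series_R_le _ (fun n => Cmod (c n))); [|easy].
  intros n; split; [apply Rabs_pos|apply Hf]. }
pose proof (Habs Re a re_le_Cmod Aa) as A1; pose proof (Habs Im a im_le_Cmod Aa) as A2.
pose proof (Habs Re b re_le_Cmod Ab) as B1; pose proof (Habs Im b im_le_Cmod Ab) as B2.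
pose proof (is_series_mult _ _ _ _ Ha1 Hb1 A1 B1) as S1.
pose proof (is_series_mult _ _ _ _ Ha2 Hb2 A2 B2) as S2.
pose proof (is_series_mult _ _ _ _ Ha1 Hb2 A1 B2) as S3.
pose proof (is_series_mult _ _ _ _ Ha2 Hb1 A2 B1) as S4.
apply is_series_Re_Im; split.
- rewrite re_mult; eapply is_series_ext; [|apply (is_series_minus _ _ _ _ S1 S2)].
  intros n; rewrite Re_sum_n, <- !sum_n_Reals.
  transitivity (sum_n (fun k => Re (a k) * Re (b (n - k)%nat)) n -
    sum_n (fun k => Im (a k) * Im (b (n - k)%nat)) n); [reflexivity|].
  rewrite <- sum_n_R_minus; apply sum_n_ext; intros k; now rewrite re_mult.
- rewrite im_mult; eapply is_series_ext; [|apply (is_series_plus _ _ _ _ S3 S4)].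
  intros n; rewrite Im_sum_n, <- !sum_n_Reals.
  transitivity (sum_n (fun k => Re (a k) * Im (b (n - k)%nat)) n +
    sum_n (fun k => Im (a k) * Re (b (n - k)%nat)) n); [reflexivity|].
  rewrite <- sum_n_R_plus; apply sum_n_ext; intros k; now rewrite im_mult.
Qed.

Lemma AN_mult (f g : C -> C) (s : C) (r : R) :
  AN f s r -> AN g s r -> AN (fun z => f z * g z)%C s r.
Proof.
intros [a Ha] [b Hb].
exists (fun n => sum_n (fun k => a k * b (n - k)%nat)%C n); intros h Hh.
set (p := (Cmod h + r) / 2).
assert (Hp : Cmod h < p < r) by (unfold p; lra).
pose proof (Cmod_ge_0 h) as Hh0.
assert (Hpp : Cmod p = p) by (apply Cmod_pos_R; lra).
assert (Habs : forall c : nat -> C, ex_series (fun n => c n * RtoC p ^ n)%C ->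
  ex_series (fun n => Cmod (c n * h ^ n))).
{ intros c Hc; eapply ex_series_ext; [|apply (pser_abs c p (Cmod h) Hc)].
  - intros n; now rewrite Cmod_mult, Cmod_pow.
  - rewrite Hpp; lra. }
eapply is_series_C_ext; [|reflexivity|
  apply (is_series_Cauchy_prod _ _ _ _ (Ha h Hh) (Hb h Hh))].
- intros n; cbv beta.
  transitivity (sum_n (fun k => a k * b (n - k)%nat * h ^ n)%C n).
  2: { exact (sum_n_mult_r (K := C_Ring) (h ^ n)%C (fun k => a k * b (n - k)%nat)%C n). }
  apply sum_n_ext_loc; intros k Hk.
  replace (h ^ n)%C with (h ^ k * h ^ (n - k))%C
    by (rewrite <- Cpow_add_r; f_equal; lia).
  Cring.
- apply Habs; eexists; apply Ha; lra.
- apply Habs; eexists; apply Hb; lra.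
Qed.

(** The [n]-th power of [exp (2 PI i d / K)], the building block of the averages
    over roots of unity. *)
Definition root_of_unity (K : nat) (d : R) : C :=
  Cexp (Ci * RtoC (2 * PI * d / INR K)).

Lemma Cexp_2PI_Z (k : Z) : Cexp (Ci * RtoC (2 * PI * IZR k)) = RtoC 1.
Proof.
assert (Hn : forall n : nat, Cexp (Ci * RtoC (2 * PI * INR n)) = RtoC 1).
{ intros n; replace (Ci * RtoC (2 * PI * INR n))%C with (INR n * (Ci * RtoC (2 * PI)))%C
    by (rewrite !RtoC_mult; ring).
  rewrite Cexp_nat, Cexp_Ci, cos_2PI, sin_2PI; apply Cpow_1_l. }
destruct (Z_le_dec 0 k) as [H|H].
- rewrite <- (Z2Nat.id k H), <- INR_IZR_INZ; apply Hn.
- replace (Ci * RtoC (2 * PI * IZR k))%C with (- (Ci * RtoC (2 * PI * IZR (- k))))%C.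
  2: { rewrite opp_IZR, !RtoC_mult, RtoC_opp; ring. }
  rewrite Cexp_opp, <- (Z2Nat.id (- k)), <- INR_IZR_INZ, Hn by lia.
  field; apply RtoC_neq_0; lra.
Qed.

Lemma root_of_unity_pow (n : nat) (d : Z) :
  (root_of_unity (S n) (IZR d) ^ S n)%C = RtoC 1.
Proof.
unfold root_of_unity; rewrite <- Cexp_nat, <- (Cexp_2PI_Z d); f_equal.
replace (RtoC (2 * PI * IZR d)) with (RtoC (INR (S n)) * RtoC (2 * PI * IZR d / INR (S n)))%C.
- ring.
- rewrite <- RtoC_mult; f_equal; field; apply not_0_INR; lia.
Qed.

Lemma root_of_unity_sum (n : nat) (d : Z) :
  root_of_unity (S n) (IZR d) <> RtoC 1 ->
  sum_n (fun j => root_of_unity (S n) (IZR d) ^ j)%C n = RtoC 0.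
Proof.
intros H; pose proof (Cgeom_sum (root_of_unity (S n) (IZR d)) n) as E.
rewrite root_of_unity_pow in E.
set (q := root_of_unity (S n) (IZR d)) in *.
assert (Hcancel : forall t : C, ((q - 1) * t)%C = (1 - 1)%C -> t = RtoC 0).
{ intros t Et; replace t with ((q - 1) * t / (q - 1))%C by
    (field; now apply Cminus_eq_contra).
  rewrite Et; field; now apply Cminus_eq_contra. }
exact (Hcancel _ E).
Qed.

Lemma root_of_unity_neq_1 (K : nat) (d : R) : d <> 0 -> Rabs d < INR K ->
  root_of_unity K d <> RtoC 1.
Proof.
intros Hd HK E; unfold root_of_unity in E; rewrite <- Cexp_0 in E.
assert (H0 : 0 < INR K) by (pose proof (Rabs_pos d); lra).
pose proof PI_RGT_0 as HPI.
apply Cexp_inj in E.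
- apply (f_equal Im) in E.
  replace (Im (Ci * RtoC (2 * PI * d / INR K))) with (2 * PI * d / INR K) in E
    by (simpl; ring).
  simpl in E; apply Hd.
  replace d with (2 * PI * d / INR K * (INR K / (2 * PI))) by (field; lra).
  rewrite E; ring.
- simpl; replace (0 * 0 + 1 * (2 * PI * d / INR K) - 0) with (2 * PI / INR K * d) by (field; lra).
  rewrite Rabs_mult, Rabs_pos_eq by
    (apply Rmult_le_pos; [lra|left; now apply Rinv_0_lt_compat]).
  apply Rmult_lt_reg_r with (INR K); [easy|].
  replace (2 * PI / INR K * Rabs d * INR K) with (2 * PI * Rabs d) by (field; lra).
  nra.
Qed.

Lemma root_of_unity_plus (K : nat) (d e : R) :
  (root_of_unity K d * root_of_unity K e)%C = root_of_unity K (d + e).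
Proof.
unfold root_of_unity; rewrite <- Cexp_plus; f_equal.
rewrite <- Cmult_plus_distr_l, <- RtoC_plus; do 2 f_equal; unfold Rdiv; ring.
Qed.

Lemma root_of_unity_pow_nat (K n : nat) (d : R) :
  (root_of_unity K d ^ n)%C = root_of_unity K (INR n * d).
Proof.
unfold root_of_unity; rewrite <- Cexp_nat; f_equal.
replace (2 * PI * (INR n * d) / INR K) with (INR n * (2 * PI * d / INR K))
  by (unfold Rdiv; ring).
rewrite RtoC_mult; ring.
Qed.

Lemma Cmod_root_of_unity (K : nat) (d : R) : Cmod (root_of_unity K d) = 1.
Proof.
unfold root_of_unity; rewrite Cmod_Cexp, <- exp_0; f_equal; simpl; ring.
Qed.

Lemma root_of_unity_0 (K : nat) : root_of_unity K 0 = RtoC 1.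
Proof.
unfold root_of_unity; replace (2 * PI * 0 / INR K) with 0 by (unfold Rdiv; ring).
rewrite Cmult_0_r; apply Cexp_0.
Qed.

(** Averaging [f (rho w) w ^ (- m)] over the [n + 1]-st roots of unity [w] isolates
    the coefficient of index [m] in the partial sum of order [n], and the average
    is at most [M]; the remainder of the series then tends to 0. *)
Lemma cauchy_estimate (f : C -> C) (a : nat -> C) (r rho M : R) (m : nat) :
  (forall h, Cmod h < r -> is_series (fun n => a n * h ^ n)%C (f h)) ->
  (forall h, Cmod h < r -> Cmod (f h) <= M) -> 0 <= rho < r ->
  Cmod (a m) * rho ^ m <= M.
Proof.
intros Ha HM Hrho.
assert (Hp : Cmod (RtoC ((rho + r) / 2)) = (rho + r) / 2) by (apply Cmod_pos_R; lra).
destruct (pser_abs a ((rho + r) / 2)%R rho) as [B HB].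
{ eexists; apply Ha; lra. }
{ lra. }
set (Bn := sum_n (fun n => Cmod (a n) * rho ^ n)) in *.
assert (key : forall n, (m <= n)%nat -> Cmod (a m) * rho ^ m <= M + (B - Bn n)).
{ intros n Hmn; set (K := S n).
  assert (HK : 0 < INR K) by (apply lt_0_INR; unfold K; lia).
  set (h := fun j => (rho * root_of_unity K 1 ^ j)%C).
  set (e := fun j => (root_of_unity K (- INR m) ^ j)%C).
  assert (Hh : forall j, Cmod (h j) = rho).
  { intros j; unfold h; rewrite Cmod_mult, Cmod_pow, Cmod_root_of_unity, pow1.
    rewrite Cmod_pos_R; lra. }
  assert (He : forall j, Cmod (e j) = 1).
  { intros j; unfold e; rewrite Cmod_pow, Cmod_root_of_unity; apply pow1. }
  assert (E1 : sum_n (fun j => sum_n (fun l => a l * h j ^ l) n * e j)%C n =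
    (INR K * (a m * rho ^ m))%C).
  { transitivity (sum_n (fun j => sum_n (fun l => a l * rho ^ l *
      root_of_unity K (IZR (Z.of_nat l - Z.of_nat m)) ^ j) n)%C n).
    { apply sum_n_ext; intros j; rewrite <- sum_n_C_mult_r; apply sum_n_ext; intros l.
      unfold h, e; rewrite Cpow_mult_l, <- Cpow_mult_r, minus_IZR, <- !INR_IZR_INZ.
      rewrite !root_of_unity_pow_nat, <- Cmult_assoc, <- Cmult_assoc.
      rewrite root_of_unity_plus, <- Cmult_assoc; do 3 f_equal.
      rewrite mult_INR; ring. }
    rewrite sum_n_switch.
    transitivity (sum_n (fun l => if Nat.eq_dec l m
      then (INR K * (a m * rho ^ m))%C else RtoC 0) n); [|now apply sum_n_C_single].
    apply sum_n_ext_loc; intros l Hl; rewrite sum_n_C_mult_l.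
    destruct (Nat.eq_dec l m) as [->|Hne].
    - rewrite Z.sub_diag, root_of_unity_0.
      rewrite (sum_n_ext _ (fun _ => RtoC 1)) by apply Cpow_1_l.
      rewrite sum_n_C_const; unfold K; Cring.
    - unfold K; rewrite root_of_unity_sum; [Cring|].
      apply root_of_unity_neq_1.
      + apply not_0_IZR; lia.
      + rewrite INR_IZR_INZ, <- abs_IZR; apply IZR_lt; lia. }
  assert (E2 : Cmod (sum_n (fun j => f (h j) * e j)%C n) <= INR K * M).
  { eapply Rle_trans; [apply (Cmod_sum_n _ (fun _ => M))|].
    - intros j _; rewrite Cmod_mult, He, Rmult_1_r; apply HM; rewrite Hh; lra.
    - rewrite sum_n_const; unfold K; lra. }
  assert (E3 : Cmod (sum_n (fun j => (f (h j) - sum_n (fun l => a l * h j ^ l) n) * e j)%C n)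
    <= INR K * (B - Bn n)).
  { eapply Rle_trans; [apply (Cmod_sum_n _ (fun _ => B - Bn n))|].
    - intros j _; rewrite Cmod_mult, He, Rmult_1_r.
      apply series_remainder_bound; [apply Ha; rewrite Hh; lra|easy|].
      intros k; rewrite Cmod_mult, Cmod_pow, Hh; lra.
    - rewrite sum_n_const; unfold K; lra. }
  assert (E4 : (INR K * (a m * rho ^ m))%C = (sum_n (fun j => f (h j) * e j)%C n -
    sum_n (fun j => (f (h j) - sum_n (fun l => a l * h j ^ l) n) * e j)%C n)%C).
  { rewrite <- E1, <- (sum_n_ext (fun j => sum_n (fun l => a l * h j ^ l) n * e j
      + (f (h j) - sum_n (fun l => a l * h j ^ l) n) * e j)%C
      (fun j => f (h j) * e j)%C) by (intros; Cring).
    rewrite sum_n_C_plus.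
    assert (Hpm : forall x y : C, x = (x + y - y)%C) by (intros; ring).
    apply Hpm. }
  apply Rmult_le_reg_l with (INR K); [easy|].
  replace (INR K * (Cmod (a m) * rho ^ m)) with (Cmod (INR K * (a m * rho ^ m))).
  2: { rewrite !Cmod_mult, Cmod_pow, !Cmod_pos_R; lra. }
  rewrite E4; eapply Rle_trans; [apply Cmod_triangle_minus|lra]. }
apply Rnot_lt_le; intros Hlt.
apply is_lim_seq_series, is_lim_seq_spec in HB.
destruct (HB (mkposreal _ (proj1 (Rminus_lt_0 _ _) Hlt))) as [N HN].
specialize (HN (max N m) ltac:(lia)); simpl in HN; apply Rabs_def2 in HN.
pose proof (key (max N m) ltac:(lia)); unfold Bn in *; lra.
Qed.

(** Weierstrass: a series of analytic functions with summable uniform bounds is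
    analytic. By the Cauchy estimates the double series of all monomials is
    dominated by [M j * (2 |h| / r) ^ n]. *)
Lemma AN_series (f : nat -> C -> C) (F : C -> C) (s : C) (r : R) (M : nat -> R) :
  0 < r -> (forall j, AN (f j) s r) ->
  (forall j h, Cmod h < r -> Cmod (f j (s + h)%C) <= M j) -> ex_series M ->
  (forall h, Cmod h < r -> is_series (fun j => f j (s + h)%C) (F (s + h)%C)) ->
  AN F s (r / 2).
Proof.
intros Hr Hf HM HMs HF.
set (a := fun j => proj1_sig (constructive_indefinite_description _ (Hf j))).
assert (Ha : forall j h, Cmod h < r ->
  is_series (fun n => a j n * h ^ n)%C (f j (s + h)%C)).
{ intros j; exact (proj2_sig (constructive_indefinite_description _ (Hf j))). }
clearbody a.
assert (HC : forall j n, Cmod (a j n) * (r / 2) ^ n <= M j).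
{ intros j n; apply (cauchy_estimate (fun h => f j (s + h)%C) (a j) r); [auto|auto|lra]. }
assert (HM0 : forall j, 0 <= M j).
{ intros j; eapply Rle_trans; [apply Cmod_ge_0|apply (HM j 0%C)].
  rewrite Cmod_0; lra. }
assert (Hb : forall n, ex_series (fun j => a j n)).
{ intros n; apply (ex_series_Cmod _ (fun j => M j * / (r / 2) ^ n)).
  - intros j; apply Rmult_le_reg_r with ((r / 2) ^ n); [apply pow_lt; lra|].
    rewrite Rmult_assoc, Rinv_l, Rmult_1_r; [apply HC|].
    apply pow_nonzero; lra.
  - now apply ex_series_scal_r. }
exists (fun n => CSeries (fun j => a j n)); intros h Hh.
set (q := Cmod h / (r / 2)).
assert (Hq : 0 <= q < 1).
{ unfold q; pose proof (Cmod_ge_0 h); split.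
  - apply Rmult_le_pos; [easy|left; apply Rinv_0_lt_compat; lra].
  - apply Rmult_lt_reg_r with (r / 2); [lra|].
    replace (Cmod h / (r / 2) * (r / 2)) with (Cmod h) by (field; lra); lra. }
destruct (series_swap (fun j n => a j n * h ^ n)%C (fun j => f j (s + h)%C) M
  (fun n => q ^ n)) as (c & S & H1 & H2 & H3).
- intros j n; rewrite Cmod_mult, Cmod_pow.
  replace (Cmod h) with (r / 2 * q) by (unfold q; field; lra).
  rewrite Rpow_mult_distr, <- Rmult_assoc.
  apply Rmult_le_compat_r; [apply pow_le; lra|apply HC].
- easy.
- apply ex_series_geom; rewrite Rabs_pos_eq; lra.
- easy.
- intros; apply pow_le; lra.
- intros j; apply Ha; lra.
- eapply is_series_C_ext; [| |exact H3].
  + intros n; apply (is_series_C_unique _ _ _ (H1 n)).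
    rewrite Cmult_comm.
    eapply is_series_C_ext; [|reflexivity|apply is_series_C_scal, CSeries_correct, Hb].
    intros j; cbv beta; ring.
  + apply (is_series_C_unique _ _ _ H2), HF; lra.
Qed.

(** Identity theorem along a segment: let [T] be the supremum of the parameters up to
    which [f] vanishes. By [pser_zero] all coefficients at the point of parameter [T]
    are 0, so [f] still vanishes beyond it, and [T] cannot be less than 1. *)
Lemma identity_segment (f : C -> C) (p u : C) (eps : R) : 0 < eps ->
  (forall t, 0 <= t <= 1 -> exists r, 0 < r /\ AN f (p + t * u)%C r) ->
  (forall t, 0 <= t < eps -> f (p + t * u)%C = RtoC 0) ->
  f (p + u)%C = RtoC 0.
Proof.
intros Heps Han H0.
set (E := fun t => t <= 1 /\ forall t', 0 <= t' <= t -> f (p + t' * u)%C = RtoC 0).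
set (e0 := Rmin 1 (eps / 2)).
assert (He0 : 0 < e0 /\ e0 <= 1 /\ e0 < eps).
{ unfold e0; split; [apply Rmin_glb_lt; lra|split; [apply Rmin_l|]].
  pose proof (Rmin_r 1 (eps / 2)); lra. }
assert (HE0 : E e0) by (split; [easy|]; intros; apply H0; lra).
destruct (completeness E) as [T [HT1 HT2]].
{ exists 1; intros t [Ht _]; easy. }
{ now exists e0. }
assert (HTe : e0 <= T) by now apply HT1.
assert (HT : T <= 1) by (apply HT2; intros t [Ht _]; easy).
assert (Hbelow : forall t, 0 <= t < T -> f (p + t * u)%C = RtoC 0).
{ intros t Ht.
  destruct (classic (exists t1, E t1 /\ t < t1)) as [[t1 [[_ Ht1] Hlt]]|Hn].
  - apply Ht1; lra.
  - exfalso; apply (Rlt_not_le T t); [easy|]; apply HT2; intros t1 Ht1.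
    apply Rnot_lt_le; intros Hlt; apply Hn; now exists t1. }
destruct (Han T ltac:(lra)) as (r & Hr & a & Ha).
set (d := Rmin T (r / (Cmod u + 1))).
pose proof (Cmod_ge_0 u) as Hu.
assert (Hd0 : 0 < r / (Cmod u + 1)) by (apply Rdiv_lt_0_compat; lra).
assert (Hd : 0 < d) by (apply Rmin_glb_lt; lra).
assert (Hdu : forall t, Rabs t < r / (Cmod u + 1) -> Cmod (t * u) < r).
{ intros t Ht; rewrite Cmod_mult, Cmod_R; pose proof (Rabs_pos t).
  apply Rle_lt_trans with (Rabs t * (Cmod u + 1)); [nra|].
  replace r with (r / (Cmod u + 1) * (Cmod u + 1)) by (field; lra).
  apply Rmult_lt_compat_r; lra. }
assert (Hz : forall n, (a n * (- u) ^ n)%C = RtoC 0).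
{ apply (pser_zero _ d Hd); intros t Ht.
  pose proof (Rmin_l T (r / (Cmod u + 1))) as Hl.
  pose proof (Rmin_r T (r / (Cmod u + 1))) as Hr'; fold d in Hl, Hr'.
  eapply is_series_C_ext; [| |apply (Ha ((- t)%R * u)%C)].
  - intros n; cbv beta; rewrite <- Cmult_assoc, <- Cpow_mult_l.
    do 2 f_equal; rewrite RtoC_opp; ring.
  - replace (p + T * u + (- t)%R * u)%C with (p + (T - t)%R * u)%C
      by (rewrite RtoC_minus, RtoC_opp; ring).
    apply Hbelow; lra.
  - apply Hdu; rewrite Rabs_Ropp, Rabs_pos_eq; lra. }
assert (Habove : forall t, Rabs t < r / (Cmod u + 1) -> f (p + (T + t)%R * u)%C = RtoC 0).
{ intros t Ht; pose proof (Ha (t * u)%C (Hdu t Ht)) as H1.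
  replace (p + T * u + t * u)%C with (p + (T + t)%R * u)%C in H1
    by (rewrite RtoC_plus; ring).
  apply (is_series_C_unique _ _ _ H1).
  apply (is_series_C_ext (fun n => (0 * (a n * (t * u) ^ n)))%C _ (0 * f (p + (T + t)%R * u))%C).
  - intros n; replace (a n * (t * u) ^ n)%C with (a n * (- u) ^ n * RtoC (- t) ^ n)%C.
    + rewrite Hz; ring.
    + rewrite <- Cmult_assoc, <- Cpow_mult_l; do 2 f_equal; rewrite RtoC_opp; ring.
  - ring.
  - now apply is_series_C_scal. }
destruct (Rle_lt_or_eq_dec T 1 HT) as [Hlt|Heq].
- exfalso.
  set (t1 := Rmin 1 (T + r / (Cmod u + 1) / 2)).
  assert (Ht1 : T < t1) by (apply Rmin_glb_lt; lra).
  apply (Rlt_not_le t1 T); [easy|]; apply HT1; split; [apply Rmin_l|].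
  intros t Ht; destruct (Rlt_le_dec t T) as [Hl|Hl]; [apply Hbelow; lra|].
  replace t with (T + (t - T)) by ring; apply Habove.
  pose proof (Rmin_r 1 (T + r / (Cmod u + 1) / 2)) as Hm; fold t1 in Hm.
  rewrite Rabs_pos_eq; lra.
- specialize (Habove 0 ltac:(rewrite Rabs_R0; lra)).
  rewrite Rplus_0_r, Heq in Habove.
  now replace (1 * u)%C with u in Habove by ring.
Qed.

(** * Series of real powers *)

Lemma ex_series_pos_bounded (b : nat -> R) (M : R) :
  (forall n, 0 <= b n) -> (forall n, sum_n b n <= M) -> ex_series b.
Proof.
intros Hb HM; destruct (ex_finite_lim_seq_incr (sum_n b) M) as [l Hl].
- intros n; rewrite sum_Sn; specialize (Hb (S n)); unfold plus; simpl; lra.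
- easy.
- now exists l.
Qed.

Lemma exp_le_compat (x y : R) : x <= y -> exp x <= exp y.
Proof. intros [H| ->]; [left; now apply exp_increasing|lra]. Qed.

Lemma Rpower_le_neg (x y a : R) : a <= 0 -> 0 < x <= y -> Rpower y a <= Rpower x a.
Proof.
intros Ha Hxy; unfold Rpower; apply exp_le_compat.
assert (ln x <= ln y) by (apply ln_le; lra); nra.
Qed.

Lemma Rpower_le_exponent (x a b : R) : 1 <= x -> a <= b -> Rpower x a <= Rpower x b.
Proof.
intros Hx Hab; unfold Rpower; apply exp_le_compat, Rmult_le_compat_r; [|easy].
rewrite <- ln_1; apply ln_le; lra.
Qed.

Lemma INR_S_ge_1 (n : nat) : 1 <= INR (S n).
Proof. rewrite S_INR; pose proof (pos_INR n); lra. Qed.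

Lemma is_derive_Rpower (a x : R) : 0 < x ->
  is_derive (fun t => Rpower t a) x (a * Rpower x (a - 1)).
Proof.
intros Hx; unfold Rpower; auto_derive; [easy|].
replace ((a - 1) * ln x) with (a * ln x + - ln x) by ring.
rewrite exp_plus, exp_Ropp, exp_ln by easy; field; lra.
Qed.

Lemma ex_series_Rpower (p : R) : 1 < p -> ex_series (fun n => Rpower (INR (S n)) (- p)).
Proof.
intros Hp; apply (ex_series_pos_bounded _ (1 + 1 / (p - 1))); [intros; left; apply exp_pos|].
set (u := fun n => Rpower (INR (S n)) (1 - p)).
assert (Hstep : forall n, (p - 1) * Rpower (INR (S (S n))) (- p) <= u n - u (S n)).
{ intros n; unfold u; pose proof (INR_S_ge_1 n).
  assert (E : INR (S (S n)) = INR (S n) + 1) by apply S_INR.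
  destruct (MVT_gen (fun t => Rpower t (1 - p)) (INR (S n)) (INR (S (S n)))
    (fun t => (1 - p) * Rpower t (1 - p - 1))) as [c [Hc Ec]];
    rewrite ?Rmin_left, ?Rmax_right in * by lra.
  - intros x Hx; apply is_derive_Rpower; lra.
  - intros x Hx; apply continuity_pt_filterlim, (ex_derive_continuous (fun t => Rpower t (1 - p))).
    eexists; apply is_derive_Rpower; lra.
  - replace (INR (S (S n)) - INR (S n)) with 1 in Ec by lra.
    replace (1 - p - 1) with (- p) in Ec by ring.
    pose proof (Rpower_le_neg c (INR (S (S n))) (- p) ltac:(lra) ltac:(lra)). nra. }
intros n.
assert (H : (p - 1) * sum_n (fun k => Rpower (INR (S k)) (- p)) n <= (p - 1) + 1 - u n).
{ induction n as [|n IH].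
  - rewrite sum_O; unfold u; simpl INR; unfold Rpower; rewrite ln_1, !Rmult_0_r, exp_0; lra.
  - rewrite sum_Sn; unfold plus; simpl AbelianMonoid.plus.
    pose proof (Hstep n); simpl in *; lra. }
assert (0 < u n) by apply exp_pos.
apply Rmult_le_reg_l with (p - 1); [lra|].
replace ((p - 1) * (1 + 1 / (p - 1))) with (p - 1 + 1) by (field; lra); lra.
Qed.

Lemma ln_le_linear (e y : R) : 0 < e -> 0 < y -> ln y <= e * y - ln e.
Proof.
intros He Hy; assert (H : ln (e * y) <= e * y).
{ rewrite <- (ln_exp (e * y)) at 2; apply ln_le; [nra|].
  pose proof (exp_ineq1_le (e * y)); lra. }
rewrite ln_mult in H by easy; lra.
Qed.

Lemma ex_series_Rpower_exp (a x : R) : 0 < x ->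
  ex_series (fun n => Rpower (INR (S n)) a * exp (- x * INR (S n))).
Proof.
intros Hx; pose proof (Rabs_pos a) as Ha0.
set (e := x / (2 * (Rabs a + 1))).
assert (He : 0 < e) by (apply Rdiv_lt_0_compat; lra).
assert (Hae : Rabs a * e <= x / 2).
{ apply Rle_trans with ((Rabs a + 1) * e); [nra|].
  right; unfold e; field; lra. }
apply (ex_series_R_le _ (fun n => exp (- Rabs a * ln e) * exp (- x / 2) ^ n)).
- intros n; pose proof (INR_S_ge_1 n) as Hn; split.
  { apply Rmult_le_pos; left; apply exp_pos. }
  assert (Hexp : exp (- x / 2) ^ n = exp (- x / 2 * INR n)).
  { clear; induction n as [|n IH]; [simpl; rewrite Rmult_0_r, exp_0; easy|].
    rewrite <- tech_pow_Rmult, IH, <- exp_plus, S_INR; f_equal; ring. }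
  rewrite Hexp; unfold Rpower; rewrite <- !exp_plus; apply exp_le_compat.
  pose proof (ln_le_linear e (INR (S n)) He ltac:(lra)) as Hl.
  assert (0 <= ln (INR (S n))) by (rewrite <- ln_1; apply ln_le; lra).
  assert (a * ln (INR (S n)) <= Rabs a * ln (INR (S n))).
  { apply Rmult_le_compat_r; [easy|apply Rle_abs]. }
  assert (Rabs a * ln (INR (S n)) <= Rabs a * (e * INR (S n) - ln e)).
  { now apply Rmult_le_compat_l. }
  rewrite S_INR in *; pose proof (pos_INR n).
  assert (Rabs a * (e * (INR n + 1)) <= x / 2 * (INR n + 1)) by nra. nra.
- apply (ex_series_scal_l (exp (- Rabs a * ln e)) (fun n => exp (- x / 2) ^ n)).
  apply ex_series_geom; rewrite Rabs_pos_eq by (left; apply exp_pos).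
  rewrite <- exp_0; apply exp_increasing; lra.
Qed.

(** * Alternating sums and their Abel limits *)

Fixpoint fdiff (m : nat) (s : C) (x : R) : C :=
  match m with
  | O => Rcpow x (- s)
  | S m => fdiff m s (x + 1) - fdiff m s x
  end%C.

Lemma CD_fdiff (m : nat) (s : C) (x : R) : 0 < x ->
  CD (fdiff m s) x (- s * fdiff m (s + 1) x)%C.
Proof.
revert x; induction m as [|m IH]; intros x Hx.
- eapply CD_eq; [apply CD_Rcpow, Hx|]; simpl; do 2 f_equal; ring.
- assert (H1 : CD (fun t => fdiff m s (t + 1)) x (- s * fdiff m (s + 1) (x + 1))%C).
  { destruct (IH (x + 1) ltac:(lra)) as [H1 H2].
    assert (Hd : is_derive (fun t => t + 1) x 1) by (auto_derive; [easy|ring]).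
    split; eapply is_derive_eq.
    - exact (is_derive_comp (fun t => Re (fdiff m s t)) (fun t => t + 1) x _ _ H1 Hd).
    - apply Rmult_1_l.
    - exact (is_derive_comp (fun t => Im (fdiff m s t)) (fun t => t + 1) x _ _ H2 Hd).
    - apply Rmult_1_l. }
  apply (CD_ext (fun t => fdiff m s (t + 1) + (-1) * fdiff m s t)%C).
  { intros t; simpl; ring. }
  eapply CD_eq; [apply CD_plus; [exact H1|apply CD_scal, IH, Hx]|].
  simpl; ring.
Qed.

Fixpoint fdiff_const (m : nat) (A : R) : R :=
  match m with O => 1 | S m => 2 * A * fdiff_const m (A + 1) end.

Lemma fdiff_const_pos (m : nat) (A : R) : 0 <= A -> 0 <= fdiff_const m A.
Proof.
revert A; induction m as [|m IH]; intros A HA; simpl; [lra|].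
pose proof (IH (A + 1) ltac:(lra)); nra.
Qed.

(** Each difference gains one power of [x]: it is a mean value of the derivative,
    whose [m - 1]-st difference is controlled by induction. *)
Lemma fdiff_bound (m : nat) (s : C) (A x : R) : Cmod s <= A -> 0 < x ->
  0 <= Re s + INR m -> Cmod (fdiff m s x) <= fdiff_const m A * Rpower x (- (Re s + INR m)).
Proof.
revert s A x; induction m as [|m IH]; intros s A x HA Hx Hm.
- simpl; rewrite Cmod_Rcpow, Rmult_1_l, re_opp, Rplus_0_r; lra.
- change (fdiff (S m) s x) with (fdiff m s (x + 1) - fdiff m s x)%C.
  rewrite S_INR in *.
  pose proof (Cmod_ge_0 s) as Hs0.
  assert (Hs1 : Cmod (s + 1) <= A + 1).
  { eapply Rle_trans; [apply Cmod_triangle|]; rewrite Cmod_1; lra. }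
  pose proof (fdiff_const_pos m (A + 1) ltac:(lra)) as Hc.
  eapply Rle_trans; [apply (Cmvt_le (fdiff m s) (fun t => - s * fdiff m (s + 1) t)%C x (x + 1)
    (A * (fdiff_const m (A + 1) * Rpower x (- (Re s + (INR m + 1))))))|].
  + lra.
  + intros t Ht; apply CD_fdiff; lra.
  + intros t Ht; rewrite Cmod_mult, Cmod_opp.
    apply Rmult_le_compat; try apply Cmod_ge_0; [easy|].
    eapply Rle_trans; [apply (IH _ (A + 1)); [easy|lra|]|].
    * rewrite re_plus; simpl; lra.
    * apply Rmult_le_compat_l; [easy|].
      rewrite re_plus; simpl Re.
      replace (Re s + 1 + INR m) with (Re s + (INR m + 1)) by ring.
      apply Rpower_le_neg; lra.
  + simpl; lra.
Qed.

Lemma AN_Rcpow (x c : R) (d s : C) (r : R) : AN (fun z => Rcpow x (d + c * z)) s r.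
Proof.
apply (AN_ext (fun z => Rcpow x d * Cexp (c * ln x * z))%C).
- intros h _; rewrite Rcpow_plus; f_equal; unfold Rcpow; f_equal; ring.
- apply AN_scal, AN_exp.
Qed.

Lemma AN_fdiff (m : nat) (x : R) (s : C) (r : R) : AN (fun z => fdiff m z x) s r.
Proof.
revert x; induction m as [|m IH]; intros x; simpl; [|now apply AN_minus].
apply (AN_ext (fun z => Rcpow x (0 + (-1)%R * z))); [|apply AN_Rcpow].
intros h _; f_equal; ring.
Qed.

Definition alt_term (m : nat) (s : C) (n : nat) : C := ((-1) ^ n * fdiff m s (INR (S n)))%C.

Lemma Cmod_sign (n : nat) : Cmod ((-1) ^ n) = 1.
Proof.
rewrite Cmod_pow, Cmod_R; replace (Rabs (-1)) with 1; [apply pow1|].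
rewrite Rabs_left; lra.
Qed.

(** [eta m k s] is the Abel sum of [alt_term m s], obtained by applying [k] times
    the summation by parts [2 A_m = fdiff m s 1 - A_(m+1)], after which the series
    converges absolutely as soon as [Re s + m + k > 1]. *)
Fixpoint eta (m k : nat) (s : C) : C :=
  match k with
  | O => CSeries (alt_term m s)
  | S k => (fdiff m s 1 - eta (S m) k s) / 2
  end%C.

Lemma alt_term_bound (m : nat) (s : C) (A p : R) (n : nat) : Cmod s <= A ->
  0 <= p <= Re s + INR m ->
  Cmod (alt_term m s n) <= fdiff_const m A * Rpower (INR (S n)) (- p).
Proof.
intros HA Hp; unfold alt_term; rewrite Cmod_mult, Cmod_sign, Rmult_1_l.
pose proof (INR_S_ge_1 n).
eapply Rle_trans; [apply (fdiff_bound m s A); [easy|lra|lra]|].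
apply Rmult_le_compat_l; [apply fdiff_const_pos; pose proof (Cmod_ge_0 s); lra|].
apply Rpower_le_exponent; lra.
Qed.

Lemma alt_series (m : nat) (s : C) : 1 < Re s + INR m ->
  is_series (alt_term m s) (eta m 0 s).
Proof.
intros H; apply CSeries_correct, (ex_series_Cmod _
  (fun n => fdiff_const m (Cmod s) * Rpower (INR (S n)) (- (Re s + INR m)))).
- intros n; apply alt_term_bound; lra.
- now apply (ex_series_scal_l _ (fun n => Rpower (INR (S n)) (- (Re s + INR m)))), ex_series_Rpower.
Qed.

Lemma Re_shift_bound (s h : C) (r : R) : Cmod h < r -> Re s - r < Re (s + h) < Re s + r.
Proof.
intros Hh; rewrite re_plus; pose proof (re_le_Cmod h) as H.
apply Rabs_le_between in H; lra.
Qed.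

Lemma AN_eta (m k : nat) (s : C) : 1 < Re s + INR (m + k) ->
  exists r, 0 < r /\ AN (eta m k) s r.
Proof.
revert m s; induction k as [|k IH]; intros m s H.
- rewrite Nat.add_0_r in H; set (r := (Re s + INR m - 1) / 2).
  assert (Hr : 0 < r) by (unfold r; lra).
  exists (r / 2); split; [lra|].
  apply (AN_series (fun n z => alt_term m z n) _ s r
    (fun n => fdiff_const m (Cmod s + r) * Rpower (INR (S n)) (- (1 + r)))); [easy| | | |].
  + intros n; unfold alt_term; apply AN_scal, AN_fdiff.
  + intros n h Hh; pose proof (Re_shift_bound s h r Hh).
    apply alt_term_bound; [|unfold r in *; lra].
    eapply Rle_trans; [apply Cmod_triangle|lra].
  + apply (ex_series_scal_l _ (fun n => Rpower (INR (S n)) (- (1 + r)))).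
    apply ex_series_Rpower; lra.
  + intros h Hh; apply alt_series; pose proof (Re_shift_bound s h r Hh); unfold r in *; lra.
- replace (m + S k)%nat with (S m + k)%nat in H by lia.
  destruct (IH (S m) s H) as (r & Hr & Hk); exists r; split; [easy|].
  apply (AN_ext (fun z => (/ 2) * (fdiff m z 1 - eta (S m) k z))%C).
  { intros h _; simpl; unfold Cdiv; ring. }
  apply AN_scal, AN_minus; [apply AN_fdiff|easy].
Qed.

Lemma Clim_RtoC (u : nat -> R) (l : R) : is_lim_seq u l -> Clim (fun n => RtoC (u n)) l.
Proof. intros H; apply Clim_Re_Im; split; [easy|apply is_lim_seq_const]. Qed.

Lemma Clim_pow (u : nat -> C) (l : C) (n : nat) :
  Clim u l -> Clim (fun k => u k ^ n)%C (l ^ n)%C.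
Proof.
intros H; induction n as [|n IH]; [exact (Clim_const 1)|].
apply (Clim_ext (fun k => u k * u k ^ n)%C); [reflexivity|].
now apply Clim_mult.
Qed.

(** If [k = 0] the series is dominated at [q = 1]. Otherwise one summation by parts
    expresses the sum in terms of that of the next differences, with coefficients that
    are continuous at [q = 1]. *)
Lemma eta_Abel (k m : nat) (s : C) (q : nat -> R) (A : nat -> C) :
  1 < Re s + INR (m + k) -> (forall N, 0 < q N < 1) -> is_lim_seq q 1 ->
  (forall N, is_series (fun n => alt_term m s n * q N ^ n)%C (A N)) ->
  Clim A (eta m k s).
Proof.
revert m A; induction k as [|k IH]; intros m A H Hq Hq1 HA.
- rewrite Nat.add_0_r in H.
  destruct (tannery (fun N n => alt_term m s n * q N ^ n)%C (alt_term m s) A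
    (fun n => fdiff_const m (Cmod s) * Rpower (INR (S n)) (- (Re s + INR m))))
    as (l & Hl & HlA).
  + intros N n; rewrite Cmod_mult, Cmod_pow, Cmod_pos_R by (specialize (Hq N); lra).
    rewrite <- (Rmult_1_r (fdiff_const _ _ * _)).
    apply Rmult_le_compat; [apply Cmod_ge_0|apply pow_le; specialize (Hq N); lra| |].
    * apply alt_term_bound; lra.
    * rewrite <- (pow1 n); apply pow_incr; specialize (Hq N); lra.
  + now apply (ex_series_scal_l _ (fun n => Rpower (INR (S n)) (- (Re s + INR m)))),
      ex_series_Rpower.
  + intros n; pose proof (Clim_scal (alt_term m s n) _ _
      (Clim_pow _ _ n (Clim_RtoC _ _ Hq1))) as Hc.
    now rewrite Cpow_1_l, Cmult_1_r in Hc.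
  + easy.
  + simpl; now rewrite (is_series_CSeries _ _ Hl).
- replace (m + S k)%nat with (S m + k)%nat in H by lia.
  set (A' := fun N => ((fdiff m s 1 - (1 + q N) * A N) / q N)%C).
  assert (Hnz : forall N, RtoC (q N) <> RtoC 0).
  { intros N; apply RtoC_neq_0; specialize (Hq N); lra. }
  assert (HA' : forall N, is_series (fun n => alt_term (S m) s n * q N ^ n)%C (A' N)).
  { intros N; pose proof (proj1 (is_series_C_shift _ _) (HA N)) as Hs.
    eapply is_series_C_ext; [| |apply (is_series_C_plus _ _ _ _
      (is_series_C_scal (- / q N) _ _ Hs) (is_series_C_scal (-1) _ _ (HA N)))].
    - intros n; cbv beta; unfold alt_term.
      change (fdiff (S m) s (INR (S n))) with (fdiff m s (INR (S n) + 1) - fdiff m s (INR (S n)))%C.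
      rewrite <- S_INR, !Cpow_S; field; apply Hnz.
    - unfold A', alt_term; simpl; field; apply Hnz. }
  pose proof (IH (S m) A' H Hq Hq1 HA') as HL.
  assert (Hq2 : is_lim_seq (fun N => / (1 + q N)) (/ 2)).
  { replace (Finite (/ 2)) with (Rbar_inv (1 + 1)) by (simpl; do 2 f_equal; ring).
    apply is_lim_seq_inv; [|simpl; intros E; injection E; lra].
    apply is_lim_seq_plus'; [apply is_lim_seq_const|easy]. }
  apply (Clim_ext (fun N => (fdiff m s 1 - q N * A' N) * RtoC (/ (1 + q N)))%C).
  { intros N; unfold A'; specialize (Hq N); rewrite RtoC_inv, RtoC_plus by lra.
    field; split; first [apply Hnz|rewrite <- RtoC_plus; apply RtoC_neq_0; lra]. }
  replace (eta m (S k) s) with ((fdiff m s 1 - 1 * eta (S m) k s) * RtoC (/ 2))%C.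
  + apply Clim_mult; [|now apply Clim_RtoC].
    apply Clim_minus; [apply Clim_const|].
    apply Clim_mult; [now apply Clim_RtoC|easy].
  + rewrite RtoC_inv by lra; simpl; unfold Cdiv; ring.
Qed.

(** * The Riemann zeta function *)

Lemma is_series_Dirichlet (s : C) : 1 < Re s ->
  ex_series (fun n => Rcpow (INR (S n)) (- s)).
Proof.
intros Hs; apply (ex_series_Cmod _ (fun n => Rpower (INR (S n)) (- Re s))).
- intros n; rewrite Cmod_Rcpow, re_opp; lra.
- now apply ex_series_Rpower.
Qed.

Definition dirichlet_zeta (s : C) : C := CSeries (fun n => Rcpow (INR (S n)) (- s)).

(** [s - 1] times the error made in replacing [n ^ (- s)] by its integral over
    [[n, n + 1]]; it is of order [n ^ (- s - 1)]. *)
Definition zeta_corr (n : nat) (s : C) : C :=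
  ((s - 1) * Rcpow (INR (S n)) (- s)
   + (Rcpow (INR (S (S n))) (1 - s) - Rcpow (INR (S n)) (1 - s)))%C.

Lemma zeta_corr_bound (n : nat) (s : C) (A p : R) : Cmod s <= A ->
  0 <= p <= Re s + 1 ->
  Cmod (zeta_corr n s) <= 4 * (A + 1) * A * Rpower (INR (S n)) (- p).
Proof.
intros HA Hp; pose proof (INR_S_ge_1 n) as Hn.
set (x0 := INR (S n)) in *.
assert (E0 : INR (S (S n)) = x0 + 1) by (unfold x0; now rewrite (S_INR (S n))).
pose proof (Cmod_ge_0 s) as Hs0.
set (P := Rpower x0 (- p)).
assert (HP : 0 < P) by apply exp_pos.
assert (H1 : forall x, x0 <= x <= x0 + 1 ->
  Cmod (Rcpow x (- s) - Rcpow x0 (- s)) <= 2 * (A * P)).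
{ intros x Hx.
  eapply Rle_trans; [apply (Cmvt_le (fun t => Rcpow t (- s))
    (fun t => - s * Rcpow t (- s - 1))%C x0 x (A * P)); [lra| |]|].
  - intros t Ht; apply CD_Rcpow; lra.
  - intros t Ht; rewrite Cmod_mult, Cmod_opp, Cmod_Rcpow.
    apply Rmult_le_compat; [easy|left; apply exp_pos|easy|].
    rewrite Re_minus, re_opp; simpl Re.
    apply Rle_trans with (Rpower x0 (- Re s - 1)); [apply Rpower_le_neg; lra|].
    apply Rpower_le_exponent; lra.
  - assert (0 <= A * P) by (apply Rmult_le_pos; lra); nra. }
set (g := fun t => (Rcpow t (1 - s) + t * ((s - 1) * Rcpow x0 (- s)))%C).
assert (H2 : Cmod (g (x0 + 1)%R - g x0) <= 2 * ((A + 1) * (2 * (A * P))) * (x0 + 1 - x0)).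
{ apply (Cmvt_le g (fun t => (1 - s) * (Rcpow t (- s) - Rcpow x0 (- s)))%C); [lra| |].
  - intros t Ht; unfold g; eapply CD_eq.
    + apply CD_plus; [apply CD_Rcpow; lra|].
      apply CD_mult; [apply CD_id|apply CD_const].
    + replace (1 - s - 1)%C with (- s)%C by ring; ring.
  - intros t Ht; rewrite Cmod_mult; apply Rmult_le_compat; try apply Cmod_ge_0.
    + eapply Rle_trans; [apply Cmod_triangle_minus|]; rewrite Cmod_1; lra.
    + now apply H1. }
replace (zeta_corr n s) with (g (x0 + 1)%R - g x0)%C.
2: { unfold zeta_corr, g; rewrite E0; fold x0; rewrite RtoC_plus; ring. }
eapply Rle_trans; [exact H2|right; unfold P; ring].
Qed.

(** The function [(s - 1) zeta s], continued to [Re s > 0]. *)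
Definition xi (s : C) : C := (1 + CSeries (fun n => zeta_corr n s))%C.

Lemma zeta_corr_series (s : C) : 0 < Re s ->
  is_series (fun n => zeta_corr n s) (CSeries (fun n => zeta_corr n s)).
Proof.
intros H; apply CSeries_correct, (ex_series_Cmod _
  (fun n => 4 * (Cmod s + 1) * Cmod s * Rpower (INR (S n)) (- (Re s + 1)))).
- intros n; apply zeta_corr_bound; lra.
- apply (ex_series_scal_l _ (fun n => Rpower (INR (S n)) (- (Re s + 1)))).
  apply ex_series_Rpower; lra.
Qed.

Lemma AN_xi (s : C) : 0 < Re s -> exists r, 0 < r /\ AN xi s r.
Proof.
intros H; set (r := Re s / 2).
assert (Hr : 0 < r) by (unfold r; lra).
exists (r / 2); split; [lra|].
apply AN_plus; [apply AN_const|].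
apply (AN_series (fun n z => zeta_corr n z) _ s r (fun n => 4 * (Cmod s + r + 1)
  * (Cmod s + r) * Rpower (INR (S n)) (- (1 + r)))); [easy| | | |].
- intros n; unfold zeta_corr; apply AN_plus; [apply AN_mult|apply AN_minus].
  + apply AN_minus; [apply AN_id|apply AN_const].
  + exact (AN_fdiff 0 (INR (S n)) s r).
  + apply (AN_ext (fun z => Rcpow (INR (S (S n))) (1 + (-1)%R * z))); [|apply AN_Rcpow].
    intros h _; f_equal; ring.
  + apply (AN_ext (fun z => Rcpow (INR (S n)) (1 + (-1)%R * z))); [|apply AN_Rcpow].
    intros h _; f_equal; ring.
- intros n h Hh; pose proof (Re_shift_bound s h r Hh).
  apply zeta_corr_bound; [|unfold r in *; lra].
  eapply Rle_trans; [apply Cmod_triangle|lra].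
- apply (ex_series_scal_l _ (fun n => Rpower (INR (S n)) (- (1 + r)))).
  apply ex_series_Rpower; lra.
- intros h Hh; apply zeta_corr_series; pose proof (Re_shift_bound s h r Hh); unfold r in *; lra.
Qed.

Lemma Rcpow_INR_lim_0 (a : C) : Re a < 0 -> Clim (fun n => Rcpow (INR (S n)) a) 0.
Proof.
intros Ha; apply (Clim_le _ _ (fun n => Rpower (INR (S n)) (Re a))).
- intros n; replace (Rcpow (INR (S n)) a - 0)%C with (Rcpow (INR (S n)) a) by ring.
  rewrite Cmod_Rcpow; lra.
- apply (is_lim_seq_incr_1 (fun n => Rpower (INR n) (Re a))).
  unfold Rpower.
  apply (filterlim_comp _ _ _ (fun n => Re a * ln (INR n)) exp _ (Rbar_locally m_infty));
    [|apply is_lim_exp_m].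
  assert (H : is_lim_seq (fun n => ln (INR n)) p_infty).
  { apply (filterlim_comp _ _ _ INR ln _ (Rbar_locally p_infty));
      [apply is_lim_seq_INR|apply is_lim_ln_p]. }
  apply (is_lim_seq_scal_l _ (Re a)) in H.
  replace (Rbar_mult (Re a) p_infty) with m_infty in H; [exact H|].
  simpl; unfold Rbar_mult; simpl; destruct (Rle_dec 0 (Re a)); [exfalso; lra|easy].
Qed.

Lemma xi_dirichlet (s : C) : 1 < Re s -> xi s = ((s - 1) * dirichlet_zeta s)%C.
Proof.
intros Hs.
pose proof (CSeries_correct _ (is_series_Dirichlet s Hs)) as HD.
assert (HT : is_series (fun n => Rcpow (INR (S (S n))) (1 - s) - Rcpow (INR (S n)) (1 - s))%C
  (- (1))%C).
{ apply is_series_Clim.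
  apply (Clim_ext (fun n => Rcpow (INR (S (S n))) (1 - s) - 1)%C).
  - induction n as [|n IH].
    + rewrite sum_O; change (INR 1) with 1; now rewrite (Rcpow_base_1 (1 - s)).
    + rewrite sum_n_C_S, <- IH; Cring.
  - replace (- (1))%C with (0 - 1)%C by ring.
    apply Clim_minus; [|apply Clim_const].
    apply (Clim_incr (fun n => Rcpow (INR (S n)) (1 - s))), Rcpow_INR_lim_0.
    rewrite Re_minus; simpl; lra. }
unfold xi; rewrite (is_series_CSeries (fun n => zeta_corr n s) _
  (is_series_C_plus _ _ _ _ (is_series_C_scal (s - 1) _ _ HD) HT)).
unfold dirichlet_zeta; ring.
Qed.

Lemma eta_dirichlet (s : C) : 1 < Re s ->
  eta 0 0 s = ((1 - Rcpow 2 (1 - s)) * dirichlet_zeta s)%C.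
Proof.
intros Hs.
pose proof (CSeries_correct _ (is_series_Dirichlet s Hs)) as HD.
fold (dirichlet_zeta s) in HD.
rewrite (alternating_split _ _ (Rcpow 2 (- s) * dirichlet_zeta s) _ HD
  (alt_series 0 s ltac:(simpl; lra))).
- unfold Cminus at 3; rewrite Rcpow_plus, Rcpow_1 by lra; ring.
- eapply is_series_C_ext; [|reflexivity|apply (is_series_C_scal (Rcpow 2 (- s)) _ _ HD)].
  intros k; cbv beta; rewrite <- Rcpow_mult by (try apply lt_0_INR; lia || lra).
  f_equal; rewrite !S_INR, plus_INR, mult_INR; simpl; ring.
Qed.

(** An arbitrary sequence of parameters tending to 1, along which Abel limits are
    taken. *)
Definition qseq (N : nat) : R := exp (- / INR (S N)).

Lemma is_lim_seq_inv_S : is_lim_seq (fun N => / INR (S N)) 0.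
Proof.
apply (is_lim_seq_incr_1 (fun N => / INR N)).
replace (Finite 0) with (Rbar_inv p_infty) by easy.
apply is_lim_seq_inv; [apply is_lim_seq_INR|easy].
Qed.

Lemma inv_INR_S_bound (N : nat) : 0 < / INR (S N) <= 1.
Proof.
pose proof (INR_S_ge_1 N); split; [apply Rinv_0_lt_compat; lra|].
rewrite <- Rinv_1; apply Rinv_le_contravar; lra.
Qed.

Lemma qseq_bound (N : nat) : 0 < qseq N < 1.
Proof.
unfold qseq; split; [apply exp_pos|].
rewrite <- exp_0; apply exp_increasing.
pose proof (INR_S_ge_1 N); assert (0 < / INR (S N)) by (apply Rinv_0_lt_compat; lra); lra.
Qed.

Lemma qseq_lim : is_lim_seq qseq 1.
Proof.
unfold qseq; rewrite <- exp_0.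
apply (is_lim_seq_continuous exp (fun N => - / INR (S N)) 0).
- apply derivable_continuous_pt, derivable_pt_exp.
- replace (Finite 0) with (Rbar_opp 0) by (simpl; f_equal; ring).
  apply (is_lim_seq_opp (fun N => / INR (S N)) 0), is_lim_seq_inv_S.
Qed.

Lemma qseq_pow (N n : nat) : qseq N ^ n = exp (- / INR (S N) * INR n).
Proof.
induction n as [|n IH]; [simpl; now rewrite Rmult_0_r, exp_0|].
rewrite <- tech_pow_Rmult, IH; unfold qseq; rewrite <- exp_plus, (S_INR n); f_equal; ring.
Qed.

Lemma ex_series_alt_qseq (m : nat) (s : C) (N : nat) :
  ex_series (fun n => alt_term m s n * qseq N ^ n)%C.
Proof.
pose proof (qseq_bound N) as Hq.
assert (Hnz : RtoC (qseq N) <> RtoC 0) by (apply RtoC_neq_0; lra).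
induction m as [|m [l IH]].
- apply (ex_series_Cmod _ (fun n => / qseq N *
    (Rpower (INR (S n)) (- Re s) * exp (- / INR (S N) * INR (S n))))).
  + intros n; unfold alt_term; unfold fdiff.
    rewrite !Cmod_mult, Cmod_sign, Cmod_pow, Cmod_Rcpow, Cmod_pos_R, re_opp, <- qseq_pow by lra.
    right; rewrite <- tech_pow_Rmult; field; lra.
  + apply (ex_series_scal_l _ (fun n => Rpower (INR (S n)) (- Re s) *
      exp (- / INR (S N) * INR (S n)))), ex_series_Rpower_exp.
    apply Rinv_0_lt_compat; pose proof (INR_S_ge_1 N); lra.
- eexists; eapply is_series_C_ext; [|reflexivity|apply (is_series_C_plus _ _ _ _
    (is_series_C_scal (- / qseq N) _ _ (proj1 (is_series_C_shift _ _) IH))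
    (is_series_C_scal (-1) _ _ IH))].
  intros n; cbv beta; unfold alt_term.
  change (fdiff (S m) s (INR (S n))) with (fdiff m s (INR (S n) + 1) - fdiff m s (INR (S n)))%C.
  rewrite <- S_INR, !Cpow_S; field; easy.
Qed.

Lemma eta_level (k k' m : nat) (s : C) :
  1 < Re s + INR (m + k) -> 1 < Re s + INR (m + k') -> eta m k s = eta m k' s.
Proof.
intros H H'.
set (A := fun N => CSeries (fun n => alt_term m s n * qseq N ^ n)%C).
assert (HA : forall N, is_series (fun n => alt_term m s n * qseq N ^ n)%C (A N)).
{ intros N; apply CSeries_correct, ex_series_alt_qseq. }
apply (Clim_unique A).
- exact (eta_Abel k m s qseq A H qseq_bound qseq_lim HA).
- exact (eta_Abel k' m s qseq A H' qseq_bound qseq_lim HA).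
Qed.

(** Both sides are analytic on the half-plane [Re s > 0] and agree for [Re s > 1]. *)
Lemma xi_eta (s : C) : 0 < Re s ->
  ((1 - Rcpow 2 (1 - s)) * xi s)%C = ((s - 1) * eta 0 1 s)%C.
Proof.
intros Hs.
set (f := fun z => ((1 - Rcpow 2 (1 - z)) * xi z - (z - 1) * eta 0 1 z)%C).
enough (H : f s = RtoC 0).
{ unfold f in H; apply Ceq_minus; exact H. }
replace s with ((s + 2) + (- (2)))%C by ring.
assert (Hre : forall t, 0 <= t <= 1 -> Re s <= Re (s + 2 + t * (- (2)))).
{ intros t Ht; rewrite !re_plus, re_scal_l, re_opp; simpl; nra. }
apply (identity_segment f (s + 2)%C (- (2))%C (1 / 2)); [lra| |].
- intros t Ht; specialize (Hre t Ht); set (z := (s + 2 + t * (- (2)))%C) in *.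
  destruct (AN_xi z ltac:(lra)) as (r1 & Hr1 & H1).
  destruct (AN_eta 0 1 z ltac:(change (INR (0 + 1)) with 1; lra)) as (r2 & Hr2 & H2).
  exists (Rmin r1 r2); split; [now apply Rmin_glb_lt|].
  apply (AN_shrink _ _ _ _ (Rmin_l r1 r2)) in H1.
  apply (AN_shrink _ _ _ _ (Rmin_r r1 r2)) in H2.
  unfold f; apply AN_minus; apply AN_mult; [|easy| |easy].
  + apply AN_minus; [apply AN_const|].
    apply (AN_ext (fun z => Rcpow 2 (1 + (-1)%R * z))); [|apply AN_Rcpow].
    intros h _; f_equal; ring.
  + apply AN_minus; [apply AN_id|apply AN_const].
- intros t Ht.
  assert (Hz : 1 < Re (s + 2 + t * (- (2)))).
  { rewrite !re_plus, re_scal_l, re_opp; simpl; nra. }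
  set (z := (s + 2 + t * (- (2)))%C) in *.
  unfold f; rewrite (eta_level 1 0 0 z), eta_dirichlet, xi_dirichlet by (try change (INR (0 + 1)) with 1; try change (INR (0 + 0)) with 0; lra).
  ring.
Qed.

Lemma Cmod_Rcpow_2 (s : C) : Cmod (Rcpow 2 (1 - s)) = exp ((1 - Re s) * ln 2).
Proof. rewrite Cmod_Rcpow; unfold Rpower; rewrite Re_minus; easy. Qed.

Lemma ln_2_pos : 0 < ln 2.
Proof. rewrite <- ln_1; apply ln_increasing; lra. Qed.

Lemma one_minus_2pow_neq_0 (s : C) : Re s < 1 -> (1 - Rcpow 2 (1 - s))%C <> RtoC 0.
Proof.
intros Hs E; pose proof (Cmod_Rcpow_2 s) as H.
replace (Rcpow 2 (1 - s)) with (1 - (1 - Rcpow 2 (1 - s)))%C in H by ring.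
rewrite E in H; replace (1 - 0)%C with (RtoC 1) in H by ring; rewrite Cmod_1 in H.
assert (0 < (1 - Re s) * ln 2) by (apply Rmult_lt_0_compat; [lra|apply ln_2_pos]).
pose proof (exp_increasing _ _ H0) as H1; rewrite exp_0 in H1; lra.
Qed.

(** For [Re s < 1] the factor is minus the geometric series of ratio [2 ^ (s - 1)]. *)
Lemma AN_inv_2pow (s : C) : Re s < 1 ->
  exists r, 0 < r /\ AN (fun z => / (1 - Rcpow 2 (1 - z)))%C s r.
Proof.
intros Hs; set (r := (1 - Re s) / 2).
assert (Hr : 0 < r) by (unfold r; lra).
pose proof ln_2_pos as Hl.
assert (Hq : forall z h, z = (s + h)%C -> Cmod h < r ->
  Cmod (Rcpow 2 (z - 1)) <= exp (- r * ln 2)).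
{ intros z h -> Hh; pose proof (Re_shift_bound s h r Hh).
  rewrite Cmod_Rcpow, Re_minus, re_RtoC; unfold Rpower; apply exp_le_compat.
  apply Rmult_le_compat_r; unfold r in *; lra. }
assert (Hr1 : 0 < exp (- r * ln 2) < 1).
{ split; [apply exp_pos|]; rewrite <- exp_0; apply exp_increasing; nra. }
assert (Hser : forall h, Cmod h < r -> is_series (fun n => Rcpow 2 (s + h - 1) ^ n)%C
  (/ (1 - Rcpow 2 (s + h - 1)))%C).
{ intros h Hh; apply is_series_Cgeom.
  apply Rle_lt_trans with (2 := proj2 Hr1); now apply (Hq _ h). }
exists (r / 2); split; [lra|].
apply (AN_ext (fun z => (- (1)) * (Rcpow 2 (z - 1) * / (1 - Rcpow 2 (z - 1))))%C).
{ intros h Hh; pose proof (Re_shift_bound s h (r / 2) Hh).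
  assert (H1 := one_minus_2pow_neq_0 (s + h)%C ltac:(unfold r in *; lra)).
  replace (s + h - 1)%C with (- (1 - (s + h)))%C by ring.
  rewrite Rcpow_opp; set (q := Rcpow 2 (1 - (s + h))) in *.
  assert (Hq0 : q <> RtoC 0) by apply Rcpow_neq_0.
  assert (Hq1 : (q - 1)%C <> RtoC 0).
  { intros E; apply H1; replace (1 - q)%C with (- (q - 1))%C by ring; rewrite E; ring. }
  field; repeat split; easy. }
assert (Hexp : forall R, AN (fun z => Rcpow 2 (z - 1)) s R).
{ intros R; apply (AN_ext (fun z => Rcpow 2 (- (1) + 1%R * z))); [|apply AN_Rcpow].
  intros h _; f_equal; ring. }
apply AN_scal, AN_mult; [apply Hexp|].
apply (AN_series (fun n z => Rcpow 2 (z - 1) ^ n)%C _ s r (fun n => exp (- r * ln 2) ^ n));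
  [easy| | | |exact Hser].
- induction j as [|j IH]; [exact (AN_const 1 s r)|].
  apply (AN_ext (fun z => Rcpow 2 (z - 1) * Rcpow 2 (z - 1) ^ j)%C); [reflexivity|].
  apply AN_mult; [apply Hexp|easy].
- intros j h Hh; rewrite Cmod_pow; apply pow_incr; split; [apply Cmod_ge_0|].
  now apply (Hq _ h).
- apply ex_series_geom; rewrite Rabs_pos_eq; lra.
Qed.

(** Enough summations by parts for absolute convergence at [s]. *)
Definition level (s : C) : nat := Z.to_nat (up (1 - Re s)).

Lemma level_spec (s : C) : 1 < Re s + INR (0 + level s).
Proof.
simpl; unfold level; pose proof (proj1 (archimed (1 - Re s))) as H.
destruct (Z_le_dec 0 (up (1 - Re s))) as [Hz|Hz].
- rewrite INR_IZR_INZ, Z2Nat.id by easy; lra.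
- assert (IZR (up (1 - Re s)) <= IZR 0) by (apply IZR_le; lia).
  pose proof (pos_INR (Z.to_nat (up (1 - Re s)))); lra.
Qed.

(** Both formulas are valid in the strip [0 < Re s < 1], where they agree by [xi_eta];
    hence the function is analytic across the line [Re s = 1 / 2]. *)
Definition zeta_cont (s : C) : C :=
  if Rlt_dec (1 / 2) (Re s) then (xi s * / (s - 1))%C
  else (eta 0 (level s) s * / (1 - Rcpow 2 (1 - s)))%C.

Lemma zeta_cont_eta (s : C) (k : nat) : Re s < 1 -> 1 < Re s + INR k ->
  zeta_cont s = (eta 0 k s * / (1 - Rcpow 2 (1 - s)))%C.
Proof.
intros Hs Hk; pose proof (one_minus_2pow_neq_0 s Hs) as Hnz.
unfold zeta_cont; destruct (Rlt_dec (1 / 2) (Re s)) as [H|H].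
- rewrite (eta_level k 1 0 s) by (simpl; lra).
  assert (Hs1 : (s - 1)%C <> RtoC 0).
  { intros E; apply (f_equal Re) in E; rewrite Re_minus in E; simpl in E; lra. }
  replace (xi s) with ((1 - Rcpow 2 (1 - s)) * xi s * / (1 - Rcpow 2 (1 - s)))%C
    by (field; easy).
  rewrite xi_eta by lra; field; easy.
- rewrite (eta_level (level s) k 0 s); [easy|apply level_spec|simpl; lra].
Qed.

Lemma zeta_cont_xi (s : C) : 0 < Re s -> s <> RtoC 1 ->
  zeta_cont s = (xi s * / (s - 1))%C.
Proof.
intros Hs Hs1; destruct (Rlt_dec (1 / 2) (Re s)) as [H|H].
- unfold zeta_cont; destruct (Rlt_dec (1 / 2) (Re s)); [easy|lra].
- rewrite (zeta_cont_eta s 1) by (simpl; lra).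
  pose proof (one_minus_2pow_neq_0 s ltac:(lra)) as Hnz.
  assert ((s - 1)%C <> RtoC 0) by now apply Cminus_eq_contra.
  replace (eta 0 1 s) with ((s - 1) * eta 0 1 s * / (s - 1))%C by (field; easy).
  rewrite <- xi_eta by easy; field; easy.
Qed.

Lemma is_zeta_zeta_cont : is_zeta zeta_cont.
Proof.
split.
- intros s Hs.
  assert (Hs1 : s <> RtoC 1) by (intros ->; simpl in Hs; lra).
  assert ((s - 1)%C <> RtoC 0) by now apply Cminus_eq_contra.
  rewrite zeta_cont_xi, xi_dirichlet by (easy || lra).
  eapply is_series_C_ext; [| |apply (CSeries_correct _ (is_series_Dirichlet s Hs))].
  + intros n; apply Rcpow_opp.
  + unfold dirichlet_zeta; field; easy.
- intros s Hs1; apply analytic_at_AN.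
  destruct (Rlt_dec 0 (Re s)) as [Hs|Hs].
  + destruct (AN_xi s Hs) as (r & Hr & H).
    assert (Hd : 0 < Cmod (s - 1)) by now apply Cmod_gt_0, Cminus_eq_contra.
    set (r' := Rmin r (Rmin (Re s) (Cmod (s - 1)))).
    assert (Hr' : 0 < r' /\ r' <= r /\ r' <= Re s /\ r' <= Cmod (s - 1)).
    { unfold r'; repeat split.
      - repeat apply Rmin_glb_lt; easy.
      - apply Rmin_l.
      - eapply Rle_trans; [apply Rmin_r|apply Rmin_l].
      - eapply Rle_trans; [apply Rmin_r|apply Rmin_r]. }
    exists r'; split; [easy|].
    apply (AN_ext (fun z => xi z * / (z - 1))%C).
    * intros h Hh; symmetry; apply zeta_cont_xi.
      -- pose proof (Re_shift_bound s h r' Hh); lra.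
      -- intros E; replace (s - 1)%C with (- h)%C in Hr' by (rewrite <- E; ring).
         rewrite Cmod_opp in Hr'; lra.
    * apply AN_mult; [apply (AN_shrink _ _ r); easy|].
      apply (AN_shrink _ _ (Cmod (s - 1))); [easy|now apply AN_inv].
  + pose proof (level_spec s) as Hk.
    destruct (AN_eta 0 (S (level s)) s) as (r1 & Hr1 & H1).
    { simpl Nat.add in *; rewrite S_INR; lra. }
    destruct (AN_inv_2pow s ltac:(lra)) as (r2 & Hr2 & H2).
    set (r' := Rmin 1 (Rmin r1 r2)).
    assert (Hr' : 0 < r' /\ r' <= 1 /\ r' <= r1 /\ r' <= r2).
    { unfold r'; repeat split.
      - repeat apply Rmin_glb_lt; lra.
      - apply Rmin_l.
      - eapply Rle_trans; [apply Rmin_r|apply Rmin_l].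
      - eapply Rle_trans; [apply Rmin_r|apply Rmin_r]. }
    exists r'; split; [easy|].
    apply (AN_ext (fun z => eta 0 (S (level s)) z * / (1 - Rcpow 2 (1 - z)))%C).
    * intros h Hh; pose proof (Re_shift_bound s h r' Hh).
      symmetry; apply zeta_cont_eta; [lra|].
      simpl Nat.add in *; rewrite S_INR; lra.
    * apply AN_mult; [apply (AN_shrink _ _ r1)|apply (AN_shrink _ _ r2)]; easy.
Qed.

(** Every point [s] other than 1 is joined to the half-plane [Re > 1] by a segment
    that avoids 1, starting off the real axis on the side of [s]. *)
Lemma is_zeta_unique (f g : C -> C) (s : C) : is_zeta f -> is_zeta g -> s <> RtoC 1 -> f s = g s.
Proof.
intros [Hf1 Hf2] [Hg1 Hg2] Hs.
set (b := if Rle_dec 0 (Im s) then Im s + 1 else Im s - 1).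
set (p := (2, b) : C).
apply Ceq_minus.
replace s with (p + (s - p))%C by ring.
change (((fun z => f z - g z)%C) (p + (s - p))%C = RtoC 0).
assert (Hre : forall t : R, Re (p + t * (s - p)) = 2 + t * (Re s - 2)).
{ intros t; rewrite re_plus, re_scal_l, Re_minus; easy. }
assert (Him : forall t : R, Im (p + t * (s - p)) = b + t * (Im s - b)).
{ intros t; rewrite im_plus, im_scal_l, Im_minus; easy. }
set (e := 1 / (Rabs (Re s - 2) + 1)).
pose proof (Rabs_pos (Re s - 2)) as Ha.
apply (identity_segment _ p (s - p)%C e).
- apply Rdiv_lt_0_compat; lra.
- intros t Ht; set (z := (p + t * (s - p))%C) in *.
  assert (Hz : z <> RtoC 1).
  { intros Ez; destruct (Rlt_le_dec t 1) as [Hlt|Hge].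
    - assert (Hi : Im (p + t * (s - p)) = 0) by (fold z; rewrite Ez; easy).
      rewrite Him in Hi; unfold b in Hi; destruct (Rle_dec 0 (Im s)); nra.
    - assert (Et : t = 1) by lra; apply Hs; rewrite <- Ez; unfold z; rewrite Et; ring. }
  destruct (proj1 (analytic_at_AN f z) (Hf2 z Hz)) as (r1 & Hr1 & H1).
  destruct (proj1 (analytic_at_AN g z) (Hg2 z Hz)) as (r2 & Hr2 & H2).
  exists (Rmin r1 r2); split; [now apply Rmin_glb_lt|].
  apply AN_minus; [apply (AN_shrink _ _ r1); [apply Rmin_l|easy]|
    apply (AN_shrink _ _ r2); [apply Rmin_r|easy]].
- intros t Ht; cbv beta.
  assert (Hz : 1 < Re (p + t * (s - p))).
  { rewrite Hre; pose proof (Rle_abs (- (Re s - 2))) as H; rewrite Rabs_Ropp in H.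
    assert (t * (Rabs (Re s - 2) + 1) < 1).
    { replace 1 with (e * (Rabs (Re s - 2) + 1)) at 2 by (unfold e; field; lra).
      apply Rmult_lt_compat_r; lra. }
    nra. }
  rewrite (is_series_C_unique _ _ _ (Hf1 _ Hz) (Hg1 _ Hz)); ring.
Qed.

Lemma is_zeta_riemann_zeta : is_zeta riemann_zeta.
Proof.
unfold riemann_zeta; apply epsilon_spec; exists zeta_cont; apply is_zeta_zeta_cont.
Qed.

(** The zeta function to the left of 0 as an Abel limit of its alternating series;
    this is the only property of the continuation used below. *)
Lemma riemann_zeta_Abel (s : C) (A : nat -> C) : Re s < 0 ->
  (forall N, is_series (fun n => (-1) ^ n * Rcpow (INR (S n)) (- s) * qseq N ^ n)%C (A N)) ->
  Clim A ((1 - Rcpow 2 (1 - s)) * riemann_zeta s)%C.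
Proof.
intros Hs HA; pose proof (one_minus_2pow_neq_0 s ltac:(lra)) as Hnz.
rewrite (is_zeta_unique _ _ s is_zeta_riemann_zeta is_zeta_zeta_cont).
2: { intros ->; simpl in Hs; lra. }
rewrite (zeta_cont_eta s (level s) ltac:(lra) (level_spec s)).
replace ((1 - Rcpow 2 (1 - s)) * (eta 0 (level s) s * / (1 - Rcpow 2 (1 - s))))%C
  with (eta 0 (level s) s) by (field; easy).
exact (eta_Abel (level s) 0 s qseq A (level_spec s) qseq_bound qseq_lim HA).
Qed.

(** * Integrals of complex functions and the Laplace transform of a power *)

Definition CInt (f : R -> C) (a b : R) : C :=
  (RInt (fun t => Re (f t)) a b, RInt (fun t => Im (f t)) a b).

Lemma CD_continuous (f : R -> C) (t : R) (d : C) : CD f t d ->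
  continuous (fun t => Re (f t)) t /\ continuous (fun t => Im (f t)) t.
Proof.
intros [H1 H2]; split.
- apply (ex_derive_continuous (fun t => Re (f t))); eexists; exact H1.
- apply (ex_derive_continuous (fun t => Im (f t))); eexists; exact H2.
Qed.

(** Differentiability is the form of continuity available for all integrands below. *)
Definition Cdiff_on (f : R -> C) (a b : R) : Prop :=
  forall t, a <= t <= b -> exists d, CD f t d.

Lemma Cdiff_on_ex_RInt (f : R -> C) (a b p q : R) : Cdiff_on f a b ->
  a <= p <= b -> a <= q <= b ->
  ex_RInt (fun t => Re (f t)) p q /\ ex_RInt (fun t => Im (f t)) p q.
Proof.
intros H Hp Hq.
assert (Hin : forall t, Rmin p q <= t <= Rmax p q -> a <= t <= b).
{ intros t [H1 H2]; split.
  - eapply Rle_trans; [|exact H1]; now apply Rmin_glb.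
  - eapply Rle_trans; [exact H2|]; now apply Rmax_lub. }
split; apply (@ex_RInt_continuous R_CompleteNormedModule); intros t Ht;
  destruct (H t (Hin t Ht)) as [d Hd]; apply (CD_continuous f t d Hd).
Qed.

Lemma CInt_derive (F f : R -> C) (a b : R) : a <= b ->
  (forall t, a <= t <= b -> CD F t (f t)) -> Cdiff_on f a b ->
  CInt f a b = (F b - F a)%C.
Proof.
intros Hab HF Hf; unfold CInt.
assert (Hc : forall t, a <= t <= b ->
  continuous (fun t => Re (f t)) t /\ continuous (fun t => Im (f t)) t).
{ intros t Ht; destruct (Hf t Ht) as [d Hd]; apply (CD_continuous f t d Hd). }
apply C_eq; simpl; apply is_RInt_unique; rewrite <- ?Rmin_left, <- ?Rmax_right by easy.
- apply (is_RInt_derive (fun t => Re (F t)) (fun t => Re (f t)));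
    rewrite Rmin_left, Rmax_right by easy; intros t Ht; [apply (HF t Ht)|apply (Hc t Ht)].
- apply (is_RInt_derive (fun t => Im (F t)) (fun t => Im (f t)));
    rewrite Rmin_left, Rmax_right by easy; intros t Ht; [apply (HF t Ht)|apply (Hc t Ht)].
Qed.

Lemma CInt_bound (f : R -> C) (g : R -> R) (a b I : R) : a <= b -> Cdiff_on f a b ->
  (forall t, a <= t <= b -> Cmod (f t) <= g t) -> is_RInt g a b I ->
  Cmod (CInt f a b) <= 2 * I.
Proof.
intros Hab Hf Hg HI.
destruct (Cdiff_on_ex_RInt f a b a b Hf) as [H1 H2]; try lra.
eapply Rle_trans; [apply Cmod_le_Re_Im|]; simpl.
assert (B1 : Rabs (RInt (fun t => Re (f t)) a b) <= I).
{ apply (norm_RInt_le (fun t => Re (f t)) g a b); [easy| |now apply (@RInt_correct R_CompleteNormedModule)|easy].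
  intros t Ht; eapply Rle_trans; [apply re_le_Cmod|now apply Hg]. }
assert (B2 : Rabs (RInt (fun t => Im (f t)) a b) <= I).
{ apply (norm_RInt_le (fun t => Im (f t)) g a b); [easy| |now apply (@RInt_correct R_CompleteNormedModule)|easy].
  intros t Ht; eapply Rle_trans; [apply im_le_Cmod|now apply Hg]. }
lra.
Qed.

Lemma CInt_Chasles (f : R -> C) (a b c : R) : a <= b <= c -> Cdiff_on f a c ->
  CInt f a c = (CInt f a b + CInt f b c)%C.
Proof.
intros Habc Hf.
destruct (Cdiff_on_ex_RInt f a c a b Hf) as [H1 H2]; try lra.
destruct (Cdiff_on_ex_RInt f a c b c Hf) as [H3 H4]; try lra.
unfold CInt; apply C_eq; simpl; symmetry.
- exact (RInt_Chasles (fun t => Re (f t)) a b c H1 H3).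
- exact (RInt_Chasles (fun t => Im (f t)) a b c H2 H4).
Qed.

Lemma CInt_plus (f g : R -> C) (a b : R) : a <= b -> Cdiff_on f a b -> Cdiff_on g a b ->
  CInt (fun t => f t + g t)%C a b = (CInt f a b + CInt g a b)%C.
Proof.
intros Hab Hf Hg.
destruct (Cdiff_on_ex_RInt f a b a b Hf) as [H1 H2]; try lra.
destruct (Cdiff_on_ex_RInt g a b a b Hg) as [H3 H4]; try lra.
unfold CInt; apply C_eq; simpl.
- exact (RInt_plus (fun t => Re (f t)) (fun t => Re (g t)) a b H1 H3).
- exact (RInt_plus (fun t => Im (f t)) (fun t => Im (g t)) a b H2 H4).
Qed.

Lemma CInt_scal (c : C) (f : R -> C) (a b : R) : a <= b -> Cdiff_on f a b ->
  CInt (fun t => c * f t)%C a b = (c * CInt f a b)%C.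
Proof.
intros Hab Hf.
destruct (Cdiff_on_ex_RInt f a b a b Hf) as [H1 H2]; try lra.
unfold CInt; apply C_eq.
- rewrite re_mult; change (RInt (fun t => Re (c * f t)) a b =
    Re c * RInt (fun t => Re (f t)) a b - Im c * RInt (fun t => Im (f t)) a b).
  apply is_RInt_unique.
  apply (is_RInt_ext (fun t => Re c * Re (f t) - Im c * Im (f t))).
  { intros t _; now rewrite re_mult. }
  exact (is_RInt_minus _ _ a b _ _ (is_RInt_scal _ a b (Re c) _ (@RInt_correct R_CompleteNormedModule _ _ _ H1))
    (is_RInt_scal _ a b (Im c) _ (@RInt_correct R_CompleteNormedModule _ _ _ H2))).
- rewrite im_mult; change (RInt (fun t => Im (c * f t)) a b =
    Re c * RInt (fun t => Im (f t)) a b + Im c * RInt (fun t => Re (f t)) a b).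
  apply is_RInt_unique.
  apply (is_RInt_ext (fun t => Re c * Im (f t) + Im c * Re (f t))).
  { intros t _; now rewrite im_mult. }
  exact (is_RInt_plus _ _ a b _ _ (is_RInt_scal _ a b (Re c) _ (@RInt_correct R_CompleteNormedModule _ _ _ H2))
    (is_RInt_scal _ a b (Im c) _ (@RInt_correct R_CompleteNormedModule _ _ _ H1))).
Qed.

Lemma CInt_ext (f g : R -> C) (a b : R) : a <= b ->
  (forall t, a <= t <= b -> f t = g t) -> CInt f a b = CInt g a b.
Proof.
intros Hab H; unfold CInt; f_equal; apply RInt_ext;
  rewrite Rmin_left, Rmax_right by easy; intros t Ht; rewrite H; lra.
Qed.

(** At [u = 1] this is the integrand of [Gamma b], and for [b = 1 - alpha] its values at
    the positive integers are the terms of the polylogarithm at [exp (- u)]. *)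
Definition lap (b u : C) (t : R) : C := (Rcpow t (b - 1) * Cexp (- u * t))%C.

Lemma CD_Cexp_linear (u : C) (t : R) : CD (fun t => Cexp (u * t)) t (u * Cexp (u * t))%C.
Proof.
eapply CD_eq; [apply CD_exp, CD_scal, CD_id|].
cbv beta; ring.
Qed.

Lemma CD_lap (b u : C) (t : R) : 0 < t -> exists d, CD (lap b u) t d.
Proof.
intros Ht; eexists; apply CD_mult; [now apply CD_Rcpow|apply CD_Cexp_linear].
Qed.

Lemma Cdiff_on_lap (b u : C) (p q : R) : 0 < p -> Cdiff_on (lap b u) p q.
Proof. intros Hp t Ht; apply CD_lap; lra. Qed.

Lemma Cmod_lap (b u : C) (t : R) :
  Cmod (lap b u t) = Rpower t (Re b - 1) * exp (- Re u * t).
Proof.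
unfold lap; rewrite Cmod_mult, Cmod_Rcpow, Cmod_Cexp, Re_minus, re_scal_r, re_opp; easy.
Qed.

Lemma Rpower_exp_bounded (a c : R) : 0 <= a -> 0 < c ->
  exists K, 0 < K /\ forall t, 0 < t -> Rpower t a * exp (- c * t) <= K.
Proof.
intros Ha Hc; set (e := c / (a + 1)).
assert (He : 0 < e) by (apply Rdiv_lt_0_compat; lra).
assert (Hae : a * e <= c).
{ apply Rle_trans with ((a + 1) * e); [nra|right; unfold e; field; lra]. }
exists (exp (- a * ln e)); split; [apply exp_pos|]; intros t Ht.
unfold Rpower; rewrite <- exp_plus; apply exp_le_compat.
pose proof (ln_le_linear e t He Ht) as Hl.
assert (a * ln t <= a * (e * t - ln e)) by now apply Rmult_le_compat_l.
nra.
Qed.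

Lemma lap_majorant (b u : C) : 1 <= Re b -> 0 < Re u ->
  exists K, 0 < K /\ forall t, 0 < t -> Cmod (lap b u t) <= K * exp (- (Re u / 2) * t).
Proof.
intros Hb Hu.
destruct (Rpower_exp_bounded (Re b - 1) (Re u / 2)) as (K & HK & H); try lra.
exists K; split; [easy|]; intros t Ht; rewrite Cmod_lap.
replace (- Re u * t) with (- (Re u / 2) * t + - (Re u / 2) * t) by field.
rewrite exp_plus, <- Rmult_assoc.
apply Rmult_le_compat_r; [left; apply exp_pos|now apply H].
Qed.

Lemma is_RInt_exp (c p q : R) : c <> 0 ->
  is_RInt (fun t => exp (- c * t)) p q ((exp (- c * p) - exp (- c * q)) / c).
Proof.
intros Hc.
replace ((exp (- c * p) - exp (- c * q)) / c) with
  (minus (- exp (- c * q) / c) (- exp (- c * p) / c))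
  by (unfold minus, plus, opp; simpl; field; easy).
apply (is_RInt_derive (fun t => - exp (- c * t) / c)); intros x _.
- auto_derive; [easy|field; easy].
- apply (ex_derive_continuous (fun t => exp (- c * t))); auto_derive; easy.
Qed.

(** Cauchy criterion for an integral over [(0, +oo)] dominated by an exponential. *)
Lemma ex_RInt_gen_exp_dominated (g : R -> R) (K c : R) : 0 < c -> 0 < K ->
  (forall t, 0 < t -> continuous g t) ->
  (forall t, 0 < t -> Rabs (g t) <= K * exp (- c * t)) ->
  ex_RInt_gen g (at_right 0) (Rbar_locally p_infty).
Proof.
intros Hc HK Hcont Hg.
assert (Hex : forall p q, 0 < p -> 0 < q -> ex_RInt g p q).
{ intros p q Hp Hq; apply (@ex_RInt_continuous R_CompleteNormedModule); intros t Ht.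
  apply Hcont; assert (0 < Rmin p q) by now apply Rmin_glb_lt. lra. }
set (W := fun t => K / c * exp (- c * t)).
assert (HW0 : 0 < K / c) by now apply Rdiv_lt_0_compat.
assert (Hle : forall p q, 0 < p <= q -> Rabs (RInt g p q) <= W p - W q).
{ intros p q Hpq.
  apply (norm_RInt_le g (fun t => K * exp (- c * t)) p q); [lra| | |].
  - intros t Ht; apply Hg; lra.
  - apply (@RInt_correct R_CompleteNormedModule), Hex; lra.
  - replace (W p - W q) with (scal K ((exp (- c * p) - exp (- c * q)) / c))
      by (unfold W, scal; simpl; unfold mult; simpl; field; lra).
    apply (is_RInt_scal (fun t => exp (- c * t)) p q K), is_RInt_exp; lra. }
assert (Hle' : forall p q, 0 < p -> 0 < q -> Rabs (RInt g p q) <= Rabs (W p - W q)).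
{ intros p q Hp Hq; destruct (Rle_lt_dec p q) as [H|H].
  - eapply Rle_trans; [apply Hle; lra|apply Rle_abs].
  - rewrite <- (opp_RInt_swap g) by now apply Hex.
    unfold opp; simpl; rewrite Rabs_Ropp, Rabs_minus_sym.
    eapply Rle_trans; [apply Hle; lra|apply Rle_abs]. }
set (F := filter_prod (at_right 0) (Rbar_locally p_infty)).
assert (PF : ProperFilter F).
{ apply filter_prod_proper. }
destruct (proj1 (@filterlim_locally_cauchy _ R_CompleteSpace F PF
  (fun ab => RInt g (fst ab) (snd ab)))) as [y Hy].
{ intros eps.
  assert (He : 0 < eps / 4) by (pose proof (cond_pos eps); lra).
  assert (HWc : continuous W 0).
  { apply (ex_derive_continuous W); unfold W; auto_derive; easy. }
  pose proof (proj1 (filterlim_locally W (W 0)) HWc (mkposreal _ He)) as [d Hd].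
  set (T := / c * - ln (eps / 4 * c / K)).
  exists (fun ab => (0 < fst ab < d) /\ (0 < snd ab /\ T < snd ab)); split.
  - apply (Filter_prod _ _ _ (fun a => 0 < a < d) (fun b => 0 < b /\ T < b)).
    + exists d; intros a Ha Ha0; split; [easy|].
      unfold ball in Ha; simpl in Ha; unfold AbsRing_ball, abs, minus, plus, opp in Ha;
        simpl in Ha; apply Rabs_def2 in Ha; lra.
    + exists (Rmax 0 T); intros b Hb; split.
      * eapply Rle_lt_trans; [apply Rmax_l|exact Hb].
      * eapply Rle_lt_trans; [apply Rmax_r|exact Hb].
    + intros; easy.
  - intros [a b] [a' b'] [Ha [Hb HbT]] [Ha' [Hb' HbT']]; simpl in *.
    assert (HWa : forall x, 0 < x < d -> Rabs (W x - W 0) < eps / 4).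
    { intros x Hx; apply (Hd x); unfold ball; simpl; unfold AbsRing_ball, abs, minus, plus, opp;
        simpl; rewrite Rabs_pos_eq; lra. }
    assert (HWb : forall x, T < x -> 0 <= W x < eps / 4).
    { intros x Hx; split; [left; apply Rmult_lt_0_compat; [easy|apply exp_pos]|].
      unfold W; apply Rmult_lt_reg_l with (c / K); [now apply Rdiv_lt_0_compat|].
      replace (c / K * (K / c * exp (- c * x))) with (exp (- c * x)) by (field; lra).
      replace (c / K * (eps / 4)) with (eps / 4 * c / K) by (field; lra).
      rewrite <- (exp_ln (eps / 4 * c / K)).
      2: { apply Rdiv_lt_0_compat; [|easy]; apply Rmult_lt_0_compat; lra. }
      apply exp_increasing.
      apply (Rmult_lt_compat_l c) in Hx; [|easy]; unfold T in Hx.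
      rewrite <- Rmult_assoc, Rinv_r in Hx by lra; lra. }
    assert (E : RInt g a' b' - RInt g a b = RInt g a' a + RInt g b b').
    { pose proof (RInt_Chasles g a' a b (Hex a' a ltac:(lra) ltac:(lra))
        (Hex a b ltac:(lra) ltac:(lra))) as C1.
      pose proof (RInt_Chasles g a' b b' (Hex a' b ltac:(lra) ltac:(lra))
        (Hex b b' ltac:(lra) ltac:(lra))) as C2.
      change (RInt g a' a + RInt g a b = RInt g a' b) in C1.
      change (RInt g a' b + RInt g b b' = RInt g a' b') in C2; lra. }
    unfold ball; simpl; unfold AbsRing_ball, abs, minus, plus, opp; simpl.
    change (Rabs (RInt g a' b' - RInt g a b) < eps); rewrite E.
    eapply Rle_lt_trans; [apply Rabs_triang|].
    pose proof (Hle' a' a ltac:(lra) ltac:(lra)) as B1.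
    pose proof (Hle' b b' ltac:(lra) ltac:(lra)) as B2.
    pose proof (HWa a Ha) as A1; pose proof (HWa a' Ha') as A2.
    pose proof (HWb b HbT); pose proof (HWb b' HbT').
    apply Rabs_def2 in A1, A2.
    assert (Rabs (W a' - W a) < eps / 2) by (apply Rabs_def1; lra).
    assert (Rabs (W b - W b') < eps / 2) by (apply Rabs_def1; lra).
    lra. }
exists y; intros P HP; specialize (Hy P HP).
assert (Hpos : F (fun ab => 0 < fst ab /\ 0 < snd ab)).
{ apply (Filter_prod _ _ _ (fun a => 0 < a) (fun b => 0 < b)); [|now exists 0|easy].
  exists (mkposreal 1 Rlt_0_1); intros a _ Ha; exact Ha. }
unfold filtermapi; unfold filtermap in Hy.
apply (filter_imp (fun ab => P (RInt g (fst ab) (snd ab)) /\ 0 < fst ab /\ 0 < snd ab)).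
2: { now apply filter_and. }
intros [a b] [H1 [H2 H3]]; exists (RInt g a b); split; [|exact H1].
apply (@RInt_correct R_CompleteNormedModule), Hex; easy.
Qed.

(** The Laplace transform of [t ^ (b - 1)]; at [u = 1] it is [Gamma b]. *)
Definition laplace (b u : C) : C :=
  (RInt_gen (fun t => Re (lap b u t)) (at_right 0) (Rbar_locally p_infty),
   RInt_gen (fun t => Im (lap b u t)) (at_right 0) (Rbar_locally p_infty)).

Lemma RInt_gen_seq (g : R -> R) (l : R) :
  is_RInt_gen g (at_right 0) (Rbar_locally p_infty) l ->
  is_lim_seq (fun N => RInt g (/ INR (S N)) (INR (S N))) l.
Proof.
intros H P HP; specialize (H P HP); unfold filtermapi in H.
destruct H as [A B [d Hd] [M HM] HAB].
assert (H1 : eventually (fun N => / INR (S N) < d)).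
{ pose proof is_lim_seq_inv_S as Hl; apply is_lim_seq_spec in Hl.
  destruct (Hl d) as [N HN]; exists N; intros n Hn; specialize (HN n Hn).
  rewrite Rminus_0_r in HN; apply Rabs_def2 in HN; lra. }
assert (H2 : eventually (fun N => M < INR (S N))).
{ destruct (nfloor_ex (Rmax 0 M)) as [n [_ Hn]]; [apply Rmax_l|].
  exists n; intros k Hk; apply le_INR in Hk; rewrite S_INR.
  pose proof (Rmax_r 0 M); lra. }
unfold filtermap; generalize (filter_and _ _ H1 H2); apply filter_imp.
intros N [G1 G2].
assert (HS : 0 < / INR (S N)) by (apply Rinv_0_lt_compat; pose proof (INR_S_ge_1 N); lra).
destruct (HAB (/ INR (S N)) (INR (S N))) as (y & Hy & HPy).
- apply Hd; [|easy].
  change (Rabs (/ INR (S N) - 0) < d); rewrite Rminus_0_r, Rabs_pos_eq; lra.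
- now apply HM.
- change (is_RInt g (/ INR (S N)) (INR (S N)) y) in Hy; now rewrite (is_RInt_unique _ _ _ _ Hy).
Qed.

Lemma laplace_seq (b u : C) : 1 <= Re b -> 0 < Re u ->
  Clim (fun N => CInt (lap b u) (/ INR (S N)) (INR (S N))) (laplace b u).
Proof.
intros Hb Hu; destruct (lap_majorant b u Hb Hu) as (K & HK & HM).
assert (Hc : forall t, 0 < t ->
  continuous (fun t => Re (lap b u t)) t /\ continuous (fun t => Im (lap b u t)) t).
{ intros t Ht; destruct (CD_lap b u t Ht) as [d Hd]; apply (CD_continuous _ t d Hd). }
assert (Hgen : forall g : R -> R, (forall t, 0 < t -> continuous g t) ->
  (forall t, 0 < t -> Rabs (g t) <= K * exp (- (Re u / 2) * t)) ->
  is_lim_seq (fun N => RInt g (/ INR (S N)) (INR (S N)))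
    (RInt_gen g (at_right 0) (Rbar_locally p_infty))).
{ intros g Hgc Hgb; apply RInt_gen_seq, (@RInt_gen_correct R_CompleteNormedModule);
    try apply Proper_StrongProper; try typeclasses eauto.
  apply (ex_RInt_gen_exp_dominated g K (Re u / 2)); try easy; lra. }
apply Clim_Re_Im; split.
- apply (Hgen (fun t => Re (lap b u t))); intros t Ht; [apply (Hc t Ht)|].
  eapply Rle_trans; [apply re_le_Cmod|now apply HM].
- apply (Hgen (fun t => Im (lap b u t))); intros t Ht; [apply (Hc t Ht)|].
  eapply Rle_trans; [apply im_le_Cmod|now apply HM].
Qed.

Lemma Gamma_laplace (b : C) : Gamma b = laplace b 1.
Proof.
assert (E : forall t, lap b 1 t = (Rcpow t (b - 1) * exp (- t))%C).
{ intros t; unfold lap; f_equal; rewrite <- Cexp_RtoC; f_equal; rewrite RtoC_opp; ring. }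
unfold Gamma, laplace.
assert (E1 : (fun t => Re (lap b 1 t)) = (fun t => Re (Rcpow t (b - 1) * exp (- t))%C)).
{ apply FunctionalExtensionality.functional_extensionality; intros t; now rewrite E. }
assert (E2 : (fun t => Im (lap b 1 t)) = (fun t => Im (Rcpow t (b - 1) * exp (- t))%C)).
{ apply FunctionalExtensionality.functional_extensionality; intros t; now rewrite E. }
now rewrite E1, E2.
Qed.

(** The boundary terms [t ^ a * exp (- c t)] tend to 0 at both ends of [(0, +oo)]. *)
Lemma Rpower_exp_boundary (a c : R) : 1 <= a -> 0 < c ->
  exists K, 0 < K /\ forall N,
    Rpower (INR (S N)) a * exp (- c * INR (S N)) <= K * / INR (S N) /\
    Rpower (/ INR (S N)) a * exp (- c * / INR (S N)) <= K * / INR (S N).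
Proof.
intros Ha Hc; destruct (Rpower_exp_bounded (a + 1) c) as (K & HK & H); try lra.
exists (K + 1); split; [lra|]; intros N; pose proof (INR_S_ge_1 N) as HN.
pose proof (inv_INR_S_bound N) as Hi.
split.
- specialize (H (INR (S N)) ltac:(lra)); rewrite Rpower_plus, Rpower_1 in H by lra.
  apply Rmult_le_reg_r with (INR (S N)); [lra|].
  replace ((K + 1) * / INR (S N) * INR (S N)) with (K + 1) by (field; lra); nra.
- assert (H1 : Rpower (/ INR (S N)) a <= / INR (S N)).
  { unfold Rpower; rewrite <- (exp_ln (/ INR (S N))) at 2 by easy.
    apply exp_le_compat; assert (ln (/ INR (S N)) <= 0) by (rewrite <- ln_1; apply ln_le; lra).
    nra. }
  assert (H2 : exp (- c * / INR (S N)) <= 1).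
  { rewrite <- exp_0; apply exp_le_compat; nra. }
  pose proof (exp_pos (- c * / INR (S N))).
  assert (0 < Rpower (/ INR (S N)) a) by apply exp_pos. nra.
Qed.

Definition C2 (f : R -> R -> C) (x y : R) : Prop :=
  continuity_2d_pt (fun u v => Re (f u v)) x y /\
  continuity_2d_pt (fun u v => Im (f u v)) x y.

Lemma C2_const (c : C) (x y : R) : C2 (fun _ _ => c) x y.
Proof. split; apply continuity_2d_pt_const. Qed.

Lemma C2_RtoC (f : R -> R -> R) (x y : R) :
  continuity_2d_pt f x y -> C2 (fun u v => RtoC (f u v)) x y.
Proof. split; [easy|exact (continuity_2d_pt_const x y 0)]. Qed.

Lemma C2_plus (f g : R -> R -> C) (x y : R) :
  C2 f x y -> C2 g x y -> C2 (fun u v => f u v + g u v)%C x y.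
Proof.
intros [F1 F2] [G1 G2]; split.
- exact (continuity_2d_pt_plus _ _ x y F1 G1).
- exact (continuity_2d_pt_plus _ _ x y F2 G2).
Qed.

Lemma C2_mult (f g : R -> R -> C) (x y : R) :
  C2 f x y -> C2 g x y -> C2 (fun u v => f u v * g u v)%C x y.
Proof.
intros [F1 F2] [G1 G2]; split.
- exact (continuity_2d_pt_minus _ _ x y (continuity_2d_pt_mult _ _ x y F1 G1)
    (continuity_2d_pt_mult _ _ x y F2 G2)).
- exact (continuity_2d_pt_plus _ _ x y (continuity_2d_pt_mult _ _ x y F1 G2)
    (continuity_2d_pt_mult _ _ x y F2 G1)).
Qed.

Lemma C2_exp (f : R -> R -> C) (x y : R) : C2 f x y -> C2 (fun u v => Cexp (f u v)) x y.
Proof.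
intros [F1 F2].
assert (He : continuity_2d_pt (fun u v => exp (Re (f u v))) x y).
{ apply (continuity_1d_2d_pt_comp exp); [|easy].
  apply derivable_continuous_pt, derivable_pt_exp. }
split; apply continuity_2d_pt_mult; try exact He.
- apply (continuity_1d_2d_pt_comp cos); [|easy].
  apply derivable_continuous_pt, derivable_pt_cos.
- apply (continuity_1d_2d_pt_comp sin); [|easy].
  apply derivable_continuous_pt, derivable_pt_sin.
Qed.

Lemma CD_CInt_param (f fd : R -> R -> C) (a b s : R) : a <= b ->
  (forall s t, CD (fun u => f u t) s (fd s t)) ->
  (forall t, a <= t <= b -> C2 fd s t) -> (forall s, Cdiff_on (f s) a b) ->
  CD (fun s => CInt (f s) a b) s (CInt (fd s) a b).
Proof.
intros Hab Hd H2 Hf.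
assert (aux : forall p : C -> R,
  (forall s t, is_derive (fun u => p (f u t)) s (p (fd s t))) ->
  (forall t, a <= t <= b -> continuity_2d_pt (fun u v => p (fd u v)) s t) ->
  (forall s, ex_RInt (fun t => p (f s t)) a b) ->
  is_derive (fun s => RInt (fun t => p (f s t)) a b) s (RInt (fun t => p (fd s t)) a b)).
{ intros p Hpd Hp2 Hpe.
  assert (HD : forall u v, Derive (fun z => p (f z v)) u = p (fd u v)).
  { intros u v; apply is_derive_unique, Hpd. }
  eapply is_derive_eq.
  - apply (is_derive_RInt_param (fun s t => p (f s t))).
    + apply filter_forall; intros x t _; eexists; apply Hpd.
    + rewrite Rmin_left, Rmax_right by easy; intros t Ht.
      apply (continuity_2d_pt_ext (fun u v => p (fd u v))); [|now apply Hp2].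
      intros u v; now rewrite HD.
    + apply filter_forall; intros x; apply Hpe.
  - apply RInt_ext; intros t _; apply HD. }
split; simpl.
- apply (aux Re); [intros; apply Hd|intros t Ht; apply (H2 t Ht)|].
  intros u; apply (Cdiff_on_ex_RInt (f u) a b a b (Hf u)); lra.
- apply (aux Im); [intros; apply Hd|intros t Ht; apply (H2 t Ht)|].
  intros u; apply (Cdiff_on_ex_RInt (f u) a b a b (Hf u)); lra.
Qed.

Lemma cos_le_shrink (x s : R) : - PI / 2 < x < PI / 2 -> 0 <= s <= 1 -> cos x <= cos (s * x).
Proof.
intros Hx Hs; destruct (Rle_lt_dec 0 x) as [H|H].
- apply cos_decr_1; nra.
- rewrite <- (cos_neg x), <- (cos_neg (s * x)); apply cos_decr_1; nra.
Qed.

(** Rotation of the ray of integration. Along [u_s = exp (s Log u)], the derivative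
    in [s] of [u_s ^ b] times the integrand is the derivative in [t] of
    [Log u * u_s ^ b * t ^ b * exp (- u_s t)], so that only boundary terms remain;
    they vanish because [Re u_s] stays bounded below. *)
Lemma laplace_Gamma (b u : C) : 1 <= Re b -> 0 < Re u ->
  laplace b u = (Gamma b * Cpw u (- b))%C.
Proof.
intros Hb Hu; set (L := Clog u).
assert (HL : Cexp L = u) by now apply Cexp_Clog.
set (psi := fun s t : R => Cexp (s * (b * L) + (b - 1) * ln t + (- (1)) * (Cexp (s * L) * t))%C).
set (psid := fun s t : R => (L * (b + (- (1)) * (Cexp (s * L) * t)) * psi s t)%C).
set (prim := fun s t : R => (L * (RtoC t * psi s t))%C).
assert (Hs : forall s t : R, CD (fun s : R => psi s t) s (psid s t)).
{ intros s t; unfold psi, psid.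
  assert (Hlin : forall c : C, CD (fun s => RtoC s * c)%C s c).
  { intros c; eapply CD_eq; [apply CD_mult; [apply CD_id|apply CD_const]|].
    cbv beta; ring. }
  eapply CD_eq.
  - apply CD_exp, CD_plus; [apply CD_plus; [apply Hlin|apply CD_const]|].
    apply CD_scal, CD_mult; [apply CD_exp, Hlin|apply CD_const].
  - unfold psi; cbv beta; ring. }
assert (Ht : forall s t : R, 0 < t -> CD (psi s) t
  (((b - 1) * / t + (- (1)) * Cexp (s * L)) * psi s t)%C).
{ intros s t Ht; unfold psi; eapply CD_eq.
  - apply CD_exp, CD_plus; [apply CD_plus; [apply CD_const|apply CD_scal, CD_RtoC]|].
    + exact (is_derive_ln t Ht).
    + apply CD_scal, CD_scal, CD_id.
  - cbv beta; rewrite RtoC_inv by lra; ring. }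
assert (Hprim : forall s t : R, 0 < t -> CD (prim s) t (psid s t)).
{ intros s t Ht0; unfold prim, psid; eapply CD_eq.
  - apply CD_scal, CD_mult; [apply CD_id|apply (Ht s t Ht0)].
  - cbv beta; field; apply RtoC_neq_0; lra. }
assert (Hpsid : forall s t : R, 0 < t -> exists d, CD (psid s) t d).
{ intros s t Ht0; eexists; unfold psid; apply CD_mult; [|apply (Ht s t Ht0)].
  apply CD_scal, CD_plus; [apply CD_const|].
  apply CD_scal, CD_scal, CD_id. }
assert (H2 : forall s t : R, 0 < t -> C2 psid s t).
{ intros s t Ht0.
  assert (Hid1 : forall c : C, C2 (fun u v => RtoC u * c)%C s t).
  { intros c; apply C2_mult; [apply C2_RtoC, continuity_2d_pt_id1|apply C2_const]. }
  assert (Hexp : C2 (fun u v => (- (1)) * (Cexp (RtoC u * L) * RtoC v))%C s t).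
  { apply C2_mult; [apply C2_const|]; apply C2_mult; [apply C2_exp, Hid1|].
    apply C2_RtoC, continuity_2d_pt_id2. }
  apply C2_mult.
  - apply C2_mult; [apply C2_const|apply C2_plus; [apply C2_const|exact Hexp]].
  - apply C2_exp, C2_plus; [|exact Hexp].
    apply C2_plus; [apply Hid1|]; apply C2_mult; [apply C2_const|].
    apply C2_RtoC, (continuity_1d_2d_pt_comp ln); [|apply continuity_2d_pt_id2].
    apply continuity_pt_filterlim, (ex_derive_continuous ln).
    eexists; exact (is_derive_ln t Ht0). }
assert (Hder : forall p q s : R, 0 < p <= q ->
  CD (fun s => CInt (psi s) p q) s (prim s q - prim s p)%C).
{ intros p q s Hpq; eapply CD_eq.
  - apply (CD_CInt_param psi psid); [lra|exact Hs|intros t Ht0; apply H2; lra|].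
    intros s0 t Ht0; eexists; apply Ht; lra.
  - apply CInt_derive; [lra|intros t Ht0; apply Hprim; lra|].
    intros t Ht0; apply Hpsid; lra. }
assert (Hpsi0 : forall t : R, psi 0 t = lap b 1 t).
{ intros t; unfold psi, lap, Rcpow; rewrite <- Cexp_plus; f_equal.
  rewrite Cmult_0_l, Cmult_0_l, Cexp_0; ring. }
assert (Hpsi1 : forall t : R, psi 1 t = (Cpw u b * lap b u t)%C).
{ intros t; unfold psi, lap, Rcpow, Cpw; rewrite <- !Cexp_plus; f_equal.
  rewrite Cmult_1_l, Cmult_1_l, HL; fold L; ring. }
pose proof (Im_Clog_bound u) as HI; fold L in HI.
set (c := exp (- Rabs (Re L)) * cos (Im L)).
assert (Hcos : 0 < cos (Im L)) by (apply cos_gt_0; lra).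
assert (Hc : 0 < c) by (apply Rmult_lt_0_compat; [apply exp_pos|easy]).
assert (Hcs : forall s : R, 0 <= s <= 1 -> c <= Re (Cexp (s * L))).
{ intros s Hs0; unfold Cexp; simpl Re at 1.
  change (c <= exp (Re (s * L)) * cos (Im (s * L))).
  rewrite re_scal_l, im_scal_l; unfold c.
  apply Rmult_le_compat; [left; apply exp_pos|lra| |apply cos_le_shrink; lra].
  apply exp_le_compat; pose proof (Rle_abs (- Re L)) as Ha; rewrite Rabs_Ropp in Ha.
  pose proof (Rabs_pos (Re L)); nra. }
set (M := exp (Cmod (b * L))).
assert (HM : 0 < M) by apply exp_pos.
assert (Hbd : forall s t : R, 0 <= s <= 1 -> 0 < t ->
  Cmod (prim s t) <= Cmod L * M * (Rpower t (Re b) * exp (- c * t))).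
{ intros s t Hs0 Ht0; unfold prim; rewrite !Cmod_mult, Cmod_pos_R, Rmult_assoc by lra.
  apply Rmult_le_compat_l; [apply Cmod_ge_0|].
  unfold psi; rewrite Cmod_Cexp, !re_plus, re_scal_l, re_scal_r, Re_minus, re_RtoC.
  replace (Re (- (1) * (Cexp (s * L) * t))) with (- Re (Cexp (s * L)) * t).
  2: { replace (- (1) * (Cexp (s * L) * t))%C with ((- t)%R * Cexp (s * L))%C
         by (rewrite RtoC_opp; ring).
       rewrite re_scal_l; ring. }
  unfold M, Rpower; rewrite <- (exp_ln t Ht0) at 1; rewrite <- !exp_plus.
  apply exp_le_compat.
  pose proof (re_le_Cmod (b * L)) as Hre; apply Rabs_le_between in Hre.
  pose proof (Cmod_ge_0 (b * L)); pose proof (Hcs s Hs0).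
  assert (c * t <= Re (Cexp (s * L)) * t) by (apply Rmult_le_compat_r; lra).
  assert (s * Re (b * L) <= Cmod (b * L)) by nra. lra. }
destruct (Rpower_exp_boundary (Re b) c Hb Hc) as (K & HK & HKN).
assert (Hlim : Clim (fun N => Cpw u b * CInt (lap b u) (/ INR (S N)) (INR (S N))
  - CInt (lap b 1) (/ INR (S N)) (INR (S N)))%C 0).
{ apply (Clim_le _ _ (fun N => 4 * (Cmod L * M * K) * / INR (S N))).
  - intros N; pose proof (INR_S_ge_1 N) as HN.
    pose proof (inv_INR_S_bound N) as Hi.
    destruct (HKN N) as [K1 K2].
    rewrite <- CInt_scal by (try apply Cdiff_on_lap; lra).
    rewrite <- (CInt_ext (psi 1) (fun t => Cpw u b * lap b u t)%C) by
      first [lra|intros; apply Hpsi1].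
    rewrite <- (CInt_ext (psi 0) (lap b 1)) by first [lra|intros; apply Hpsi0].
    set (A := CInt (psi 1) _ _); set (A0 := CInt (psi 0) _ _).
    replace (A - A0 - 0)%C with (A - A0)%C by ring; unfold A, A0.
    eapply Rle_trans; [apply (Cmvt_le (fun s => CInt (psi s) (/ INR (S N)) (INR (S N)))
      (fun s => prim s (INR (S N)) - prim s (/ INR (S N))%R)%C 0 1
      (2 * (Cmod L * M * K * / INR (S N))))|]; [lra| | |lra].
    + intros s _; apply Hder; lra.
    + intros s Hs0; eapply Rle_trans; [apply Cmod_triangle_minus|].
      assert (HLM : 0 <= Cmod L * M) by (apply Rmult_le_pos; [apply Cmod_ge_0|lra]).
      pose proof (Hbd s (INR (S N)) Hs0 ltac:(lra)) as B1.
      pose proof (Hbd s (/ INR (S N)) Hs0 ltac:(lra)) as B2.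
      apply (Rmult_le_compat_l _ _ _ HLM) in K1, K2; lra.
  - apply is_lim_seq_scal_0, is_lim_seq_inv_S. }
assert (E : (Cpw u b * laplace b u - laplace b 1)%C = RtoC 0).
{ refine (Clim_unique _ _ _ _ Hlim); apply Clim_minus.
  - apply Clim_scal, laplace_seq; lra.
  - apply laplace_seq; [lra|simpl; lra]. }
rewrite Gamma_laplace.
replace (laplace b 1) with (Cpw u b * laplace b u - (Cpw u b * laplace b u - laplace b 1))%C by ring.
rewrite E; unfold Cpw; replace (- b * Clog u)%C with (- (b * Clog u))%C by ring.
rewrite Cexp_opp; field; apply Cexp_neq_0.
Qed.

Lemma Gamma_S (b : C) : 1 <= Re b -> Gamma (b + 1) = (b * Gamma b)%C.
Proof.
intros Hb; rewrite !Gamma_laplace.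
set (F := fun t => (Rcpow t b * Cexp (- (1) * t))%C).
assert (Hb1 : 1 <= Re (b + 1)) by (rewrite re_plus; simpl; lra).
assert (HF : forall t, 0 < t -> CD F t (b * lap b 1 t + (- (1)) * lap (b + 1) 1 t)%C).
{ intros t Ht; unfold F; eapply CD_eq.
  - apply CD_mult; [now apply CD_Rcpow|apply CD_Cexp_linear].
  - unfold lap; replace (b + 1 - 1)%C with b by ring; ring. }
destruct (Rpower_exp_boundary (Re b) 1 Hb Rlt_0_1) as (K & HK & HKN).
assert (HFm : forall t, Cmod (F t) = Rpower t (Re b) * exp (- (1) * t)).
{ intros t; unfold F; rewrite Cmod_mult, Cmod_Rcpow, Cmod_Cexp, re_scal_r; easy. }
assert (Hlim : Clim (fun N => b * CInt (lap b 1) (/ INR (S N)) (INR (S N))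
  - CInt (lap (b + 1) 1) (/ INR (S N)) (INR (S N)))%C 0).
{ apply (Clim_le _ _ (fun N => 2 * K * / INR (S N))).
  - intros N; pose proof (INR_S_ge_1 N) as HN.
    pose proof (inv_INR_S_bound N) as Hi.
    destruct (HKN N) as [K1 K2].
    assert (Hsc : forall (c d : C), Cdiff_on (fun t => c * lap d 1 t)%C (/ INR (S N)) (INR (S N))).
    { intros c d t Ht; destruct (CD_lap d 1 t ltac:(lra)) as [e He].
      eexists; apply CD_scal, He. }
    set (A := CInt (lap b 1) (/ INR (S N)) (INR (S N))).
    set (A1 := CInt (lap (b + 1) 1) (/ INR (S N)) (INR (S N))).
    assert (HI : (b * A + - (1) * A1)%C = (F (INR (S N)) - F (/ INR (S N))%R)%C).
    { assert (Hle : / INR (S N) <= INR (S N)) by lra.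
      unfold A, A1.
      rewrite <- (CInt_scal b (lap b 1) _ _ Hle (Cdiff_on_lap b 1 _ _ (proj1 Hi))).
      rewrite <- (CInt_scal (- (1)) (lap (b + 1) 1) _ _ Hle
        (Cdiff_on_lap (b + 1) 1 _ _ (proj1 Hi))).
      rewrite <- (CInt_plus _ _ _ _ Hle (Hsc b b) (Hsc (- (1))%C (b + 1)%C)).
      apply CInt_derive; [lra|intros t Ht; apply HF; lra|].
      intros t Ht; destruct (Hsc b b t Ht) as [d1 D1].
      destruct (Hsc (- (1))%C (b + 1)%C t Ht) as [d2 D2].
      eexists; apply CD_plus; eassumption. }
    replace (b * A - A1 - 0)%C with (b * A + - (1) * A1)%C by ring.
    rewrite HI; eapply Rle_trans; [apply Cmod_triangle_minus|]; rewrite !HFm; lra.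
  - apply is_lim_seq_scal_0, is_lim_seq_inv_S. }
assert (E : (b * laplace b 1 - laplace (b + 1) 1)%C = RtoC 0).
{ refine (Clim_unique _ _ _ _ Hlim); apply Clim_minus.
  - apply Clim_scal, laplace_seq; [lra|simpl; lra].
  - apply laplace_seq; [lra|simpl; lra]. }
symmetry; now apply Ceq_minus.
Qed.

(** * Comparison of the sum and the integral of [t ^ (b - 1) * exp (- u t)] *)

(** The polylogarithm of order [1 - b] at [exp (- u)], in the form in which it is
    compared with [laplace b u]. *)
Definition psum (b u : C) : C := CSeries (fun n => lap b u (INR (S n))).

Lemma psum_series (b u : C) : 0 < Re u -> is_series (fun n => lap b u (INR (S n))) (psum b u).
Proof.
intros Hu; apply CSeries_correct, (ex_series_Cmod _
  (fun n => Rpower (INR (S n)) (Re b - 1) * exp (- Re u * INR (S n)))).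
- intros n; rewrite Cmod_lap; lra.
- now apply ex_series_Rpower_exp.
Qed.

(** The Laplace transform of the hat function [max 0 (1 - |t|)]. *)
Definition hatK (u : C) : C := ((Cexp u - 1) * (1 - Cexp (- u)) / (u * u))%C.

Lemma Rpower_unit_step (a x t : R) : 1 <= x -> x <= t <= x + 1 ->
  Rpower t a <= Rpower 2 (Rabs a) * Rpower x a.
Proof.
intros Hx Ht.
replace t with (t / x * x) by (field; lra).
assert (Hr : 1 <= t / x <= 2).
{ split; apply Rmult_le_reg_r with x; try lra; unfold Rdiv;
    rewrite Rmult_assoc, Rinv_l; lra. }
rewrite <- Rpower_mult_distr by lra.
apply Rmult_le_compat_r; [left; apply exp_pos|].
unfold Rpower; apply exp_le_compat.
assert (H0 : 0 <= ln (t / x)) by (rewrite <- ln_1; apply ln_le; lra).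
assert (H1 : ln (t / x) <= ln 2) by (apply ln_le; lra).
pose proof (Rle_abs a); pose proof (Rabs_pos a); nra.
Qed.

(** Error of linear interpolation of a power on a unit interval, by three mean value
    inequalities; the second derivative is of order [x ^ (Re g - 2)]. *)
Lemma interpolation_error (g : C) : exists D, 0 <= D /\ forall x t, 1 <= x -> x <= t <= x + 1 ->
  Cmod (Rcpow t g - (Rcpow x g + (t - x)%R * (Rcpow (x + 1) g - Rcpow x g)))
  <= D * Rpower x (Re g - 2).
Proof.
set (B := Cmod g * Cmod (g - 1) * Rpower 2 (Rabs (Re g - 2))).
assert (HB : 0 <= B).
{ repeat apply Rmult_le_pos; try apply Cmod_ge_0; left; apply exp_pos. }
exists (8 * B); split; [lra|]; intros x t Hx Ht.
set (S2 := B * Rpower x (Re g - 2)).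
assert (HS2 : 0 <= S2) by (apply Rmult_le_pos; [easy|left; apply exp_pos]).
assert (H1 : forall p q, x <= p <= q -> q <= x + 1 ->
  Cmod (g * Rcpow q (g - 1) - g * Rcpow p (g - 1)) <= 2 * S2).
{ intros p q Hpq Hq.
  eapply Rle_trans; [apply (Cmvt_le (fun y => g * Rcpow y (g - 1))%C
    (fun y => g * ((g - 1) * Rcpow y (g - 1 - 1)))%C p q S2); [lra| |]|].
  - intros y Hy; apply CD_scal, CD_Rcpow; lra.
  - intros y Hy; rewrite !Cmod_mult, Cmod_Rcpow, !Re_minus; simpl Re.
    replace (Re g - 1 - 1) with (Re g - 2) by ring.
    pose proof (Rpower_unit_step (Re g - 2) x y Hx ltac:(lra)) as Hstep.
    unfold S2, B; rewrite <- !Rmult_assoc, (Rmult_assoc (Cmod g * Cmod (g - 1))).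
    apply Rmult_le_compat_l; [|exact Hstep].
    apply Rmult_le_pos; apply Cmod_ge_0.
  - nra. }
assert (H1' : forall p q, x <= p <= x + 1 -> x <= q <= x + 1 ->
  Cmod (g * Rcpow q (g - 1) - g * Rcpow p (g - 1)) <= 2 * S2).
{ intros p q Hp Hq; destruct (Rle_lt_dec p q); [apply H1; lra|].
  rewrite Cmod_minus_sym; apply H1; lra. }
set (D := (Rcpow (x + 1) g - Rcpow x g)%C).
assert (H2 : forall y, x <= y <= x + 1 -> Cmod (g * Rcpow y (g - 1) - D) <= 4 * S2).
{ intros y Hy.
  pose (f := fun z => (Rcpow z g + z * (- (g * Rcpow y (g - 1))))%C).
  assert (Hf : Cmod (f (x + 1)%R - f x) <= 2 * (2 * S2) * (x + 1 - x)).
  { apply (Cmvt_le f (fun z => g * Rcpow z (g - 1) - g * Rcpow y (g - 1))%C); [lra| |].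
    - intros z Hz; unfold f; eapply CD_eq.
      + apply CD_plus; [apply CD_Rcpow; lra|apply CD_mult; [apply CD_id|apply CD_const]].
      + cbv beta; ring.
    - intros z Hz; apply H1'; lra. }
  rewrite Cmod_minus_sym; unfold D.
  replace (Rcpow (x + 1) g - Rcpow x g - g * Rcpow y (g - 1))%C with (f (x + 1)%R - f x)%C.
  - lra.
  - unfold f; rewrite RtoC_plus; ring. }
pose (e := fun z => (Rcpow z g + z * (- D))%C).
assert (He : Cmod (e t - e x) <= 2 * (4 * S2) * (t - x)).
{ apply (Cmvt_le e (fun z => g * Rcpow z (g - 1) - D)%C); [lra| |].
  - intros z Hz; unfold e; eapply CD_eq.
    + apply CD_plus; [apply CD_Rcpow; lra|apply CD_mult; [apply CD_id|apply CD_const]].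
    + cbv beta; ring.
  - intros z Hz; apply H2; lra. }
replace (Rcpow t g - (Rcpow x g + (t - x)%R * D))%C with (e t - e x)%C.
- replace (8 * B * Rpower x (Re g - 2)) with (8 * S2) by (unfold S2; ring); nra.
- unfold e; rewrite RtoC_minus; ring.
Qed.

(** The integral over [[x, x + 1]] of [exp (- u t)] times the linear function that agrees
    with [t ^ (b - 1)] at both ends, arranged so that the sum over [x] telescopes. *)
Definition hat_piece (b u : C) (x : R) : C :=
  ((lap b u x - lap b u (x + 1)) / u
   + (1 - Cexp (- u)) / (u * u) * (Cexp u * lap b u (x + 1) - lap b u x))%C.

Lemma lap_shift_exp (b u : C) (x : R) :
  (Cexp u * lap b u (x + 1))%C = (Rcpow (x + 1) (b - 1) * Cexp (- u * x))%C.
Proof.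
unfold lap; rewrite (Cmult_comm (Cexp u)), <- Cmult_assoc, <- Cexp_plus; do 2 f_equal.
rewrite RtoC_plus; ring.
Qed.

Lemma hat_piece_integral (b u : C) (x : R) : u <> RtoC 0 ->
  hat_piece b u x = CInt (fun t => (Rcpow x (b - 1) + (t - x)%R *
    (Rcpow (x + 1) (b - 1) - Rcpow x (b - 1))) * Cexp (- u * t))%C x (x + 1).
Proof.
intros Hu; set (g0 := Rcpow x (b - 1)); set (g1 := Rcpow (x + 1) (b - 1)).
set (F := fun t => ((- / u * ((g0 - x * (g1 - g0)) + / u * (g1 - g0))
  + t * (- / u * (g1 - g0))) * Cexp (- u * t))%C).
rewrite (CInt_derive F); [| lra | |].
- unfold F, hat_piece; rewrite lap_shift_exp; unfold lap; fold g0 g1.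
  replace (Cexp (- u * (x + 1)%R)) with (Cexp (- u) * Cexp (- u * x))%C.
  2: { rewrite <- Cexp_plus; f_equal; rewrite RtoC_plus; ring. }
  rewrite RtoC_plus; field; easy.
- intros t Ht; unfold F; eapply CD_eq.
  + apply CD_mult; [apply CD_line|apply CD_Cexp_linear].
  + rewrite RtoC_minus; field; easy.
- intros t Ht; eexists; apply CD_mult; [|apply CD_Cexp_linear].
  apply (CD_ext (fun t => (g0 - x * (g1 - g0)) + t * (g1 - g0))%C); [|apply CD_line].
  intros z; rewrite RtoC_minus; ring.
Qed.

Lemma hat_piece_error (b : C) : exists D, 0 <= D /\ forall u x, 0 < Re u -> 1 <= x ->
  Cmod (CInt (lap b u) x (x + 1) - hat_piece b u x)
  <= D * (Rpower x (Re b - 3) * exp (- Re u * x)).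
Proof.
destruct (interpolation_error (b - 1)) as (D & HD & HI).
exists (2 * D); split; [lra|]; intros u x Hu Hx.
set (h := fun t => ((Rcpow x (b - 1) + (t - x)%R *
    (Rcpow (x + 1) (b - 1) - Rcpow x (b - 1))) * Cexp (- u * t))%C).
assert (Hh : Cdiff_on h x (x + 1)).
{ intros t Ht; unfold h; eexists; apply CD_mult; [|apply CD_Cexp_linear].
  apply (CD_ext (fun t => (Rcpow x (b - 1) - x * (Rcpow (x + 1) (b - 1) - Rcpow x (b - 1)))
    + t * (Rcpow (x + 1) (b - 1) - Rcpow x (b - 1)))%C); [|apply CD_line].
  intros z; rewrite RtoC_minus; ring. }
assert (Hm : Cdiff_on (fun t => (- (1)) * h t)%C x (x + 1)).
{ intros t Ht; destruct (Hh t Ht) as [d Hd]; eexists; apply CD_scal, Hd. }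
rewrite hat_piece_integral by now apply Re_pos_neq_0.
fold h; replace (CInt (lap b u) x (x + 1) - CInt h x (x + 1))%C with
  (CInt (lap b u) x (x + 1) + (- (1)) * CInt h x (x + 1))%C by ring.
assert (Hle : x <= x + 1) by lra.
assert (Hl : Cdiff_on (lap b u) x (x + 1)) by (apply Cdiff_on_lap; lra).
rewrite <- (CInt_scal _ h _ _ Hle Hh), <- (CInt_plus _ _ _ _ Hle Hl Hm).
replace (2 * D * (Rpower x (Re b - 3) * exp (- Re u * x))) with
  (2 * scal (x + 1 - x) (D * Rpower x (Re b - 3) * exp (- Re u * x)))
  by (unfold scal; simpl; unfold mult; simpl; ring).
apply (CInt_bound _ (fun _ => D * Rpower x (Re b - 3) * exp (- Re u * x))).
- lra.
- intros t Ht; destruct (CD_lap b u t ltac:(lra)) as [d1 D1].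
  destruct (Hm t Ht) as [d2 D2]; eexists; apply CD_plus; eassumption.
- intros t Ht; unfold lap, h.
  match goal with |- Cmod ?e <= _ => replace e with
    ((Rcpow t (b - 1) - (Rcpow x (b - 1) + (t - x)%R *
      (Rcpow (x + 1) (b - 1) - Rcpow x (b - 1)))) * Cexp (- u * t))%C by ring end.
  rewrite Cmod_mult, Cmod_Cexp, re_scal_r, re_opp.
  pose proof (HI x t Hx Ht) as H; rewrite Re_minus in H; simpl Re in H.
  replace (Re b - 1 - 2) with (Re b - 3) in H by ring.
  apply Rmult_le_compat; [apply Cmod_ge_0|left; apply exp_pos|easy|].
  apply exp_le_compat; nra.
- exact (is_RInt_const x (x + 1) _).
Qed.

(** The term by which the sum of the pieces over [[1, +oo)] exceeds
    [hatK u * psum b u]; it is minus the integral over [[0, 1]] of [t * exp (- u t)]. *)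
Lemma hat_end_bound (u : C) : 0 < Re u ->
  Cmod (Cexp (- u) / u - Cexp (- u) * (Cexp u - 1) / (u * u)) <= 2.
Proof.
intros Hu; pose proof (Re_pos_neq_0 u Hu) as Hnz.
set (F := fun t : R => ((/ (u * u) + t * / u) * Cexp (- u * t))%C).
assert (E : (Cexp (- u) / u - Cexp (- u) * (Cexp u - 1) / (u * u))%C =
  CInt (fun t => (0 + t * (- (1))) * Cexp (- u * t))%C 0 1).
{ rewrite (CInt_derive F); [| lra | |].
  - unfold F; replace (- u * 1)%C with (- u)%C by ring.
    replace (- u * 0)%C with (RtoC 0) by ring; rewrite Cexp_0, Cexp_opp.
    field; split; first [easy|apply Cexp_neq_0].
  - intros t Ht; unfold F; eapply CD_eq.
    + apply CD_mult; [apply CD_line|apply CD_Cexp_linear].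
    + cbv beta; field; easy.
  - intros t Ht; eexists; apply CD_mult; [apply CD_line|apply CD_Cexp_linear]. }
rewrite E; replace 2 with (2 * scal (1 - 0) 1) by (unfold scal; simpl; unfold mult; simpl; ring).
apply (CInt_bound _ (fun _ => 1)); [lra| | |exact (is_RInt_const 0 1 1)].
- intros t Ht; eexists; apply CD_mult; [apply CD_line|apply CD_Cexp_linear].
- intros t Ht; rewrite Cmod_mult, Cmod_Cexp, re_scal_r, re_opp.
  replace (0 + t * - (1))%C with (- t)%C by ring; rewrite Cmod_opp, Cmod_pos_R by lra.
  assert (exp (- Re u * t) <= 1) by (rewrite <- exp_0; apply exp_le_compat; nra).
  pose proof (exp_pos (- Re u * t)); nra.
Qed.

Lemma hat_piece_series (b u : C) : 0 < Re u ->
  is_series (fun n => hat_piece b u (INR (S n)))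
    (hatK u * psum b u + (Cexp (- u) / u - Cexp (- u) * (Cexp u - 1) / (u * u)))%C.
Proof.
intros Hu; pose proof (Re_pos_neq_0 u Hu) as Hnz.
pose proof (psum_series b u Hu) as HP.
pose proof (proj1 (is_series_C_shift _ _) HP) as HP1.
assert (E1 : lap b u (INR 1) = Cexp (- u)).
{ change (INR 1) with 1; unfold lap; rewrite Rcpow_base_1, Cmult_1_l; f_equal; ring. }
cbv beta in HP1; rewrite E1 in HP1.
eapply is_series_C_ext; [| |apply (is_series_C_plus _ _ _ _
  (is_series_C_scal (/ u) _ _ (is_series_C_minus _ _ _ _ HP HP1))
  (is_series_C_scal ((1 - Cexp (- u)) / (u * u)) _ _
    (is_series_C_minus _ _ _ _ (is_series_C_scal (Cexp u) _ _ HP1) HP)))].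
- intros n; cbv beta; unfold hat_piece; rewrite <- S_INR; unfold Cdiv; ring.
- unfold hatK; rewrite Cexp_opp; field; split; first [easy|apply Cexp_neq_0].
Qed.

Lemma CInt_lap_split (b u : C) (N : nat) :
  CInt (lap b u) (/ INR (S (S N))) (INR (S (S N))) =
  (CInt (lap b u) (/ INR (S (S N))) 1
   + sum_n (fun k => CInt (lap b u) (INR (S k)) (INR (S k) + 1)) N)%C.
Proof.
pose proof (INR_S_ge_1 (S N)) as HN.
pose proof (inv_INR_S_bound (S N)) as Hi.
rewrite (CInt_Chasles _ _ 1) by (try apply Cdiff_on_lap; lra).
f_equal; clear Hi HN; induction N as [|N IH].
- rewrite sum_O; change (INR 1) with 1; rewrite (S_INR 1); change (INR 1) with 1; easy.
- rewrite sum_n_C_S, <- IH, <- (S_INR (S (S N))), <- CInt_Chasles; [easy| |].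
  + pose proof (INR_S_ge_1 (S N)); rewrite (S_INR (S (S N))); lra.
  + apply Cdiff_on_lap; lra.
Qed.

(** The piecewise linear interpolant of the power at the integers has a Laplace
    transform that is exactly [hatK u * psum b u], up to the end piece. The error is of
    the order of the sum of [n ^ (Re b - 3) * exp (- n Re u)], hence better by a factor
    [(Re u) ^ kap] than the bound [(Re u) ^ (1 - Re b)] given by a Riemann sum. That gain
    is what makes the errors vanish on average in [lipschitz_formula]. *)
Lemma laplace_psum_error (b : C) : 1 < Re b ->
  exists D kap, 0 <= D /\ 0 < kap /\ 0 <= Re b - 1 - kap /\ forall u, 0 < Re u <= 1 ->
    Cmod (laplace b u - hatK u * psum b u) <= D * Rpower (Re u) (- (Re b - 1 - kap)).
Proof.
intros Hb; set (sg := Re b) in *.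
(* [kap < Re b - 1] keeps [del] positive, and [kap < 1] makes the sum of
   [n ^ (kap - 2)] converge. *)
set (kap := Rmin 1 (sg - 1) / 2).
assert (Hkap : 0 < kap /\ kap <= 1 / 2 /\ kap <= (sg - 1) / 2).
{ unfold kap; pose proof (Rmin_l 1 (sg - 1)); pose proof (Rmin_r 1 (sg - 1)).
  assert (0 < Rmin 1 (sg - 1)) by (apply Rmin_glb_lt; lra). lra. }
set (del := sg - 1 - kap).
assert (Hdel : 0 < del) by (unfold del; lra).
destruct (hat_piece_error b) as (D0 & HD0 & Hpiece); fold sg in Hpiece.
destruct (Rpower_exp_bounded del 1) as (Kd & HKd & Hexp); try lra.
destruct (ex_series_Rpower (2 - kap) ltac:(lra)) as [Z HZ].
assert (HZ0 : 0 <= Z).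
{ eapply Rle_trans; [|apply (sum_n_le_series _ Z 0 (fun k => Rlt_le _ _ (exp_pos _)) HZ)].
  rewrite sum_O; left; apply exp_pos. }
exists (4 + D0 * Kd * Z), kap; repeat split; try lra.
{ pose proof (Rmult_le_pos _ _ (Rmult_le_pos _ _ HD0 (Rlt_le _ _ HKd)) HZ0); lra. }
intros u Hu; fold del; set (x := Re u) in *.
assert (Hxd : 1 <= Rpower x (- del)).
{ rewrite <- (Rpower_O x) by lra; unfold Rpower; apply exp_le_compat.
  assert (ln x <= 0) by (rewrite <- ln_1; apply ln_le; lra); nra. }
assert (Hterm : forall k, Rpower (INR (S k)) (sg - 3) * exp (- x * INR (S k)) <=
  Kd * Rpower x (- del) * Rpower (INR (S k)) (- (2 - kap))).
{ intros k; pose proof (INR_S_ge_1 k).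
  assert (Hxk : 0 < x * INR (S k)) by (apply Rmult_lt_0_compat; lra).
  specialize (Hexp (x * INR (S k)) Hxk).
  rewrite <- Rpower_mult_distr in Hexp by lra.
  replace (sg - 3) with (del + - (2 - kap)) by (unfold del; ring).
  rewrite Rpower_plus, (Rpower_Ropp x del).
  replace (- x * INR (S k)) with (- (1) * (x * INR (S k))) by ring.
  apply Rmult_le_reg_l with (Rpower x del); [apply exp_pos|].
  replace (Rpower x del * (Kd * / Rpower x del * Rpower (INR (S k)) (- (2 - kap)))) with
    (Kd * Rpower (INR (S k)) (- (2 - kap))) by (field; apply Rgt_not_eq, exp_pos).
  match goal with |- ?l <= _ => replace l with ((Rpower x del * Rpower (INR (S k)) del *
    exp (- (1) * (x * INR (S k)))) * Rpower (INR (S k)) (- (2 - kap))) by ring end.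
  apply Rmult_le_compat_r; [left; apply exp_pos|exact Hexp]. }
pose proof (laplace_seq b u (Rlt_le _ _ Hb) (proj1 Hu)) as HL.
apply Clim_incr in HL.
pose proof (hat_piece_series b u (proj1 Hu)) as HH; apply is_series_Clim in HH.
set (endp := (Cexp (- u) / u - Cexp (- u) * (Cexp u - 1) / (u * u))%C) in *.
assert (Hend : Cmod endp <= 2) by exact (hat_end_bound u (proj1 Hu)).
assert (HB : Cmod (laplace b u - (hatK u * psum b u + endp)) <=
  2 + D0 * Kd * Z * Rpower x (- del)).
{ apply (Clim_norm_le _ _ _ (Clim_minus _ _ _ _ HL HH)); intros N.
  rewrite CInt_lap_split.
  pose proof (INR_S_ge_1 (S N)) as HN.
  pose proof (inv_INR_S_bound (S N)) as Hi.
  set (I0 := CInt (lap b u) (/ INR (S (S N))) 1).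
  set (T := sum_n (fun k => CInt (lap b u) (INR (S k)) (INR (S k) + 1)) N).
  set (H := sum_n (fun n => hat_piece b u (INR (S n))) N).
  replace (I0 + T - H)%C with (I0 + (T - H))%C by ring.
  eapply Rle_trans; [apply Cmod_triangle|]; apply Rplus_le_compat.
  - unfold I0; apply Rle_trans with (2 * scal (1 - / INR (S (S N))) 1).
    + apply (CInt_bound _ (fun _ => 1)); [lra|apply Cdiff_on_lap; lra| |
        exact (is_RInt_const _ 1 1)].
      intros t Ht; rewrite Cmod_lap; fold sg x.
      apply Rle_trans with (1 * 1); [|lra].
      apply Rmult_le_compat; try (left; apply exp_pos).
      * unfold Rpower; rewrite <- exp_0 at 2; apply exp_le_compat.
        assert (ln t <= 0) by (rewrite <- ln_1; apply ln_le; lra).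
        assert (0 <= sg - 1) by lra; nra.
      * rewrite <- exp_0; apply exp_le_compat; nra.
    + unfold scal; simpl; unfold mult; simpl; change (2 * ((1 - / INR (S (S N))) * 1) <= 2); lra.
  - replace (T - H)%C with (sum_n (fun k => CInt (lap b u) (INR (S k)) (INR (S k) + 1)
      - hat_piece b u (INR (S k)))%C N).
    2: { unfold T, H; clear; induction N as [|N IH]; [now rewrite !sum_O|].
         rewrite !sum_n_C_S, IH; Cring. }
    eapply Rle_trans; [apply (Cmod_sum_n _ (fun k => D0 * Kd * Rpower x (- del) *
      Rpower (INR (S k)) (- (2 - kap))))|].
    + intros k _; eapply Rle_trans; [apply (Hpiece u (INR (S k)) (proj1 Hu)), INR_S_ge_1|].
      fold x.
      pose proof (Hterm k) as Hk; apply (Rmult_le_compat_l _ _ _ HD0) in Hk; lra.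
    + eapply Rle_trans.
      * right; exact (sum_n_mult_l (K := R_Ring) (D0 * Kd * Rpower x (- del))
          (fun k => Rpower (INR (S k)) (- (2 - kap))) N).
      * replace (D0 * Kd * Z * Rpower x (- del)) with (D0 * Kd * Rpower x (- del) * Z) by ring.
        apply Rmult_le_compat_l.
        -- repeat apply Rmult_le_pos; try lra; left; apply exp_pos.
        -- apply sum_n_le_series; [intros; left; apply exp_pos|easy]. }
replace (laplace b u - hatK u * psum b u)%C with
  (laplace b u - (hatK u * psum b u + endp) + endp)%C by ring.
eapply Rle_trans; [apply Cmod_triangle|].
pose proof (Rmult_le_pos _ _ (Rmult_le_pos _ _ HD0 (Rlt_le _ _ HKd)) HZ0); nra.
Qed.

(** * The Lipschitz summation formula *)

Lemma sin_ge_linear (T t : R) : 0 <= t <= T -> T < PI / 2 -> t * cos T <= sin t.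
Proof.
intros Ht HT; destruct (Req_dec t 0) as [->|Hne]; [rewrite sin_0; lra|].
destruct (MVT_gen sin 0 t cos) as [c [Hc E]]; rewrite ?Rmin_left, ?Rmax_right in * by lra.
- intros x _; apply is_derive_sin.
- intros x _; apply continuity_sin.
- rewrite sin_0, !Rminus_0_r in E; rewrite E.
  assert (cos T <= cos c) by (apply cos_decr_1; lra); nra.
Qed.

(** With [u = x + i y], the square of the modulus of [exp u - 1] is
    [(exp x - 1) ^ 2 + 4 exp x (sin (y / 2)) ^ 2], which is comparable to [|u| ^ 2] as
    long as [|y / 2|] stays away from [PI]. *)
Lemma hatK_lower_bound : exists c, 0 < c /\ forall u, 0 < Re u <= 1 ->
  Rabs (Im u) <= 3 * PI / 2 -> c <= Cmod (hatK u).
Proof.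
pose proof PI_RGT_0 as HPI.
set (c1 := cos (3 * PI / 8)).
assert (Hc1 : 0 < c1) by (apply cos_gt_0; lra).
assert (Hc1' : c1 <= 1) by apply COS_bound.
set (q := c1 * c1 * (c1 * c1)).
assert (Hq : 0 < q <= 1) by (unfold q; split; [repeat apply Rmult_lt_0_compat; easy|];
  assert (0 < c1 * c1 <= 1) by nra; nra).
exists (q * exp (- (1))); split; [apply Rmult_lt_0_compat; [lra|apply exp_pos]|].
intros u Hx Hy; pose proof (Re_pos_neq_0 u (proj1 Hx)) as Hnz.
assert (E : hatK u = ((Cexp u - 1) * (Cexp u - 1) * Cexp (- u) / (u * u))%C).
{ unfold hatK; rewrite Cexp_opp; field; split; first [exact Hnz|apply Cexp_neq_0]. }
set (x := Re u) in *; set (y := Im u) in *.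
assert (Hs : q * (y * y) <= 4 * (sin (y / 2) * sin (y / 2))).
{ set (t := Rabs y / 4).
  assert (Ht : 0 <= t <= 3 * PI / 8) by (unfold t; pose proof (Rabs_pos y); lra).
  assert (Es : sin (y / 2) * sin (y / 2) = sin (2 * t) * sin (2 * t)).
  { unfold t; replace (2 * (Rabs y / 4)) with (Rabs y / 2) by field.
    unfold Rabs; destruct (Rcase_abs y); [|easy].
    replace (- y / 2) with (- (y / 2)) by field; rewrite sin_neg; ring. }
  rewrite Es, sin_2a.
  pose proof (sin_ge_linear (3 * PI / 8) t Ht ltac:(lra)) as Hsin; fold c1 in Hsin.
  assert (Hcos : c1 <= cos t) by (unfold c1; apply cos_decr_1; lra).
  assert (Hyt : y * y = 16 * (t * t)).
  { unfold t; replace (16 * (Rabs y / 4 * (Rabs y / 4))) with (Rabs y * Rabs y) by field.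
    rewrite <- Rabs_mult, Rabs_pos_eq; nra. }
  rewrite Hyt; unfold q.
  assert (H1 : c1 * (t * c1) <= cos t * sin t) by (apply Rmult_le_compat; nra).
  assert (H2 : 0 <= c1 * (t * c1)) by (apply Rmult_le_pos; nra).
  assert (H3 : (c1 * (t * c1)) * (c1 * (t * c1)) <= (cos t * sin t) * (cos t * sin t)) by nra.
  nra. }
assert (Hm : q * (x * x + y * y) <= Cmod (Cexp u - 1) * Cmod (Cexp u - 1)).
{ rewrite Cmod_sqr, Re_minus, Im_minus; unfold Cexp; fold x y; simpl Re; simpl Im.
  set (e := exp x); assert (He : 1 + x <= e) by apply exp_ineq1_le.
  assert (Ec : cos y = 1 - 2 * (sin (y / 2) * sin (y / 2))).
  { replace y with (2 * (y / 2)) at 1 by field; rewrite cos_2a_sin; ring. }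
  pose proof (sin2_cos2 y) as Esc; unfold Rsqr in Esc.
  assert (Ex : (e * cos y - 1) * (e * cos y - 1) + (e * sin y - 0) * (e * sin y - 0) =
    (e - 1) * (e - 1) + 4 * e * (sin (y / 2) * sin (y / 2))).
  { transitivity (e * e * (sin y * sin y + cos y * cos y) - 2 * e * cos y + 1); [ring|].
    rewrite Esc, Ec; ring. }
  rewrite Ex; set (s2 := sin (y / 2) * sin (y / 2)) in *.
  assert (0 <= s2) by (unfold s2; apply Rle_0_sqr).
  assert (x * x <= (e - 1) * (e - 1)) by nra.
  assert (4 * s2 <= 4 * e * s2) by nra.
  assert (q * (x * x) <= x * x) by nra. lra. }
rewrite E, Cmod_div by now apply Cmult_neq_0.
rewrite !Cmod_mult, Cmod_Cexp, re_opp; fold x; rewrite (Cmod_sqr u); fold x y.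
assert (Hxy : 0 < x * x + y * y) by nra.
apply Rmult_le_reg_r with (x * x + y * y); [easy|].
match goal with |- _ <= ?p / ?d * ?d => replace (p / d * d) with p by (field; lra) end.
assert (He : exp (- (1)) <= exp (- x)) by (apply exp_le_compat; lra).
pose proof (exp_pos (- (1))).
replace (q * exp (- (1)) * (x * x + y * y)) with (q * (x * x + y * y) * exp (- (1))) by ring.
apply Rmult_le_compat; try lra.
apply Rmult_le_pos; [lra|]; nra.
Qed.

Lemma Cexp_quotient_limit (rho : R) : 0 < rho -> exists K, forall u, u <> RtoC 0 ->
  Cmod u <= rho -> Cmod ((Cexp u - 1) / u - 1) <= K * Cmod u.
Proof.
intros Hrho; set (a := fun n => RtoC (/ INR (fact (S n)))).
assert (Hs : ex_series (fun n => Cmod (a n) * rho ^ n)).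
{ apply (ex_series_R_le _ (fun n => / INR (fact n) * rho ^ n)).
  - intros n; unfold a; rewrite Cmod_pos_R by (left; apply Rinv_0_lt_compat, INR_fact_lt_0).
    split; [apply Rmult_le_pos; [left; apply Rinv_0_lt_compat, INR_fact_lt_0|apply pow_le; lra]|].
    apply Rmult_le_compat_r; [apply pow_le; lra|].
    apply Rinv_le_contravar; [apply INR_fact_lt_0|apply le_INR, fact_le; lia].
  - exists (exp rho); apply is_pseries_R, is_exp_Reals. }
destruct (pser_continuous_0 a rho Hrho Hs) as [K HK]; exists K; intros u Hu Hur.
replace (RtoC 1) with (a 0%nat) at 2 by (unfold a; simpl; f_equal; field).
apply HK; [easy|].
eapply is_series_C_ext; [| |apply (is_series_C_scal (/ u) _ _
  (proj1 (is_series_C_shift _ _) (is_series_Cexp u)))].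
- intros n; cbv beta; unfold a; rewrite RtoC_inv by apply INR_fact_neq_0; rewrite Cpow_S.
  field; split; [apply RtoC_neq_0, INR_fact_neq_0|easy].
- simpl; field; easy.
Qed.

Lemma hatK_limit (v : C) (M : nat -> R) : v <> RtoC 0 -> (forall N, 1 <= M N) ->
  is_lim_seq (fun N => / M N) 0 -> Clim (fun N => hatK (v / M N)) 1.
Proof.
intros Hv HM Hlim; pose proof (proj1 (Cmod_gt_0 v) Hv) as Hpos.
destruct (Cexp_quotient_limit (Cmod v) Hpos) as [K HK].
assert (HMnz : forall N, RtoC (M N) <> RtoC 0).
{ intros N; apply RtoC_neq_0; specialize (HM N); lra. }
assert (Hmod : forall N, Cmod (v / M N) = Cmod v * / M N).
{ intros N; rewrite Cmod_div, Cmod_pos_R by (auto; specialize (HM N); lra); easy. }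
assert (Hnz : forall N, (v / M N)%C <> RtoC 0).
{ intros N; apply Cmod_gt_0; rewrite Hmod; apply Rmult_lt_0_compat; [easy|].
  apply Rinv_0_lt_compat; specialize (HM N); lra. }
assert (Hle : forall N, Cmod v * / M N <= Cmod v).
{ intros N; specialize (HM N); rewrite <- (Rmult_1_r (Cmod v)) at 2.
  apply Rmult_le_compat_l; [lra|]; rewrite <- Rinv_1; apply Rinv_le_contravar; lra. }
assert (Hq : forall e : C, Cmod e = 1 -> (forall N, (e * (v / M N))%C <> RtoC 0) ->
  Clim (fun N => (Cexp (e * (v / M N)) - 1) / (e * (v / M N)))%C 1).
{ intros e He Hez; apply (Clim_le _ _ (fun N => K * Cmod v * / M N)).
  - intros N; eapply Rle_trans; [apply HK; [apply Hez|]|];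
      rewrite Cmod_mult, He, Rmult_1_l, Hmod; [apply Hle|lra].
  - now apply is_lim_seq_scal_0. }
replace (RtoC 1) with (1 * 1)%C by ring.
apply (Clim_ext (fun N => (Cexp (1 * (v / M N)) - 1) / (1 * (v / M N))
  * ((Cexp (- (1) * (v / M N)) - 1) / (- (1) * (v / M N))))%C).
- intros N; unfold hatK; replace (- (v / M N))%C with (- (1) * (v / M N))%C by ring.
  rewrite Cmult_1_l; set (t := (v / M N)%C); assert (t <> RtoC 0) by apply Hnz.
  field; easy.
- apply Clim_mult; apply Hq; try (rewrite ?Cmod_opp; apply Cmod_1); intros N.
  + rewrite Cmult_1_l; apply Hnz.
  + intros E0; apply (Hnz N); replace (v / M N)%C with (- (- (1) * (v / M N)))%C by ring.
    rewrite E0; ring.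
Qed.

(** The terms of indices [k] and [- k] of a sum over the integers. The index of [f] is a
    real number so that it can be negated and scaled. *)
Definition sterm (f : R -> C) (k : nat) : C :=
  match k with
  | O => f 0
  | S _ => f (INR k) + f (- INR k)%R
  end%C.

Definition symsum (f : R -> C) (N : nat) : C := sum_n (sterm f) N.

Lemma symsum_S (f : R -> C) (N : nat) :
  symsum f (S N) = (symsum f N + (f (INR (S N)) + f (- INR (S N))%R))%C.
Proof. exact (sum_Sn (sterm f) N). Qed.

Lemma symsum_0 (f : R -> C) : symsum f 0 = f 0.
Proof. exact (sum_O (sterm f)). Qed.

Lemma symsum_ext (f g : R -> C) (N : nat) :
  (forall z, Rabs (IZR z) <= INR N -> f (IZR z) = g (IZR z)) -> symsum f N = symsum g N.
Proof.
induction N as [|N IH]; intros H.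
- rewrite !symsum_0; apply (H 0%Z); rewrite Rabs_R0; simpl; lra.
- rewrite !symsum_S, IH.
  + rewrite INR_IZR_INZ, <- opp_IZR, !H; [easy| |].
    * rewrite <- abs_IZR, INR_IZR_INZ; apply IZR_le; lia.
    * rewrite <- abs_IZR, INR_IZR_INZ; apply IZR_le; lia.
  + intros z Hz; apply H; rewrite S_INR; lra.
Qed.

Lemma symsum_scal (c : C) (f : R -> C) (N : nat) :
  symsum (fun j => c * f j)%C N = (c * symsum f N)%C.
Proof.
induction N as [|N IH]; [now rewrite !symsum_0|].
rewrite !symsum_S, IH; ring.
Qed.

Lemma symsum_minus (f g : R -> C) (N : nat) :
  symsum (fun j => f j - g j)%C N = (symsum f N - symsum g N)%C.
Proof.
induction N as [|N IH]; [now rewrite !symsum_0|].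
rewrite !symsum_S, IH; ring.
Qed.

Lemma symsum_series (a : nat -> R -> C) (l : R -> C) (N : nat) :
  (forall j, is_series (fun n => a n j) (l j)) ->
  is_series (fun n => symsum (a n) N) (symsum l N).
Proof.
intros H; apply is_series_C_sum_n; intros [|k]; [apply H|].
apply is_series_C_plus; apply H.
Qed.

Lemma symsum_bound (f : R -> C) (B : R) (N : nat) :
  (forall z, Rabs (IZR z) <= INR N -> Cmod (f (IZR z)) <= B) ->
  Cmod (symsum f N) <= INR (2 * N + 1) * B.
Proof.
induction N as [|N IH]; intros H.
- rewrite symsum_0; simpl INR; rewrite Rmult_1_l; apply (H 0%Z).
  rewrite Rabs_R0; simpl; lra.
- rewrite symsum_S.
  assert (H1 : Cmod (symsum f N) <= INR (2 * N + 1) * B).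
  { apply IH; intros z Hz; apply H; rewrite S_INR; lra. }
  assert (H2 : Cmod (f (INR (S N))) <= B).
  { rewrite INR_IZR_INZ; apply H; rewrite <- abs_IZR, INR_IZR_INZ; apply IZR_le; lia. }
  assert (H3 : Cmod (f (- INR (S N))) <= B).
  { rewrite INR_IZR_INZ, <- opp_IZR; apply H; rewrite <- abs_IZR, INR_IZR_INZ.
    apply IZR_le; lia. }
  pose proof (Cmod_triangle (symsum f N) (f (INR (S N)) + f (- INR (S N))%R)).
  pose proof (Cmod_triangle (f (INR (S N))) (f (- INR (S N))%R)).
  replace (INR (2 * S N + 1)) with (INR (2 * N + 1) + 2); [lra|].
  rewrite !plus_INR, !mult_INR, (S_INR N); simpl; ring.
Qed.

Lemma root_of_unity_period (m : nat) (z : Z) :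
  root_of_unity (S m) (INR (S m) * IZR z) = RtoC 1.
Proof.
unfold root_of_unity; rewrite <- (Cexp_2PI_Z z); do 3 f_equal.
field; apply not_0_INR; lia.
Qed.

Lemma symsum_root_telescope (K N : nat) (d : R) :
  ((root_of_unity K d - 1) * symsum (fun j => root_of_unity K (d * j)) N)%C =
  (root_of_unity K (d * (INR N + 1)) - root_of_unity K (- (d * INR N)))%C.
Proof.
induction N as [|N IH].
- rewrite symsum_0; simpl INR; rewrite !Rmult_0_r, Rplus_0_l, Rmult_1_r, Ropp_0.
  rewrite root_of_unity_0; ring.
- rewrite symsum_S, Cmult_plus_distr_l, IH, S_INR.
  replace (root_of_unity K (d * (INR N + 1 + 1))) with
    (root_of_unity K d * root_of_unity K (d * (INR N + 1)))%C
    by (rewrite root_of_unity_plus; f_equal; ring).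
  replace (root_of_unity K (- (d * INR N))) with
    (root_of_unity K d * root_of_unity K (d * - (INR N + 1)))%C
    by (rewrite root_of_unity_plus; f_equal; ring).
  replace (- (d * (INR N + 1))) with (d * - (INR N + 1)) by ring.
  ring.
Qed.

(** Averages over the [2 N + 1]-st roots of unity select the multiples of [2 N + 1]. *)
Lemma symsum_root_filter (N n : nat) :
  symsum (fun j => root_of_unity (S (2 * N)) (- INR n * j)) N =
  if Nat.eq_dec (n mod S (2 * N)) 0 then RtoC (INR (S (2 * N))) else RtoC 0.
Proof.
set (m := (2 * N)%nat).
pose proof (Nat.div_mod_eq n (S m)) as Hn.
pose proof (Nat.mod_upper_bound n (S m) ltac:(lia)) as Hr.
set (q := (n / S m)%nat) in *; set (r := (n mod S m)%nat) in *.
assert (HnR : INR n = INR (S m) * INR q + INR r) by (rewrite Hn, plus_INR, mult_INR; easy).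
destruct (Nat.eq_dec r 0) as [E|E].
- rewrite (symsum_ext _ (fun _ => RtoC 1)).
  + unfold m; clear; induction N as [|N IH]; [now rewrite symsum_0|].
    rewrite symsum_S, IH, <- !RtoC_plus; f_equal.
    rewrite !S_INR, !mult_INR, !S_INR; simpl; ring.
  + intros z _; rewrite <- (root_of_unity_period m (- Z.of_nat q * z)); f_equal.
    rewrite HnR, E, mult_IZR, opp_IZR, <- INR_IZR_INZ; simpl (INR 0); ring.
- pose proof (symsum_root_telescope (S m) N (- INR n)) as T.
  replace (root_of_unity (S m) (- INR n * (INR N + 1))) with
    (root_of_unity (S m) (- (- INR n * INR N))) in T.
  2: { rewrite <- (Cmult_1_r (root_of_unity (S m) (- INR n * (INR N + 1)))).
       rewrite <- (root_of_unity_period m (Z.of_nat n)), root_of_unity_plus; f_equal.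
       rewrite <- INR_IZR_INZ; unfold m; rewrite S_INR, mult_INR; simpl; ring. }
  assert (Hq : root_of_unity (S m) (- INR n) <> RtoC 1).
  { replace (- INR n) with (INR (S m) * IZR (- Z.of_nat q) + - INR r)
      by (rewrite HnR, opp_IZR, <- INR_IZR_INZ; ring).
    rewrite <- root_of_unity_plus, root_of_unity_period, Cmult_1_l.
    apply root_of_unity_neq_1.
    - assert (0 < INR r) by (apply lt_0_INR; lia); lra.
    - rewrite Rabs_Ropp, Rabs_pos_eq by apply pos_INR; now apply lt_INR. }
  set (S0 := symsum _ N) in *; set (q0 := root_of_unity (S m) (- INR n)) in *.
  replace S0 with ((q0 - 1) * S0 / (q0 - 1))%C by (field; now apply Cminus_eq_contra).
  rewrite T; field; now apply Cminus_eq_contra.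
Qed.

Definition shifted (w : C) (j : R) : C := (w + Ci * RtoC (2 * PI * j))%C.

Definition avg_point (w : C) (N : nat) (j : R) : C :=
  (shifted w j / RtoC (INR (S (2 * N))))%C.

Lemma Re_shifted (w : C) (j : R) : Re (shifted w j) = Re w.
Proof. unfold shifted, Re, Im; simpl; ring. Qed.

Lemma Im_shifted (w : C) (j : R) : Im (shifted w j) = Im w + 2 * PI * j.
Proof. unfold shifted, Re, Im; simpl; ring. Qed.

Lemma Cdiv_R_l (v : C) (M : R) : M <> 0 -> (v / RtoC M)%C = (RtoC (/ M) * v)%C.
Proof. intros HM; rewrite RtoC_inv by easy; unfold Cdiv; ring. Qed.

Lemma Re_avg_point (w : C) (N : nat) (j : R) :
  Re (avg_point w N j) = / INR (S (2 * N)) * Re w.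
Proof.
unfold avg_point; rewrite Cdiv_R_l by (apply not_0_INR; lia).
now rewrite re_scal_l, Re_shifted.
Qed.

(** The sum of [exp (- n (w + 2 PI i j) / M)] over the [M = 2 N + 1] values of [j] is
    [M * exp (- n w / M)] if [M] divides [n], and 0 otherwise. The terms [n = M m] that
    remain are those of [psum b w], each multiplied by [M ^ b]. *)
Lemma psum_average (b w : C) (N : nat) : 0 < Re w ->
  (Rcpow (INR (S (2 * N))) b * psum b w)%C = symsum (fun j => psum b (avg_point w N j)) N.
Proof.
intros Hw; set (m := (2 * N)%nat); set (M := INR (S m)).
assert (HM : 0 < M) by (apply lt_0_INR; lia).
assert (HMz : RtoC M <> RtoC 0) by (apply RtoC_neq_0; lra).
assert (H1 : is_series (fun n => symsum (fun j => lap b (avg_point w N j) (INR (S n))) N)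
  (symsum (fun j => psum b (avg_point w N j)) N)).
{ apply (symsum_series (fun n j => lap b (avg_point w N j) (INR (S n)))
    (fun j => psum b (avg_point w N j))).
  intros j; apply psum_series; rewrite Re_avg_point.
  apply Rmult_lt_0_compat; [now apply Rinv_0_lt_compat|easy]. }
assert (E : forall n, symsum (fun j => lap b (avg_point w N j) (INR (S n))) N =
  (lap b (w / M) (INR (S n)) *
    if Nat.eq_dec (S n mod S m) 0 then RtoC M else RtoC 0)%C).
{ intros n; unfold M, m; rewrite <- symsum_root_filter, <- symsum_scal; f_equal.
  apply FunctionalExtensionality.functional_extensionality; intros j.
  unfold lap, root_of_unity; rewrite <- Cmult_assoc, <- Cexp_plus; do 2 f_equal.
  unfold avg_point, shifted; fold m M.
  replace (2 * PI * (- INR (S n) * j) / M) with (- (2 * PI * j * INR (S n)) * / M)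
    by (field; lra).
  rewrite !RtoC_mult, RtoC_inv, RtoC_opp, !RtoC_mult by lra; field; easy. }
assert (H2 : is_series (fun k => lap b (w / M) (INR (S (S m * k + m))) * M)%C
  (symsum (fun j => psum b (avg_point w N j)) N)).
{ eapply is_series_C_ext; [|reflexivity|
    apply (series_decimate (fun n => symsum (fun j => lap b (avg_point w N j) (INR (S n))) N)
      m _); [|exact H1]].
  - intros k; cbv beta; rewrite E.
    replace (S (S m * k + m)) with (0 + (S k) * S m)%nat by lia.
    rewrite Nat.Div0.mod_add, Nat.Div0.mod_0_l; destruct (Nat.eq_dec 0 0); easy.
  - intros n Hn; cbv beta; rewrite E; destruct (Nat.eq_dec (S n mod S m) 0); [easy|ring]. }
refine (is_series_C_unique _ _ _ _ H2).
eapply is_series_C_ext; [|reflexivity|apply (is_series_C_scal (Rcpow M b) _ _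
  (psum_series b w Hw))].
intros k; cbv beta.
replace (S (S m * k + m)) with (S m * S k)%nat by lia.
rewrite mult_INR; fold M; unfold lap.
rewrite Rcpow_mult by (try apply lt_0_INR; lia || lra).
replace (Rcpow M b) with (Rcpow M (b - 1) * M)%C.
2: { rewrite <- (Rcpow_1 M HM) at 1; rewrite <- Rcpow_plus; f_equal; ring. }
replace (- (w / M) * (M * INR (S k))%R)%C with (- w * INR (S k))%C
  by (rewrite RtoC_mult; field; easy).
ring.
Qed.

Lemma Cpw_div_R (v s : C) (M : R) : 0 < M -> v <> RtoC 0 ->
  Cpw (v / M) s = (Rcpow M (- s) * Cpw v s)%C.
Proof.
intros HM Hv; unfold Cpw, Rcpow; rewrite <- Cexp_plus; f_equal.
replace (Clog (v / M)) with (Clog v - ln M)%C; [ring|].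
unfold Clog; rewrite Cdiv_R_l by lra.
pose proof (proj1 (Cmod_gt_0 v) Hv) as Hm.
assert (Hi : 0 < / M) by now apply Rinv_0_lt_compat.
apply C_eq.
- rewrite Re_minus; simpl Re; rewrite Cmod_mult, Cmod_pos_R, ln_mult, ln_Rinv by lra; lra.
- rewrite Im_minus; symmetry.
  change (atan (Im (RtoC (/ M) * v) / Re (RtoC (/ M) * v)) = atan (Im v / Re v) - 0).
  rewrite re_scal_l, im_scal_l, Rminus_0_r; f_equal.
  unfold Rdiv; rewrite Rinv_mult, Rinv_inv; generalize (/ Re v); intros r; field; lra.
Qed.

Lemma Cmod_Cpw_le (v b : C) : v <> RtoC 0 ->
  Cmod (Cpw v (- b)) <= exp (2 * Cmod b) * Rpower (Cmod v) (- Re b).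
Proof.
intros Hv; rewrite Cmod_Cpw, re_opp, im_opp; unfold Rpower; rewrite <- exp_plus.
apply exp_le_compat.
pose proof (Im_Clog_bound v) as HI; pose proof PI_4 as HP.
pose proof (im_le_Cmod b) as Hb; apply Rabs_le_between in Hb.
pose proof (Cmod_ge_0 b).
assert (Im b * Im (Clog v) <= 2 * Cmod b) by nra. lra.
Qed.

Lemma Cmod_shifted_ge (w : C) (j : R) : Cmod w < 2 * PI -> 1 <= Rabs j ->
  (2 * PI - Cmod w) * Rabs j <= Cmod (shifted w j).
Proof.
intros Hw Hj; unfold shifted; rewrite Cplus_comm.
pose proof (Cmod_triangle_rev (Ci * RtoC (2 * PI * j)) w) as H.
rewrite Cmod_mult, Cmod_Ci, Cmod_R, Rabs_mult, (Rabs_pos_eq (2 * PI)) in H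
  by (pose proof PI_RGT_0; lra).
pose proof (Cmod_ge_0 w); nra.
Qed.

Lemma Clim_ext_loc (u v : nat -> C) (l : C) (N0 : nat) :
  (forall n, (N0 <= n)%nat -> u n = v n) -> Clim u l -> Clim v l.
Proof.
intros H; apply is_lim_seq_ext_loc; exists N0; intros n Hn; now rewrite H.
Qed.

Lemma Clim_inv_1 (u : nat -> C) (c : R) (N0 : nat) : 0 < c ->
  (forall n, (N0 <= n)%nat -> c <= Cmod (u n)) ->
  Clim u 1 -> Clim (fun n => / u n)%C 1.
Proof.
intros Hc Hu Hl.
apply (is_lim_seq_le_le_loc (fun _ => 0) _ (fun n => / c * Cmod (u n - 1))).
- exists N0; intros n Hn; specialize (Hu n Hn); split; [apply Cmod_ge_0|].
  assert (Hnz : u n <> RtoC 0) by (apply Cmod_gt_0; lra).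
  replace (/ u n - 1)%C with (- (u n - 1) / u n)%C by (field; easy).
  rewrite Cmod_div, Cmod_opp by easy; unfold Rdiv; rewrite Rmult_comm.
  apply Rmult_le_compat_r; [apply Cmod_ge_0|apply Rinv_le_contravar; lra].
- apply is_lim_seq_const.
- now apply is_lim_seq_scal_0.
Qed.

Lemma is_series_finite_support (a : nat -> C) (N : nat) :
  (forall k, (N < k)%nat -> a k = RtoC 0) -> is_series a (sum_n a N).
Proof.
intros H; apply is_series_Clim.
apply (Clim_ext_loc (fun _ => sum_n a N) _ _ N); [|apply Clim_const].
intros n Hn; induction Hn as [|n Hn IH]; [easy|].
rewrite sum_n_C_S, <- IH, H by lia; symmetry; apply Cplus_0_r.
Qed.

(** The formula follows from the exact identity [psum_average] by letting the number
    of roots of unity tend to infinity: at the points [(w + 2 PI i j) / M] close to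
    0 or to the imaginary axis, [psum] is the Laplace transform divided by [hatK], up
    to an error which is small on average. *)
Lemma lipschitz_formula (b w : C) : 1 < Re b -> 0 < Re w -> Cmod w < 2 * PI ->
  exists l : C, is_series (sterm (fun j => Cpw (shifted w j) (- b))) l /\
    psum b w = (Gamma b * l)%C.
Proof.
intros Hb Hw Hw2; pose proof PI_RGT_0 as HPI; pose proof PI_4 as HP4.
destruct (laplace_psum_error b Hb) as (D & kap & HD & Hkap & Hdel & Herr).
destruct hatK_lower_bound as (c & Hc & HK).
set (del := Re b - 1 - kap) in *.
(* From [N + 4] on the points lie in the region of [hatK_lower_bound]: [M] is at
   least 9, and [|w| < 2 PI <= 8]. *)
set (M := fun N => INR (S (2 * (N + 4)))).
assert (HM : forall N, 9 <= M N).
{ intros N; unfold M; replace 9 with (INR 9) by (simpl; ring); apply le_INR; lia. }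
assert (HMS : forall N, INR (S N) <= M N) by (intros N; apply le_INR; lia).
assert (HRw : Re w <= 8).
{ pose proof (re_le_Cmod w) as H; apply Rabs_le_between in H; lra. }
assert (HIw : Rabs (Im w) < 2 * PI) by (pose proof (im_le_Cmod w); lra).
set (G := fun j => Cpw (shifted w j) (- b)).
set (pt := fun N j => avg_point w (N + 4) j).
assert (Hsnz : forall j, shifted w j <> RtoC 0).
{ intros j; apply Re_pos_neq_0; now rewrite Re_shifted. }
assert (HRe : forall N j, Re (pt N j) = / M N * Re w) by (intros; apply Re_avg_point).
assert (HRe1 : forall N j, 0 < Re (pt N j) <= 1).
{ intros N j; rewrite HRe; specialize (HM N); split.
  - apply Rmult_lt_0_compat; [apply Rinv_0_lt_compat|]; lra.
  - apply Rmult_le_reg_l with (M N); [lra|].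
    rewrite <- Rmult_assoc, Rinv_r; lra. }
assert (HIm : forall N j, Rabs j <= INR (N + 4) -> Rabs (Im (pt N j)) <= 3 * PI / 2).
{ intros N j Hj; unfold pt, avg_point; fold (M N); rewrite Cdiv_R_l by (specialize (HM N); lra).
  rewrite im_scal_l, Im_shifted, Rabs_mult, Rabs_pos_eq.
  2: { left; apply Rinv_0_lt_compat; specialize (HM N); lra. }
  assert (H1 : Rabs (Im w + 2 * PI * j) <= 2 * PI + 2 * PI * INR (N + 4)).
  { eapply Rle_trans; [apply Rabs_triang|].
    rewrite (Rabs_mult (2 * PI)), (Rabs_pos_eq (2 * PI)) by lra.
    apply Rplus_le_compat; [lra|apply Rmult_le_compat_l; lra]. }
  apply Rmult_le_reg_l with (M N); [specialize (HM N); lra|].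
  rewrite <- Rmult_assoc, Rinv_r, Rmult_1_l by (specialize (HM N); lra).
  eapply Rle_trans; [exact H1|].
  assert (EM : M N = 2 * INR (N + 4) + 1).
  { unfold M; rewrite S_INR, mult_INR; simpl (INR 2); ring. }
  rewrite EM; assert (4 <= INR (N + 4)) by (rewrite plus_INR; simpl; pose proof (pos_INR N); lra).
  nra. }
assert (HKpt : forall N j, Rabs j <= INR (N + 4) -> c <= Cmod (hatK (pt N j))).
{ intros N j Hj; apply HK; [apply HRe1|now apply HIm]. }
set (kinv := fun N j => (/ hatK (pt N j))%C).
assert (Hkinv : forall N j, Rabs j <= INR (N + 4) -> Cmod (kinv N j) <= / c).
{ intros N j Hj; pose proof (HKpt N j Hj) as H; unfold kinv.
  rewrite Cmod_inv by (apply Cmod_gt_0; lra); apply Rinv_le_contravar; lra. }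
set (err := fun N j => (laplace b (pt N j) - hatK (pt N j) * psum b (pt N j))%C).
(* [psum_average], with [psum] replaced by the Laplace transform over [hatK] *)
assert (Hsplit : forall N, psum b w = (Gamma b * symsum (fun j => G j * kinv N j) (N + 4)
  - Rcpow (M N) (- b) * symsum (fun j => err N j * kinv N j) (N + 4))%C).
{ intros N; assert (HMN : 0 < M N) by (specialize (HM N); lra).
  assert (H1 : symsum (fun j => psum b (pt N j)) (N + 4) =
    symsum (fun j => (Gamma b * Rcpow (M N) b) * (G j * kinv N j) - err N j * kinv N j)%C (N + 4)).
  { apply symsum_ext; intros z Hz; unfold err.
    rewrite laplace_Gamma by (try apply HRe1; lra).
    replace (Cpw (pt N (IZR z)) (- b)) with (Rcpow (M N) b * G (IZR z))%C.
    2: { unfold G, pt, avg_point; fold (M N); rewrite Cpw_div_R by easy.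
         do 2 f_equal; ring. }
    assert (Hnz : hatK (pt N (IZR z)) <> RtoC 0).
    { apply Cmod_gt_0; pose proof (HKpt N (IZR z) Hz); lra. }
    unfold kinv; field; easy. }
  rewrite (symsum_minus (fun j => (Gamma b * Rcpow (M N) b) * (G j * kinv N j))%C
    (fun j => err N j * kinv N j)%C), symsum_scal in H1.
  pose proof (psum_average b w (N + 4) Hw) as H2; fold (M N) in H2.
  unfold pt in H1 at 1; rewrite H1 in H2.
  rewrite Rcpow_opp.
  assert (Hnz : Rcpow (M N) b <> RtoC 0) by apply Rcpow_neq_0.
  replace (psum b w) with (/ Rcpow (M N) b * (Rcpow (M N) b * psum b w))%C by (field; easy).
  rewrite H2; field; easy. }
(* [2 N + 9] errors of order [M ^ del], multiplied by [M ^ (- Re b)], where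
   [1 + del - Re b = - kap] *)
assert (Herr0 : Clim (fun N => Rcpow (M N) (- b)
  * symsum (fun j => err N j * kinv N j) (N + 4))%C 0).
{ set (A := D * Rpower (Re w) (- del) * / c).
  assert (HA : 0 <= A).
  { unfold A; repeat apply Rmult_le_pos; [easy|left; apply exp_pos|].
    left; now apply Rinv_0_lt_compat. }
  pose proof (Rcpow_INR_lim_0 (RtoC (- kap)) ltac:(simpl; lra)) as Hl.
  apply (Clim_le _ _ (fun N => A * Cmod (Rcpow (INR (S N)) (RtoC (- kap)) - 0))).
  - intros N; pose proof (HM N) as HMN.
    replace (Rcpow (INR (S N)) (RtoC (- kap)) - 0)%C with (Rcpow (INR (S N)) (RtoC (- kap)))
      by ring.
    cbv beta; match goal with |- Cmod (?e - _) <= _ => replace (e - 0)%C with e by ring end.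
    rewrite Cmod_mult, !Cmod_Rcpow, re_opp, re_RtoC.
    apply Rle_trans with (Rpower (M N) (- Re b) *
      (M N * (D * Rpower (/ M N * Re w) (- del) * / c))).
    + apply Rmult_le_compat_l; [left; apply exp_pos|].
      replace (M N) with (INR (2 * (N + 4) + 1)) at 1 by (unfold M; f_equal; lia).
      apply symsum_bound; intros z Hz; rewrite Cmod_mult.
      apply Rmult_le_compat; try apply Cmod_ge_0; [|now apply Hkinv].
      rewrite <- (HRe N (IZR z)); apply Herr, HRe1.
    + rewrite <- Rpower_mult_distr by (try apply Rinv_0_lt_compat; lra).
      assert (Ei : Rpower (/ M N) (- del) = Rpower (M N) del).
      { unfold Rpower; rewrite ln_Rinv by lra; f_equal; ring. }
      rewrite Ei.
      replace (Rpower (M N) (- Re b) * (M N * (D * (Rpower (M N) del *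
        Rpower (Re w) (- del)) * / c))) with
        (A * (Rpower (M N) (- Re b) * Rpower (M N) 1 * Rpower (M N) del))
        by (rewrite Rpower_1 by lra; unfold A; ring).
      rewrite <- !Rpower_plus.
      replace (- Re b + 1 + del) with (- kap) by (unfold del; ring).
      apply Rmult_le_compat_l; [easy|]; apply Rpower_le_neg; [lra|].
      split; [apply lt_0_INR; lia|apply HMS].
  - apply is_lim_seq_scal_0, Hl. }
set (F := fun N k => if le_lt_dec k (N + 4) then sterm (fun j => (G j * kinv N j)%C) k
  else RtoC 0).
set (g := fun k => match k with
  | O => Cmod (G 0)
  | S _ => exp (2 * Cmod b) * Rpower ((2 * PI - Cmod w) * INR k) (- Re b)
  end).
assert (HGk : forall k j, Rabs j = INR k -> j = INR k \/ j = - INR k -> Cmod (G j) <= g k).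
{ intros [|k] j Hj Hj'.
  - simpl in Hj'; replace j with 0 by (destruct Hj'; lra); simpl; lra.
  - unfold g, G; eapply Rle_trans; [apply Cmod_Cpw_le, Hsnz|].
    apply Rmult_le_compat_l; [left; apply exp_pos|]; apply Rpower_le_neg; [lra|].
    pose proof (INR_S_ge_1 k); split; [apply Rmult_lt_0_compat; lra|].
    rewrite <- Hj; apply Cmod_shifted_ge; lra. }
assert (Hg0 : forall k, 0 <= g k).
{ intros [|k]; unfold g; [apply Cmod_ge_0|].
  apply Rmult_le_pos; left; apply exp_pos. }
assert (Hci : 0 < / c) by now apply Rinv_0_lt_compat.
destruct (tannery F (sterm G) (fun N => symsum (fun j => G j * kinv N j)%C (N + 4))
  (fun k => 2 * / c * g k)) as (l & Hl & HSl).
- intros N k; unfold F; destruct (le_lt_dec k (N + 4)) as [Hk|Hk].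
  2: { rewrite Cmod_0; apply Rmult_le_pos; [lra|apply Hg0]. }
  apply le_INR in Hk; pose proof (pos_INR k) as Hk0.
  assert (Hj : forall j, Rabs j = INR k -> j = INR k \/ j = - INR k ->
    Cmod (G j * kinv N j) <= / c * g k).
  { intros j Hj Hj'; rewrite Cmod_mult, Rmult_comm.
    apply Rmult_le_compat; try apply Cmod_ge_0; [apply Hkinv; lra|now apply HGk]. }
  assert (Hgk : 0 <= / c * g k) by (apply Rmult_le_pos; [lra|apply Hg0]).
  destruct k as [|k]; unfold sterm.
  + eapply Rle_trans; [apply (Hj 0); [rewrite Rabs_R0; easy|now left]|lra].
  + eapply Rle_trans; [apply Cmod_triangle|].
    pose proof (Hj (INR (S k)) (Rabs_pos_eq _ Hk0) (or_introl eq_refl)).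
    pose proof (Hj (- INR (S k)) (eq_trans (Rabs_Ropp _) (Rabs_pos_eq _ Hk0)) (or_intror eq_refl)).
    lra.
- apply (ex_series_scal_l (2 * / c) g), ex_series_incr_1.
  apply (ex_series_ext (fun k => exp (2 * Cmod b) * Rpower (2 * PI - Cmod w) (- Re b)
    * Rpower (INR (S k)) (- Re b))).
  + intros k; unfold g; rewrite <- Rpower_mult_distr; [apply Rmult_assoc|lra|apply lt_0_INR; lia].
  + apply (ex_series_scal_l (exp (2 * Cmod b) * Rpower (2 * PI - Cmod w) (- Re b))
      (fun k => Rpower (INR (S k)) (- Re b))).
    now apply ex_series_Rpower.
- assert (Hlim : forall j k, Rabs j = INR k -> Clim (fun N => G j * kinv N j)%C (G j)).
  { intros j k Hj; enough (H1 : Clim (fun N => G j * kinv N j)%C (G j * 1)%C) by now rewrite Cmult_1_r in H1.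
    apply Clim_scal.
    apply (Clim_inv_1 _ c k Hc).
    - intros N HN; apply HKpt; rewrite Hj; apply le_INR; lia.
    - apply (hatK_limit (shifted w j) M); [apply Hsnz|intros N; specialize (HM N); lra|].
      apply (is_lim_seq_le_le (fun _ => 0) _ (fun N => / INR (S N)));
        [|apply is_lim_seq_const|apply is_lim_seq_inv_S].
      intros N; pose proof (HM N); pose proof (INR_S_ge_1 N); split.
      + left; apply Rinv_0_lt_compat; lra.
      + apply Rinv_le_contravar; [lra|apply HMS]. }
  intros k; apply (Clim_ext_loc (fun N => sterm (fun j => (G j * kinv N j)%C) k) _ _ k).
  { intros N HN; unfold F; destruct (le_lt_dec k (N + 4)); [easy|lia]. }
  destruct k as [|k]; unfold sterm.
  + apply (Hlim 0 0%nat); rewrite Rabs_R0; easy.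
  + apply Clim_plus; apply (Hlim _ (S k)); rewrite ?Rabs_Ropp; apply Rabs_pos_eq, pos_INR.
- intros N; unfold symsum.
  rewrite (sum_n_ext_loc _ (F N)).
  + apply is_series_finite_support; intros k Hk; unfold F.
    destruct (le_lt_dec k (N + 4)); [lia|easy].
  + intros k Hk; unfold F; destruct (le_lt_dec k (N + 4)); [easy|lia].
- exists l; split; [exact Hl|].
  apply (Clim_unique (fun _ => psum b w)); [apply Clim_const|].
  apply (Clim_ext _ _ _ (fun N => eq_sym (Hsplit N))).
  replace (Gamma b * l)%C with (Gamma b * l - 0)%C by ring.
  apply Clim_minus; [now apply Clim_scal|exact Herr0].
Qed.

(** * Expansion at 0 and the values of zeta to the left of 0 *)

(** The principal logarithm of [2 PI i j] for real [j <> 0]. *)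
Definition ilog (j : R) : C :=
  (ln (2 * PI * Rabs j), if Rlt_dec 0 j then PI / 2 else - (PI / 2)).

Definition ipw (j : R) (s : C) : C := Cexp (s * ilog j).

Lemma Cexp_ilog (j : R) : j <> 0 -> Cexp (ilog j) = (Ci * RtoC (2 * PI * j))%C.
Proof.
intros Hj; pose proof PI_RGT_0 as HPI; pose proof (Rabs_pos_lt j Hj) as Ha.
unfold Cexp, ilog; simpl Re; simpl Im.
rewrite exp_ln by (apply Rmult_lt_0_compat; lra).
destruct (Rlt_dec 0 j) as [H|H].
- rewrite cos_PI2, sin_PI2, Rabs_pos_eq by lra; apply C_eq; simpl; ring.
- rewrite cos_neg, sin_neg, cos_PI2, sin_PI2, Rabs_left1 by lra; apply C_eq; simpl; ring.
Qed.

Lemma Im_ilog_bound (j : R) : - (PI / 2) <= Im (ilog j) <= PI / 2.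
Proof.
pose proof PI_RGT_0; unfold ilog; simpl; destruct (Rlt_dec 0 j); lra.
Qed.

Lemma Cmod_ipw (j : R) (b : C) (m : nat) : 1 <= Rabs j ->
  Cmod (ipw j (- (b + INR m))) <=
  exp (2 * Cmod b) * Rpower (2 * PI * Rabs j) (- Re b) * (/ (2 * PI)) ^ m.
Proof.
intros Hj; pose proof PI_RGT_0 as HPI; pose proof PI_4 as HP4.
set (X := 2 * PI * Rabs j).
assert (HX : 2 * PI <= X) by (unfold X; nra).
assert (Hm : (/ (2 * PI)) ^ m = exp (- INR m * ln (2 * PI))).
{ induction m as [|m IH]; [simpl; rewrite Ropp_0, Rmult_0_l, exp_0; easy|].
  rewrite <- tech_pow_Rmult, IH, S_INR, <- (exp_ln (/ (2 * PI))), <- exp_plus, ln_Rinv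
    by (try apply Rinv_0_lt_compat; lra).
  f_equal; ring. }
rewrite Hm; unfold ipw, Rpower; rewrite Cmod_Cexp, re_mult, re_opp, im_opp, re_plus, im_plus.
rewrite re_RtoC, im_RtoC, Rplus_0_r, <- !exp_plus; apply exp_le_compat.
change (Re (ilog j)) with (ln X).
pose proof (Im_ilog_bound j) as HI; pose proof (Cmod_ge_0 b).
pose proof (im_le_Cmod b) as Hb; apply Rabs_le_between in Hb.
assert (Im b * Im (ilog j) <= 2 * Cmod b) by nra.
assert (ln (2 * PI) <= ln X) by (apply ln_le; lra).
assert (INR m * ln (2 * PI) <= INR m * ln X) by (apply Rmult_le_compat_l; [apply pos_INR|easy]).
lra.
Qed.

Lemma ipw_shift (j : R) (b : C) (m : nat) : j <> 0 ->
  ipw j (- (b + INR m)) = (ipw j (- b) * (/ (Ci * RtoC (2 * PI * j))) ^ m)%C.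
Proof.
intros Hj; rewrite <- Cexp_ilog, <- Cexp_opp, <- Cexp_nat by easy.
unfold ipw; rewrite <- Cexp_plus; f_equal; ring.
Qed.

(** Binomial expansion of [(w + 2 PI i j) ^ (- b)] in powers of [w]. The logarithm of
    the product [2 PI i j * (1 + w / (2 PI i j))] is the sum of the logarithms because
    the three imaginary parts are at most [PI / 2]. *)
Lemma shifted_expansion (b w : C) (j : R) : 0 < Re w -> Cmod w < 2 * PI -> 1 <= Rabs j ->
  is_series (fun m => binc (- b) m * w ^ m * ipw j (- (b + INR m)))%C (Cpw (shifted w j) (- b)).
Proof.
intros Hw Hw2 Hj; pose proof PI_RGT_0 as HPI.
assert (Hj0 : j <> 0) by (intros ->; rewrite Rabs_R0 in Hj; lra).
set (v0 := (Ci * RtoC (2 * PI * j))%C).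
assert (Hv : Cmod v0 = 2 * PI * Rabs j).
{ unfold v0; rewrite Cmod_mult, Cmod_Ci, Cmod_R, Rabs_mult, (Rabs_pos_eq (2 * PI)); lra. }
assert (Hv0 : v0 <> RtoC 0) by (apply Cmod_gt_0; nra).
assert (Ht : Cmod (w / v0) < 1).
{ rewrite Cmod_div by easy; apply Rmult_lt_reg_r with (Cmod v0); [nra|].
  replace (Cmod w / Cmod v0 * Cmod v0) with (Cmod w) by (field; nra); nra. }
assert (Hre : 0 < Re (1 + w / v0)).
{ rewrite re_plus, re_RtoC; pose proof (re_le_Cmod (w / v0)) as H.
  apply Rabs_le_between in H; lra. }
assert (Hlog : Clog (shifted w j) = (ilog j + Clog (1 + w / v0))%C).
{ apply Cexp_inj.
  - rewrite Cexp_plus, Cexp_ilog, !Cexp_Clog by (try rewrite Re_shifted; easy).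
    unfold shifted; fold v0; field; easy.
  - rewrite im_plus.
    pose proof (Im_Clog_bound (shifted w j)); pose proof (Im_ilog_bound j).
    pose proof (Im_Clog_bound (1 + w / v0)); apply Rabs_def1; lra. }
assert (E : Cpw (shifted w j) (- b) = (ipw j (- b) * Cpw (1 + w / v0) (- b))%C).
{ unfold Cpw, ipw; rewrite Hlog, <- Cexp_plus; f_equal; ring. }
rewrite E; eapply is_series_C_ext; [|reflexivity|
  apply (is_series_C_scal (ipw j (- b)) _ _ (is_series_binomial (- b) (w / v0) Ht))].
intros m; cbv beta; rewrite ipw_shift by easy; fold v0.
unfold Cdiv; rewrite Cpow_mult_l; ring.
Qed.

(** The sum of [(2 PI i j) ^ (- b)] over all nonzero integers [j]. *)
Definition zsum (b : C) : C :=
  CSeries (fun k => ipw (INR (S k)) (- b) + ipw (- INR (S k)) (- b))%C.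

Lemma Rabs_INR_S (k : nat) : Rabs (INR (S k)) = INR (S k).
Proof. apply Rabs_pos_eq, pos_INR. Qed.

Lemma Rabs_opp_INR_S (k : nat) : Rabs (- INR (S k)) = INR (S k).
Proof. rewrite Rabs_Ropp; apply Rabs_INR_S. Qed.

(** Expanding each term of the Lipschitz formula by [shifted_expansion] gives a double
    series, dominated by [k ^ (- Re b)] times the terms of a binomial series at
    [|w| / (2 PI) < 1]. *)
Lemma psum_expansion (b w : C) : 1 < Re b -> 0 < Re w -> Cmod w < 2 * PI ->
  exists S : C, is_series (fun m => binc (- b) m * w ^ m * zsum (b + INR m))%C S /\
    psum b w = (Gamma b * (Cpw w (- b) + S))%C.
Proof.
intros Hb Hw Hw2; pose proof PI_RGT_0 as HPI.
destruct (lipschitz_formula b w Hb Hw Hw2) as (l & Hl & HP).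
apply is_series_C_shift in Hl.
assert (E0 : sterm (fun j => Cpw (shifted w j) (- b)) 0 = Cpw w (- b)).
{ simpl; f_equal; unfold shifted; rewrite Rmult_0_r; ring. }
rewrite E0 in Hl.
set (p := fun k m => (ipw (INR (S k)) (- (b + INR m)) + ipw (- INR (S k)) (- (b + INR m)))%C).
set (q := Cmod w / (2 * PI)).
assert (Hq : 0 <= q < 1).
{ unfold q; split.
  - apply Rmult_le_pos; [apply Cmod_ge_0|left; apply Rinv_0_lt_compat; lra].
  - apply Rmult_lt_reg_r with (2 * PI); [lra|].
    replace (Cmod w / (2 * PI) * (2 * PI)) with (Cmod w) by (field; lra); lra. }
set (B := 2 * exp (2 * Cmod b) * Rpower (2 * PI) (- Re b)).
assert (Hp : forall k m, Cmod (p k m) <=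
  B * Rpower (INR (S k)) (- Re b) * (/ (2 * PI)) ^ m).
{ intros k m; pose proof (INR_S_ge_1 k); unfold p.
  eapply Rle_trans; [apply Cmod_triangle|].
  pose proof (Cmod_ipw (INR (S k)) b m ltac:(rewrite Rabs_INR_S; lra)) as B1.
  pose proof (Cmod_ipw (- INR (S k)) b m ltac:(rewrite Rabs_opp_INR_S; lra)) as B2.
  rewrite Rabs_INR_S in B1; rewrite Rabs_opp_INR_S in B2.
  rewrite <- Rpower_mult_distr in B1, B2 by lra; unfold B; lra. }
assert (HB : 0 <= B).
{ unfold B; apply Rmult_le_pos; [apply Rmult_le_pos; [lra|]|]; left; apply exp_pos. }
destruct (series_swap (fun k m => binc (- b) m * w ^ m * p k m)%C
  (fun k => sterm (fun j => Cpw (shifted w j) (- b)) (S k))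
  (fun k => B * Rpower (INR (S k)) (- Re b)) (fun m => Cmod (binc (- b) m) * q ^ m))
  as (c & S0 & H1 & H2 & H3).
- intros k m; rewrite !Cmod_mult, Cmod_pow.
  replace (Cmod w) with (q * (2 * PI)) by (unfold q; field; lra).
  rewrite Rpow_mult_distr.
  replace (B * Rpower (INR (S k)) (- Re b) * (Cmod (binc (- b) m) * q ^ m)) with
    (Cmod (binc (- b) m) * (q ^ m * (2 * PI) ^ m) *
      (B * Rpower (INR (S k)) (- Re b) * (/ (2 * PI)) ^ m)).
  + apply Rmult_le_compat_l; [|apply Hp].
    repeat apply Rmult_le_pos; try apply Cmod_ge_0; apply pow_le; lra.
  + rewrite pow_inv; field; apply pow_nonzero; lra.
- apply (ex_series_scal_l B (fun k => Rpower (INR (S k)) (- Re b))).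
  now apply ex_series_Rpower.
- now apply binc_summable.
- intros k; apply Rmult_le_pos; [easy|left; apply exp_pos].
- intros m; apply Rmult_le_pos; [apply Cmod_ge_0|apply pow_le; lra].
- intros k; pose proof (INR_S_ge_1 k); unfold sterm, p.
  eapply is_series_C_ext; [|reflexivity|apply is_series_C_plus; apply shifted_expansion;
    try easy; rewrite ?Rabs_opp_INR_S, ?Rabs_INR_S; lra].
  intros m; cbv beta; ring.
- exists S0; split.
  + eapply is_series_C_ext; [|reflexivity|exact H3].
    intros m; apply (is_series_C_unique _ _ _ (H1 m)), is_series_C_scal.
    apply CSeries_correct, (ex_series_Cmod _
      (fun k => B * Rpower (INR (S k)) (- Re b) * (/ (2 * PI)) ^ m)); [intros k; apply Hp|].
    apply (ex_series_scal_r ((/ (2 * PI)) ^ m) (fun k => B * Rpower (INR (S k)) (- Re b))).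
    apply (ex_series_scal_l B (fun k => Rpower (INR (S k)) (- Re b))).
    now apply ex_series_Rpower.
  + rewrite HP; f_equal; rewrite (is_series_C_unique _ _ _ H2 Hl); ring.
Qed.

(** The functional equation, in the form in which it comes out of [psum_expansion]
    at [w = x] and [w = 2 x] as [x] tends to 0: in the alternating sum
    [psum b x - 2 ^ b * psum b (2 x)] the singular terms cancel. *)
Lemma riemann_zeta_left (s : C) : Re s < 0 ->
  riemann_zeta s = (Gamma (1 - s) * zsum (1 - s))%C.
Proof.
intros Hs; set (b := (1 - s)%C).
assert (Hb : 1 < Re b) by (unfold b; rewrite Re_minus, re_RtoC; lra).
pose proof PI2_3_2 as HPI.
set (a := fun m => (binc (- b) m * zsum (b + INR m))%C).
assert (Hexp : forall x, 0 < x -> x < 2 * PI -> exists S : C,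
  is_series (fun m => a m * RtoC x ^ m)%C S /\ psum b x = (Gamma b * (Cpw x (- b) + S))%C).
{ intros x Hx Hx2; destruct (psum_expansion b x Hb) as (S & HS & HP).
  - now rewrite re_RtoC.
  - rewrite Cmod_pos_R; lra.
  - exists S; split; [|easy]; eapply is_series_C_ext; [|reflexivity|exact HS].
    intros m; unfold a; ring. }
assert (Habs : ex_series (fun m => Cmod (a m) * 2 ^ m)).
{ destruct (Hexp 3) as (S3 & HS3 & _); [lra|lra|].
  apply (pser_abs a 3); [now exists S3|rewrite Cmod_pos_R; lra]. }
destruct (pser_continuous_0 a 2 ltac:(lra) Habs) as [K HK].
assert (Ha0 : a 0%nat = zsum b).
{ unfold a; simpl; replace (b + 0)%C with b by ring; ring. }
set (x := fun N => / INR (S N)).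
assert (Hx : forall N, 0 < x N <= 1).
{ exact inv_INR_S_bound. }
set (A := fun N => CSeries (fun n => (-1) ^ n * Rcpow (INR (S n)) (- s) * qseq N ^ n)%C).
assert (HA : forall N, is_series (fun n => (-1) ^ n * Rcpow (INR (S n)) (- s) * qseq N ^ n)%C (A N)).
{ intros N; apply CSeries_correct; exact (ex_series_alt_qseq 0 s N). }
pose proof (riemann_zeta_Abel s A Hs HA) as Hzeta; fold b in Hzeta.
assert (HAN : forall N, exists S1 S2 : C,
  is_series (fun m => a m * RtoC (x N) ^ m)%C S1 /\
  is_series (fun m => a m * RtoC (2 * x N) ^ m)%C S2 /\
  A N = (/ qseq N * (Gamma b * (S1 - Rcpow 2 b * S2)))%C).
{ intros N; specialize (Hx N); pose proof (qseq_bound N) as Hq.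
  destruct (Hexp (x N)) as (S1 & HS1 & HP1); [lra|lra|].
  destruct (Hexp (2 * x N)) as (S2 & HS2 & HP2); [lra|lra|].
  exists S1, S2; split; [easy|split; [easy|]].
  assert (Hqz : RtoC (qseq N) <> RtoC 0) by (apply RtoC_neq_0; lra).
  assert (Hlap : forall n, lap b (x N) (INR (S n)) =
    (Rcpow (INR (S n)) (- s) * (qseq N * qseq N ^ n))%C).
  { intros n; unfold lap; replace (b - 1)%C with (- s)%C by (unfold b; ring); f_equal.
    rewrite <- Cpow_S, <- RtoC_pow, qseq_pow, <- Cexp_RtoC; f_equal.
    rewrite RtoC_mult, RtoC_opp; easy. }
  assert (HT : is_series (fun n => (-1) ^ n * lap b (x N) (INR (S n)))%C (qseq N * A N)%C).
  { eapply is_series_C_ext; [|reflexivity|apply (is_series_C_scal (qseq N) _ _ (HA N))].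
    intros n; cbv beta; rewrite Hlap; ring. }
  assert (HE : is_series (fun k => lap b (x N) (INR (S (2 * k + 1))))
    (Rcpow 2 (b - 1) * psum b (2 * x N)%R)%C).
  { eapply is_series_C_ext; [|reflexivity|apply (is_series_C_scal (Rcpow 2 (b - 1)) _ _
      (psum_series b (2 * x N)%R ltac:(rewrite re_RtoC; lra)))].
    intros k; cbv beta; unfold lap.
    replace (INR (S (2 * k + 1))) with (2 * INR (S k))
      by (rewrite !S_INR, plus_INR, mult_INR; simpl; ring).
    rewrite Rcpow_mult by (try apply lt_0_INR; lia || lra).
    rewrite <- Cmult_assoc; do 3 f_equal; rewrite !RtoC_mult; ring. }
  pose proof (alternating_split _ _ _ _ (psum_series b (x N) ltac:(rewrite re_RtoC; lra)) HT HE)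
    as Hsplit.
  assert (E2 : (2 * Rcpow 2 (b - 1))%C = Rcpow 2 b).
  { rewrite <- (Rcpow_1 2) at 1 by lra; rewrite <- Rcpow_plus; f_equal; ring. }
  assert (Epw : (Rcpow 2 b * Cpw (2 * x N)%R (- b))%C = Cpw (x N) (- b)).
  { unfold Cpw, Rcpow; rewrite !Clog_RtoC, ln_mult, RtoC_plus, <- Cexp_plus by lra.
    f_equal; ring. }
  replace (A N) with (/ qseq N * (qseq N * A N))%C by (field; easy).
  rewrite Hsplit, Cmult_assoc, E2, HP1, HP2; f_equal.
  replace (Gamma b * (Cpw (x N) (- b) + S1) - Rcpow 2 b * (Gamma b * (Cpw (2 * x N)%R (- b) + S2)))%C
    with (Gamma b * (Cpw (x N) (- b) - Rcpow 2 b * Cpw (2 * x N)%R (- b) + S1 - Rcpow 2 b * S2))%C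
    by ring.
  rewrite Epw; ring. }
assert (Hlim : Clim A (1 * (Gamma b * (zsum b - Rcpow 2 b * zsum b)))).
{ destruct (choice _ HAN) as [S1 HS1]; destruct (choice _ HS1) as [S2 HS2].
  assert (Hpow : forall (c : R) (S : nat -> C), 0 < c <= 2 ->
    (forall N, is_series (fun m => a m * RtoC (c * x N) ^ m)%C (S N)) -> Clim S (zsum b)).
  { intros c S Hc HS; apply (Clim_le _ _ (fun N => K * c * x N)).
    - intros N; specialize (Hx N).
      assert (Hcx : 0 < c * x N) by (apply Rmult_lt_0_compat; lra).
      pose proof (HK (c * x N)%R (S N) ltac:(rewrite Cmod_pos_R; nra) (HS N)) as H.
      rewrite Ha0, (Cmod_pos_R (c * x N)) in H by lra; lra.
    - apply is_lim_seq_scal_0, is_lim_seq_inv_S. }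
  apply (Clim_ext (fun N => RtoC (/ qseq N) * (Gamma b * (S1 N - Rcpow 2 b * S2 N)))%C).
  { intros N; rewrite (proj2 (proj2 (HS2 N))), RtoC_inv; [easy|].
    pose proof (qseq_bound N); lra. }
  apply Clim_mult.
  - apply Clim_RtoC; replace (Finite 1) with (Rbar_inv 1) by (simpl; f_equal; apply Rinv_1).
    apply is_lim_seq_inv; [apply qseq_lim|intros E; injection E; lra].
  - apply Clim_scal, Clim_minus; [|apply Clim_scal].
    + apply (Hpow 1); [lra|]; intros N; rewrite Rmult_1_l; apply HS2.
    + apply (Hpow 2); [lra|]; intros N; apply HS2. }
pose proof (Clim_unique _ _ _ Hzeta Hlim) as E.
pose proof (one_minus_2pow_neq_0 s ltac:(lra)) as Hnz; fold b in Hnz.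
replace (riemann_zeta s) with ((1 - Rcpow 2 b) * riemann_zeta s / (1 - Rcpow 2 b))%C
  by (field; easy).
rewrite E; field; easy.
Qed.

Lemma Gamma_rising (b : C) (m : nat) : 1 <= Re b ->
  Gamma (b + INR m) = (Gamma b * binc (- b) m * (-1) ^ m * INR (fact m))%C.
Proof.
intros Hb; induction m as [|m IH].
- simpl; replace (b + 0)%C with b by ring; ring.
- rewrite S_INR, RtoC_plus, Cplus_assoc, Gamma_S, IH.
  + rewrite binc_S, Cpow_S, fact_simpl, mult_INR, RtoC_mult.
    replace (RtoC (INR (S m))) with (INR m + 1)%C by (now rewrite S_INR, RtoC_plus).
    assert (Hnz : (INR m + 1)%C <> RtoC 0).
    { rewrite <- RtoC_plus, <- S_INR; apply RtoC_neq_0, not_0_INR; lia. }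
    field; exact Hnz.
  + rewrite re_plus, re_RtoC; pose proof (pos_INR m); lra.
Qed.

(** The argument in [(0, 2 PI)] of [z] exceeds the principal argument of [- z] by
    [PI]. *)
Lemma Clog_opp (z : C) : Re z < 0 ->
  Clog (- z) = (ln (Cmod z) + Ci * arg z - Ci * PI)%C.
Proof.
intros Hz; pose proof PI_RGT_0.
destruct (arg_spec z) as [Ha Ez]; [intros [_ H0]; lra|].
assert (Hpos : 0 < Cmod z) by (apply Cmod_gt_0; intros E; rewrite E in Hz; simpl in Hz; lra).
apply Cexp_inj.
- rewrite Cexp_Clog by (rewrite re_opp; lra).
  rewrite Cexp_minus, Cexp_plus, (Cexp_Ci PI), cos_PI, sin_PI, Cexp_RtoC, exp_ln by easy.
  rewrite Ez at 1.
  replace ((-1)%R, 0%R) with (RtoC (-1)) by easy; field; apply RtoC_neq_0; lra.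
- replace (Im (ln (Cmod z) + Ci * arg z - Ci * PI)) with (arg z - PI) by (simpl; ring).
  pose proof (Im_Clog_bound (- z)); apply Rabs_def1; lra.
Qed.

Theorem corollary1p2 (alpha : C) (alpha_nonint : forall k : Z, alpha <> RtoC (IZR k))
    (alpha_neg : Re alpha < 0)
    (z : C) (z_neg : Re z < 0) (z_lt : Cmod z < 2 * PI) :
  ex_series (fun n : nat => riemann_zeta (alpha - INR n) / INR (fact n) * z ^ n)%C /\
  polylog alpha (Cexp z) =
    (C_alpha alpha * Cpower z (alpha - 1)
     + CSeries (fun n : nat => riemann_zeta (alpha - INR n) / INR (fact n) * z ^ n))%C.
Proof.
set (b := (1 - alpha)%C).
assert (Hb : 1 < Re b) by (unfold b; rewrite Re_minus, re_RtoC; lra).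
destruct (psum_expansion b (- z)) as (S & HS & HP).
{ easy. }
{ rewrite re_opp; lra. }
{ now rewrite Cmod_opp. }
assert (Hser : is_series (fun n => riemann_zeta (alpha - INR n) / INR (fact n) * z ^ n)%C
  (Gamma b * S)%C).
{ eapply is_series_C_ext; [|reflexivity|apply (is_series_C_scal (Gamma b) _ _ HS)].
  intros n; cbv beta.
  rewrite riemann_zeta_left by (rewrite Re_minus, re_RtoC; pose proof (pos_INR n); lra).
  replace (1 - (alpha - INR n))%C with (b + INR n)%C by (unfold b; ring).
  rewrite Gamma_rising by lra.
  replace (- z)%C with ((-1) * z)%C by ring; rewrite Cpow_mult_l.
  field; apply RtoC_neq_0, INR_fact_neq_0. }
split; [eexists; exact Hser|].
rewrite (is_series_CSeries _ _ Hser).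
assert (Epoly : polylog alpha (Cexp z) = psum b (- z)).
{ unfold polylog, psum; f_equal.
  apply FunctionalExtensionality.functional_extensionality; intros n.
  unfold lap; replace (b - 1)%C with (- alpha)%C by (unfold b; ring).
  rewrite Rcpow_opp, <- Cexp_nat; unfold Cdiv; rewrite Cmult_comm; do 2 f_equal; ring. }
assert (Esing : (C_alpha alpha * Cpower z (alpha - 1))%C = (Gamma b * Cpw (- z) (- b))%C).
{ unfold C_alpha, Cpower, Cpw; fold b; rewrite Clog_opp by easy.
  (* the two exponents differ by [2 PI i] *)
  replace (Gamma b) with (Gamma b * Cexp (Ci * RtoC (2 * PI * IZR (-1))))%C at 2
    by (rewrite Cexp_2PI_Z; ring).
  rewrite (Cmult_comm (Cexp _) (Gamma b)), <- !Cmult_assoc, <- !Cexp_plus.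
  do 2 f_equal; unfold b; rewrite !RtoC_mult.
  replace (Ci * PI)%C with (PI * Ci)%C by ring.
  replace (RtoC (-1)) with (- (1))%C by (now rewrite <- RtoC_opp).
  replace (RtoC 2) with (1 + 1)%C by (now rewrite <- RtoC_plus).
  ring. }
rewrite Epoly, HP, Esing; ring.
Qed.
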